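(* Let $(M,J,\beta)$ be a complex manifold endowed with a holomorphic Poisson structure $\beta$, $(\mathfrak g,\langle\cdot,\cdot\rangle_{\mathfrak g})$ a quadratic Lie algebra endowed with a skew-symmetric (integrable) complex structure $J_{\mathfrak g}$ and $\rho:\pi_1(M)\to\mathrm{Aut}(\mathfrak g,\langle\cdot,\cdot\rangle_{\mathfrak g},J_{\mathfrak g})$ a representation. Then these data define a generalised complex structure $\mathcal J$ on the untwisted Courant algebroid $E=\mathbb TM\oplus\mathcal G$ with the flat bundle of quadratic Lie algebras $\mathcal G=\widetilde M\times_\rho\mathfrak g$. The generalised complex structure $\mathcal J$ has components $J$, $B=\beta+\bar\beta$ and $A$, and all other components equal to zero; here $A$ is the parallel field of skew-symmetric complex structures on the fibers of $\mathcal G$ associated with $J_{\mathfrak g}$. Moreover, $\mathcal J$ is non-degenerate precisely on the complement of the hypersurface $\{\det\beta=0\}$, where $\beta$ is considered here as a map $\bigwedge^{1,0}T^*M\to T^{1,0}M$ (such that $\det\beta$ is a holomorphic section of $\det(T^{1,0}M)^{\otimes2}$, the square of the anti-canonical line bundle).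
   Context: Manifolds are connected. $\mathbb TM=TM\oplus T^*M$. A quadratic Lie algebra is a finite-dimensional real Lie algebra with ad-invariant scalar product (non-degenerate symmetric bilinear form). A skew-symmetric integrable complex structure on $\mathfrak g$ is $J_{\mathfrak g}\in\mathrm{End}(\mathfrak g)$ with $J_{\mathfrak g}^2=-\mathrm{Id}$, skew with respect to $\langle\cdot,\cdot\rangle_{\mathfrak g}$, whose $i$-eigenspace in $\mathfrak g^{\mathbb C}$ is a Lie subalgebra. $\mathrm{Aut}(\mathfrak g,\langle\cdot,\cdot\rangle_{\mathfrak g},J_{\mathfrak g})$ is the group of Lie algebra automorphisms preserving $\langle\cdot,\cdot\rangle_{\mathfrak g}$ and commuting with $J_{\mathfrak g}$. $\widetilde M$ is the universal cover of $M$. For a bundle $\mathcal G$ of quadratic Lie algebras with a flat connection $\nabla$ preserving bracket and scalar product, the untwisted Courant algebroid $E=\mathbb TM\oplus\mathcal G$ has anchor the projection $\pi:E\to TM$, scalar product $\langle X+\xi+r,Y+\eta+\tilde r\rangle=\frac12(\eta(X)+\xi(Y))+\langle r,\tilde r\rangle_{\mathcal G}$ and Dorfman bracket $[X,Y]=\mathcal L_XY$, $[X,r]=\nabla_Xr$, $[r_1,r_2]=2\langle\nabla r_1,r_2\rangle_{\mathcal G}+[r_1,r_2]_{\mathcal G}$, $[X,\eta]=\mathcal L_X\eta$, $[\eta_1,\eta_2]=[r,\eta]=0$, together with $[u,v]+[v,u]=2d\langle u,v\rangle$. Unless otherwise stated Courant algebroids are of neutral signature. On $\mathcal G=\widetilde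 M\times_\rho\mathfrak g$ one uses the canonical flat connection. A generalised complex structure on $E$ is a skew-symmetric $\mathcal J\in\Gamma(\mathrm{End}\,E)$ with $\mathcal J^2=-\mathrm{Id}$ whose $i$-eigenbundle in $E^{\mathbb C}$ has sections closed under the Dorfman bracket. Its components $J,A,B,C,\mu,\nu$ are defined by $\mathcal JX=JX+CX+\mu X$, $\mathcal J\xi=B\xi-J^*\xi+\nu\xi$, $\mathcal Jr=-\nu^*r-\mu^*r+Ar$ ($*$ = adjoint for the scalar product of $E$; on $J$ the dual map). So here $\mathcal JX=JX$, $\mathcal J\xi=B\xi-J^*\xi$, $\mathcal Jr=Ar$, with the bivector $B$ viewed as a map $T^*M\to TM$ via $\eta(B\xi)=B(\xi,\eta)$. $\mathcal J$ is non-degenerate at a point $p$ if $B_p:T^*_pM\to T_pM$ is bijective. *)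

(* Defs.v *)
From HB Require Import structures.
From mathcomp Require Import all_boot all_order all_algebra.
From mathcomp Require Import complex.
From mathcomp Require Import all_classical all_reals all_analysis.
Import Order.TTheory GRing.Theory Num.Theory.
Import numFieldNormedType.Exports.

Set Implicit Arguments.
Unset Strict Implicit.
Unset Printing Implicit Defensive.

Local Open Scope classical_set_scope.
Local Open Scope ring_scope.

Section Calculus.
Context {R : realType} {m : nat}.
Local Notation V := 'rV[R]_m.

(** [U] is meant to be open. *)
Fixpoint Ck (k : nat) (U : set V) (f : V -> R^o) : Prop :=
  if k is k'.+1 then
    (forall x, U x -> differentiable f x) /\
    (forall v : V, Ck k' U (fun x => 'D_v f x))
  else forall x, U x -> {for x, continuous f}.

Definition smooth_on (U : set V) (f : V -> R^o) : Prop := forall k, Ck k U f.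

(** A finite-dimensional real vector space [W] carries no norm in the library:
    smoothness and derivatives of [W]-valued maps are taken coordinatewise with
    respect to the basis [vbasis fullv] (the choice is immaterial). *)
Definition vcoord (W : vectType R) (i : 'I_(\dim {: W})) (w : W) : R^o :=
  coord (vbasis {: W}) i w.

Definition smooth_at (W : vectType R) (a : V) (f : V -> W) : Prop :=
  exists U : set V,
    [/\ open U, U a & forall i, smooth_on U (fun x => vcoord i (f x))].

Definition vD (W : vectType R) (v : V) (f : V -> W) (a : V) : W :=
  \sum_i ('D_v (fun x => vcoord i (f x)) a) *: (vbasis {: W})`_i.

(** Vectors and covectors are both rows of components. *)
Definition pairing (xi X : V) : R^o := (X *m xi^T) 0 0.

Definition basis_vec (j : 'I_m) : V := delta_mx 0 j.

Definition dual_map (f : V -> V) (xi : V) : V :=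
  \row_j pairing xi (f (basis_vec j)).

Definition lie_bracket (X Y : V -> V) (a : V) : V :=
  'D_(X a) Y a - 'D_(Y a) X a.

Definition lie_derivative (X eta : V -> V) (a : V) : V :=
  'D_(X a) eta a + \row_j pairing (eta a) ('D_(basis_vec j) X a).

Definition differential (f : V -> R^o) (a : V) : V :=
  \row_j 'D_(basis_vec j) f a.

End Calculus.

Section Holomorphic.
Context {R : realType} {n : nat}.
(** C^n is R^n x R^n, the point [z = x + iy] being [row_mx x y]. *)
Local Notation V := 'rV[R]_(n + n).

Definition zcoord (k : 'I_n) (v : V) : R[i] :=
  Complex (v 0 (lshift n k)) (v 0 (rshift n k)).

(** The complex structure of a complex manifold, read in any holomorphic chart. *)
Definition mul_i (v : V) : V := row_mx (- rsubmx v) (lsubmx v).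

Definition cderive (v : V) (f : V -> R[i]) (a : V) : R[i] :=
  Complex ('D_v (fun x => complex.Re (f x) : R^o) a)
          ('D_v (fun x => complex.Im (f x) : R^o) a).

Let dx (j : 'I_n) := cderive (basis_vec (lshift n j)).
Let dy (j : 'I_n) := cderive (basis_vec (rshift n j)).

Definition dz (j : 'I_n) (f : V -> R[i]) (a : V) : R[i] :=
  (dx j f a - Complex 0 1 * dy j f a) / 2%:R.
Definition dzbar (j : 'I_n) (f : V -> R[i]) (a : V) : R[i] :=
  (dx j f a + Complex 0 1 * dy j f a) / 2%:R.

Definition holomorphic_on (U : set V) (f : V -> R[i]) : Prop :=
  [/\ smooth_on U (fun x => complex.Re (f x)),
      smooth_on U (fun x => complex.Im (f x)) &
      forall x j, U x -> dzbar j f x = 0].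

End Holomorphic.

Record chart (R : realType) (M : Type) (m : nat) := Chart {
  chart_dom : set M;
  chart_fwd : M -> 'rV[R]_m;
  chart_bwd : 'rV[R]_m -> M }.

Definition chart_img (R : realType) (M : Type) (m : nat) (phi : chart R M m) :
  set 'rV[R]_m := chart_fwd phi @` chart_dom phi.

Definition is_chart (R : realType) (M : topologicalType) (m : nat)
    (phi : chart R M m) : Prop :=
  [/\ open (chart_dom phi),
      open (chart_img phi),
      (forall p, chart_dom phi p -> chart_bwd phi (chart_fwd phi p) = p),
      {within chart_dom phi, continuous (chart_fwd phi)} &
      {within chart_img phi, continuous (chart_bwd phi)}].

Definition transition (R : realType) (M : Type) (m : nat)
  (phi psi : chart R M m) : 'rV[R]_m -> 'rV[R]_m :=
  chart_fwd psi \o chart_bwd phi.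

Record complex_manifold (R : realType) (n : nat) := ComplexManifold {
  carrier :> topologicalType;
  atlas_index : Type;
  atlas : atlas_index -> chart R carrier (n + n);
  carrier_hausdorff : hausdorff_space carrier;
  carrier_second_countable : @second_countable carrier;
  carrier_connected : connected [set: carrier];
  atlas_chart : forall i, is_chart (atlas i);
  atlas_cover : forall p, exists i, chart_dom (atlas i) p;
  atlas_holomorphic : forall i j k, holomorphic_on
        (chart_fwd (atlas i) @` (chart_dom (atlas i) `&` chart_dom (atlas j)))
        (fun x => zcoord k (transition (atlas i) (atlas j) x)) }.

Section Paths.
Context {R : realType} {M : topologicalType}.
Implicit Types c d : R -> M.

(** Only the restriction of [c] to [0, 1] matters. *)
Definition is_path c (p q : M) : Prop :=
  [/\ {within `[0, 1]%classic, continuous c}, c 0 = p & c 1 = q].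

Definition homotopic c d : Prop :=
  exists H : R * R -> M,
    {within (`[0, 1]%classic `*` `[0, 1]%classic), continuous H} /\
    (forall t, 0 <= t <= 1 ->
      [/\ H (0, t) = c t, H (1, t) = d t, H (t, 0) = c 0 & H (t, 1) = c 1]).

(** First [c], then [d]. *)
Definition path_cat c d : R -> M :=
  fun t => if t <= 2%:R^-1 then c (2%:R * t) else d (2%:R * t - 1).

End Paths.

Record quadratic_lie_algebra (R : realType) := QuadraticLieAlgebra {
  qla_space :> vectType R;
  qla_br : qla_space -> qla_space -> qla_space;
  qla_sp : qla_space -> qla_space -> R;
  qla_br_linl : forall (a : R) x y z, qla_br (a *: x + y) z = a *: qla_br x z + qla_br y z;
  qla_br_linr : forall (a : R) x y z, qla_br z (a *: x + y) = a *: qla_br z x + qla_br z y;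
  qla_brxx : forall x, qla_br x x = 0;
  qla_jacobi : forall x y z, qla_br x (qla_br y z) + qla_br y (qla_br z x)
                    + qla_br z (qla_br x y) = 0;
  qla_sp_linl : forall (a : R) x y z, qla_sp (a *: x + y) z = a * qla_sp x z + qla_sp y z;
  qla_sp_sym : forall x y, qla_sp x y = qla_sp y x;
  qla_sp_nondeg : forall x, (forall y, qla_sp x y = 0) -> x = 0;
  qla_sp_ad : forall x y z, qla_sp (qla_br x y) z + qla_sp y (qla_br x z) = 0 }.

(** An element [x + i y] of the complexification of [W] is the pair [(x, y)]. *)
Definition complexified_bracket (W : zmodType) (br : W -> W -> W)
    (u v : W * W) : W * W :=
  (br u.1 v.1 - br u.2 v.2, br u.1 v.2 + br u.2 v.1).

Definition i_eigen (W : zmodType) (T : W -> W) (u : W * W) : Prop :=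
  T u.1 = - u.2 /\ T u.2 = u.1.

Section LieAlgebra.
Context {R : realType} (g : quadratic_lie_algebra R).

Definition skew_complex_structure (Jg : 'End(g)) : Prop :=
  [/\ forall x, Jg (Jg x) = - x,
      forall x y, qla_sp (Jg x) y = - qla_sp x (Jg y) &
      forall u v : g * g, i_eigen Jg u -> i_eigen Jg v ->
        i_eigen Jg (complexified_bracket (@qla_br R g) u v)].

Definition qla_automorphism (Jg f : 'End(g)) : Prop :=
  [/\ bijective f,
      forall x y, f (qla_br x y) = qla_br (f x) (f y),
      forall x y, qla_sp (f x) (f y) = qla_sp x y &
      forall x, f (Jg x) = Jg (f x)].

End LieAlgebra.

Section Bundles.
Context {R : realType} {n : nat} (M : complex_manifold R n) (m0 : M).
Context (g : quadratic_lie_algebra R).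

Local Notation V := 'rV[R]_(n + n).
Local Notation I := (atlas_index M).
Local Notation at_ i := (@atlas R n M i).
Local Notation E := (V * V * g)%type.

Definition is_loop (gamma : R -> M) : Prop := is_path gamma m0 m0.

(** A representation of pi_1(M, m0) by automorphisms, as a homotopy-invariant
    and multiplicative function on loops. *)
Definition pi1_representation (Jg : 'End(g)) (rho : (R -> M) -> 'End(g)) : Prop :=
  [/\ forall gamma, is_loop gamma -> qla_automorphism Jg (rho gamma),
      forall gamma delta, is_loop gamma -> is_loop delta ->
        homotopic gamma delta -> rho gamma = rho delta &
      forall gamma delta, is_loop gamma -> is_loop delta ->
        forall x, rho (path_cat gamma delta) x = rho gamma (rho delta x)].

(** The points over [p] of the universal cover are the homotopy classes of paths
    [c] from [m0] to [p]; pi_1(M, m0) acts on them on the left by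
    [[gamma] . [c] = [path_cat gamma c]]. The fibre at [p] of the associated
    bundle (universal cover) x_rho g is thereby identified with [g] as soon as
    such a [c] is chosen, and the fibre at [p] of [TM + T*M + (bundle)] is
    identified with [V * V * g] by a frame: a chart at [p] together with a path
    from [m0] to [p]. *)
Definition is_frame (i : I) (c : R -> M) : Prop :=
  is_path c m0 (c 1) /\ chart_dom (at_ i) (c 1).

(** A field of objects of type [W]: its components in all frames. *)
Definition field (W : Type) := I -> (R -> M) -> W.

(** The path going from [c 1] to the point of coordinates [x], along a line
    segment in the coordinates [i]. For [x] close to the coordinates of [c 1],
    [x |-> path_cat c (segment i c x)] is the local inverse of the universal
    covering map sending [c 1] to [c], read in the chart. *)
Definition segment (i : I) (c : R -> M) (x : V) : R -> M :=
  fun t => chart_bwd (at_ i) ((1 - t) *: chart_fwd (at_ i) (c 1) + t *: x).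

Definition coords (i : I) (c : R -> M) : V := chart_fwd (at_ i) (c 1).

(** Local expression of a field around [c 1]; frames over neighbouring points
    use the flat local trivialisation of the associated bundle given by [c]. *)
Definition local (W : Type) (F : field W) (i : I) (c : R -> M) (x : V) : W :=
  F i (path_cat c (segment i c x)).

Definition smooth_field (W : vectType R) (F : field W) : Prop :=
  forall i c, is_frame i c -> smooth_at (coords i c) (local F i c).

Definition homotopy_invariant (W : Type) (F : field W) : Prop :=
  forall i c d, is_frame i c -> is_path d m0 (d 1) -> homotopic c d ->
    F i c = F i d.

Definition real_jacobian (i j : I) (p : M) : 'M[R]_(n + n) :=
  jacobian (transition (at_ i) (at_ j)) (chart_fwd (at_ i) p).

Definition hol_jacobian (i j : I) (p : M) : 'M[R[i]]_n :=
  \matrix_(a, b) dz a (fun x => zcoord b (transition (at_ i) (at_ j) x))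
                    (chart_fwd (at_ i) p).

Variable rho : (R -> M) -> 'End(g).

(** Passage from the components in the frame [(i, c)] to the components in the
    frame [(j, path_cat gamma c)], where [p = c 1]. *)
Definition frame_change (i j : I) (gamma : R -> M) (p : M) (u : E) : E :=
  (u.1.1 *m real_jacobian i j p, u.1.2 *m (real_jacobian j i p)^T,
   rho gamma u.2).

Definition is_section (u : field E) : Prop :=
  [/\ homotopy_invariant u,
      forall i j gamma c, is_loop gamma -> is_frame i c ->
        chart_dom (at_ j) (c 1) ->
        u j (path_cat gamma c) = frame_change i j gamma (c 1) (u i c) &
      smooth_field u].

Definition is_end_section (T : field 'End(E)) : Prop :=
  [/\ homotopy_invariant T,
      forall i j gamma c, is_loop gamma -> is_frame i c ->
        chart_dom (at_ j) (c 1) ->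
        forall u : E, T j (path_cat gamma c) (frame_change i j gamma (c 1) u) =
                      frame_change i j gamma (c 1) (T i c u) &
      smooth_field T].

Definition courant_sp (u v : E) : R :=
  2%:R^-1 * (pairing v.1.2 u.1.1 + pairing u.1.2 v.1.1) + qla_sp u.2 v.2.

(** [[X + xi + r, Y + eta + s] = [X, Y] + (L_X eta - L_Y xi + d(xi(Y))
     + 2 <nabla r, s>) + (nabla_X s - nabla_Y r + [r, s])], which is the bilinear
    bracket determined by its values on [(X, Y)], [(X, eta)], [(X, s)], [(r, s)],
    [(r, eta)], [(xi, eta)] and by [[u, v] + [v, u] = 2 d<u, v>]. The canonical
    flat connection is differentiation in the local trivialisations. *)
Definition dorfman (u v : field E) : field E := fun i c =>
  let a := coords i c in
  let X := fun x => (local u i c x).1.1 in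
  let xi := fun x => (local u i c x).1.2 in
  let r := fun x => (local u i c x).2 in
  let Y := fun x => (local v i c x).1.1 in
  let eta := fun x => (local v i c x).1.2 in
  let s := fun x => (local v i c x).2 in
  (lie_bracket X Y a,
   lie_derivative X eta a - lie_derivative Y xi a
     + differential (fun x => pairing (xi x) (Y x)) a
     + \row_j (2%:R * qla_sp (vD (basis_vec j) r a) (s a)),
   vD (X a) s a - vD (Y a) r a + qla_br (r a) (s a)).

(** Sections [u.1 + i u.2] of the i-eigenbundle of [T]. *)
Definition is_eigensection (T : field 'End(E)) (u : field E * field E) : Prop :=
  [/\ is_section u.1, is_section u.2 &
      forall i c, is_frame i c -> i_eigen (T i c) (u.1 i c, u.2 i c)].

Definition generalised_complex (T : field 'End(E)) : Prop :=
  [/\ is_end_section T,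
      forall i c, is_frame i c ->
        forall u v, courant_sp (T i c u) v = - courant_sp u (T i c v),
      forall i c, is_frame i c -> forall u, T i c (T i c u) = - u &
      forall u v, is_eigensection T u -> is_eigensection T v ->
        is_eigensection T (complexified_bracket dorfman u v)].

(** The remaining blocks of a skew-symmetric endomorphism are minus the adjoints
    of these. *)
Definition comp_J (T : 'End(E)) (X : V) : V := (T (X, 0, 0)).1.1.
Definition comp_C (T : 'End(E)) (X : V) : V := (T (X, 0, 0)).1.2.
Definition comp_mu (T : 'End(E)) (X : V) : g := (T (X, 0, 0)).2.
Definition comp_B (T : 'End(E)) (xi : V) : V := (T (0, xi, 0)).1.1.
Definition comp_nu (T : 'End(E)) (xi : V) : g := (T (0, xi, 0)).2.
Definition comp_A (T : 'End(E)) (r : g) : g := (T (0, 0, r)).2.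

Definition has_components (T : field 'End(E)) (J B : I -> M -> V -> V)
    (A : (R -> M) -> 'End(g)) (C : I -> M -> V -> V) (mu nu : field (V -> g)) :
    Prop :=
  forall i c, is_frame i c ->
    [/\ comp_J (T i c) =1 J i (c 1), comp_B (T i c) =1 B i (c 1) &
        comp_A (T i c) =1 A c] /\
    [/\ comp_C (T i c) =1 C i (c 1), comp_mu (T i c) =1 mu i c &
        comp_nu (T i c) =1 nu i c].

Definition nondegenerate_at (T : field 'End(E)) (p : M) : Prop :=
  forall i c, is_frame i c -> c 1 = p -> bijective (comp_B (T i c)).

(** A parallel section, with respect to the flat connection, of the bundle of
    endomorphisms of the associated bundle. *)
Definition parallel_complex_structure (A : (R -> M) -> 'End(g)) : Prop :=
  [/\ homotopy_invariant (fun _ => A),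
      forall gamma c, is_loop gamma -> is_path c m0 (c 1) ->
        forall x, A (path_cat gamma c) (rho gamma x) = rho gamma (A c x),
      smooth_field (fun _ => A),
      forall i c, is_frame i c -> forall v,
        vD v (local (fun _ => A) i c) (coords i c) = 0 &
      forall c, is_path c m0 (c 1) -> skew_complex_structure (A c)].

End Bundles.

Section Poisson.
Context {R : realType} {n : nat} (M : complex_manifold R n).

Local Notation V := 'rV[R]_(n + n).
Local Notation I := (atlas_index M).
Local Notation at_ i := (@atlas R n M i).

(** The bivector field of components [b i p], i.e.
    [1/2 sum_(k, l) (b i p) k l d/dz_k /\ d/dz_l] in the chart [i]; the last
    condition is the vanishing of its Schouten bracket with itself. *)
Definition holomorphic_poisson (b : I -> M -> 'M[R[i]]_n) : Prop :=
  let bl i k l := fun x => b i (chart_bwd (at_ i) x) k l in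
  [/\ forall i p, chart_dom (at_ i) p -> (b i p)^T = - b i p,
      forall i j p, chart_dom (at_ i) p -> chart_dom (at_ j) p ->
        b j p = (hol_jacobian i j p)^T *m b i p *m hol_jacobian i j p,
      forall i k l, holomorphic_on (chart_img (at_ i)) (bl i k l) &
      forall i x j k l, chart_img (at_ i) x ->
        \sum_h (bl i j h x * dz h (bl i k l) x +
                bl i k h x * dz h (bl i l j) x +
                bl i l h x * dz h (bl i j k) x) = 0].

(** [xi (d/dz_k)] for a real covector [xi]. *)
Definition cov_dz (xi : V) (k : 'I_n) : R[i] :=
  Complex (xi 0 (lshift n k)) (- xi 0 (rshift n k)) / 2%:R.

Definition beta_form (b : 'M[R[i]]_n) (xi eta : V) : R[i] :=
  \sum_k \sum_l b k l * cov_dz xi k * cov_dz eta l.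

(** The real bivector [beta + conj beta] evaluated on two real covectors. *)
Definition B_form (b : 'M[R[i]]_n) (xi eta : V) : R :=
  complex.Re (beta_form b xi eta + conjc (beta_form b xi eta)).

(** [eta (B xi) = B (xi, eta)] *)
Definition B_map (b : 'M[R[i]]_n) (xi : V) : V :=
  \row_j B_form b xi (basis_vec j).

(** [b i p] is also the matrix, for the bases [dz_k] and [d/dz_l], of
    [beta : T*^(1,0) -> T^(1,0)]. *)
Definition det_beta (b : I -> M -> 'M[R[i]]_n) (i : I) (p : M) : R[i] :=
  \det (b i p).

(** Holomorphic sections of the square of [det T^(1,0)M], in the local frames
    [(d/dz_1 /\ ... /\ d/dz_n)^2]. *)
Definition holomorphic_anticanonical_sq (f : I -> M -> R[i]) : Prop :=
  (forall i, holomorphic_on (chart_img (at_ i))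
               (fun x => f i (chart_bwd (at_ i) x))) /\
  (forall i j p, chart_dom (at_ i) p -> chart_dom (at_ j) p ->
     f j p = \det (hol_jacobian i j p) ^+ 2 * f i p).

Definition zero_locus (f : I -> M -> R[i]) : set M :=
  [set p | exists2 i, chart_dom (at_ i) p & f i p = 0].

Context (g : quadratic_lie_algebra R).
Local Notation E := (V * V * g)%type.

Definition poisson_gcs (b : I -> M -> 'M[R[i]]_n) (Jg : 'End(g)) :
    field M 'End(E) := fun i c =>
  linfun (fun u : E => (mul_i u.1.1 + B_map (b i (c 1)) u.1.2,
                        - dual_map mul_i u.1.2, Jg u.2) : E).

End Poisson.

(* Main.v *)
Require Import Defs.
From HB Require Import structures.
From mathcomp Require Import all_boot all_order all_algebra.
From mathcomp Require Import complex.
From mathcomp Require Import all_classical all_reals all_analysis.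
From mathcomp Require Import ring lra.
Import Order.TTheory GRing.Theory Num.Theory.
Import numFieldNormedType.Exports.

(** The algebraic conditions on the endomorphism
    [T (X + xi + r) = (J X + B xi) - J^* xi + Jg r] are pointwise. In complex
    coordinates a real covector is the complex row [cov_dz] of its (1,0)-part, a real
    vector is the complex row [zcoord], and the map of [B = beta + conj beta] is right
    multiplication by the matrix of [beta] ([zcoord_B_map]). Hence [J B = B J^*], which
    with the skewness of [beta] gives [T^2 = -1] and the skewness of [T]; and [B] is
    bijective exactly where the determinant of [beta] is not zero ([B_map_bijective]).
    Differentials of holomorphic transition maps are complex linear, so [T] is
    compatible with changes of frame; along loops this is the hypothesis that the
    representation commutes with [Jg].

    Integrability. A section of the i-eigenbundle is [T u + i u] with [u] real, so
    closure under the bracket amounts to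
    [T ([T u, v] + [u, T v]) = [T u, T v] - [u, v]], the vanishing of the Nijenhuis
    torsion of [T]. In a flat trivialisation the bracket is a first order differential
    expression. Since [J] and [Jg] are constant there, the derivatives of [u] and [v]
    cancel; the derivatives of [B] are complex linear in the direction because [beta] is
    holomorphic, which leaves the Schouten bracket of [B] with itself
    ([nijenhuis_vector], [nijenhuis_form]), and this is the real part of the one of
    [beta] contracted with (1,0)-forms ([real_poisson]). The component in [g] is the
    integrability of [Jg].

    The bracket of two sections is a section. Sections are given frame by frame, a frame
    being a chart and a path, up to homotopy. Paths prolonged by coordinate segments
    inside a ball are homotopic as soon as they have the same endpoint
    ([cell_homotopic]), so that the local expressions of a section at neighbouring frames
    agree ([local_local]) and those in two charts are exchanged by the transition map
    ([section_transported]). In the transformation of the bracket under a change of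
    coordinates [tau] the second derivatives of [tau] appear only through their
    antisymmetrisation ([local_dorfman_transport]); this vanishes by Young's theorem on
    the symmetry of second derivatives ([derive_comm]), which rests on the mean value
    theorem.

    Finally [det beta] is a polynomial in holomorphic functions and transforms by the
    square of the complex Jacobian determinant. That every zero of [det beta] is seen by
    some frame uses that the connected manifold [M] is path connected
    ([path_connected]). *)

Set Implicit Arguments.
Unset Strict Implicit.
Unset Printing Implicit Defensive.

Local Open Scope classical_set_scope.
Local Open Scope ring_scope.

(** * Smooth functions *)

(** Differentiability only depends on the germ; smoothness on an open set is
    transported along equalities that hold on that set only. *)
Lemma near_eq_differentiable (R : realType) (V W : normedModType R)
    (f g : V -> W) (a : V) :
  (\forall x \near a, f x = g x) -> differentiable f a -> differentiable g a.
Proof.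
move=> fg df.
have fga := nbhs_singleton fg.
have key : g \o shift a = cst (g a) + 'd f a +o_ 0 id.
  have /eqaddoP E := diff_locally df.
  apply/eqaddoP => e e0; have := E e e0.
  have : \forall h \near (0 : V), f (h + a) = g (h + a).
    by move: fg; rewrite (near_shift 0 a) /=; apply: filterS => h /=; rewrite subr0.
  apply: filterS2 => h /= fgh.
  by rewrite /= !fctE /= fgh fga.
have /diff_locallyP [dc _] := df.
apply/diff_locallyP.
have -> : ('d g a : V -> W) = 'd f a by apply: diff_unique.
by split.
Qed.

Section Ck.
Context {R : realType} {m : nat}.
Local Notation V := 'rV[R]_m.
Implicit Types (f g : V -> R^o) (U : set V).

Lemma Ck_eq k U f g : open U -> (forall x, U x -> f x = g x) ->
  Ck k U f -> Ck k U g.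
Proof.
move=> oU; elim: k f g => [|k IH] f g fg /=.
  move=> cf x Ux; have nfg : \forall y \near x, f y = g y.
    by apply: filterS (open_nbhs_nbhs (conj oU Ux)) => y /fg.
  rewrite /prop_for /continuous_at -(fg _ Ux).
  by apply: cvg_trans (cf x Ux); exact: near_eq_cvg nfg.
move=> [df Df]; split.
  move=> x Ux; apply: near_eq_differentiable (df x Ux).
  by apply: filterS (open_nbhs_nbhs (conj oU Ux)) => y /fg.
move=> v; apply: IH (Df v) => x Ux; apply: near_eq_derive.
by apply: filterS (open_nbhs_nbhs (conj oU Ux)) => y /fg.
Qed.

Lemma CkS k U f : Ck k.+1 U f -> Ck k U f.
Proof.
elim: k f => [|k IH] f.
  by move=> [df _] x Ux; exact: differentiable_continuous (df x Ux).
by move=> [df Df]; split=> // v; apply: IH; exact: Df.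
Qed.

Lemma Ck_sub k U U' f : U' `<=` U -> Ck k U f -> Ck k U' f.
Proof.
move=> UU'; elim: k f => [|k IH] f /= ; first by move=> cf x /UU'; exact: cf.
by move=> [df Df]; split=> [x /UU'|v]; [exact: df | exact: IH (Df v)].
Qed.

Lemma Ck_cst k U (c : R) : open U -> Ck k U (fun _ => c).
Proof.
move=> oU; elim: k c => [|k IH] c /=; first by move=> x _; exact: cst_continuous.
split=> [x _|v]; first exact: differentiable_cst.
by apply: (Ck_eq oU) (IH 0) => x _; rewrite derive_cst.
Qed.

Lemma Ck_add k U f g : open U -> Ck k U f -> Ck k U g -> Ck k U (f + g).
Proof.
move=> oU; elim: k f g => [|k IH] f g.
  by move=> cf cg x Ux; apply: continuousD; [exact: cf | exact: cg].
move=> [df Df] [dg Dg]; split=> [x Ux|v].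
  by apply: differentiableD; [exact: df|exact: dg].
apply: (Ck_eq oU) (IH _ _ (Df v) (Dg v)) => x Ux.
by rewrite deriveD //; apply: diff_derivable; [exact: df|exact: dg].
Qed.

(** By the Leibniz rule the derivatives of a product are again sums of products,
    now of one class lower: induction on the class. *)
Lemma Ck_mul k U f g : open U -> Ck k U f -> Ck k U g -> Ck k U (f * g).
Proof.
move=> oU; elim: k f g => [|k IH] f g.
  by move=> cf cg x Ux; apply: continuousM; [exact: cf | exact: cg].
move=> Hf Hg; have [df Df] := Hf; have [dg Dg] := Hg.
split=> [x Ux|v].
  by apply: differentiableM; [exact: df|exact: dg].
have := Ck_add oU (IH _ _ (CkS Hf) (Dg v)) (IH _ _ (CkS Hg) (Df v)).
apply: (Ck_eq oU) => x Ux.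
by rewrite deriveM //; apply: diff_derivable; [exact: df|exact: dg].
Qed.

End Ck.

(** With germs, combining finitely many smooth functions requires no bookkeeping
    of the open sets where they are defined. *)
Definition smooth_germ (R : realType) (m : nat) (a : 'rV[R]_m)
    (f : 'rV[R]_m -> R^o) : Prop :=
  exists U : set 'rV[R]_m, [/\ open U, U a & smooth_on U f].

Section Germs.
Context {R : realType} {m : nat}.
Local Notation V := 'rV[R]_m.
Implicit Types (f g : V -> R^o) (a v : V).

Lemma smooth_germ_on U f : open U -> smooth_on U f ->
  forall a, U a -> smooth_germ a f.
Proof. by move=> oU sf a Ua; exists U. Qed.

(** Each clause of [Ck] is a condition at points, so smoothness is local. *)
Lemma smooth_on_germ U f : open U -> (forall a, U a -> smooth_germ a f) ->
  smooth_on U f.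
Proof.
move=> oU sf k.
have {}sf a : U a -> exists W, [/\ open W, W a & Ck k W f].
  by move=> /sf [W [? ? sW]]; exists W; split.
elim: k f sf => [|k IH] f sf.
  by move=> a /sf [W [_ Wa]]; exact.
split; first by move=> a /sf [W [_ Wa [+ _]]]; exact.
move=> v; apply: IH => a /sf [W [oW Wa [_ Df]]].
by exists W; split=> //; exact: Df.
Qed.

Lemma smooth_germ_near a f : smooth_germ a f -> \forall x \near a, smooth_germ x f.
Proof.
move=> [U [oU Ua sf]]; apply: filterS (open_nbhs_nbhs (conj oU Ua)) => x Ux.
exact: smooth_germ_on Ux.
Qed.

Lemma near_open a (P : V -> Prop) : (\forall x \near a, P x) ->
  exists U, [/\ open U, U a & forall x, U x -> P x].
Proof. by move=> h; have := h; rewrite -nbhs_nearE nbhsE => -[U [oU Ua] UP]; exists U. Qed.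

Lemma smooth_germ_eq a f g : (\forall x \near a, f x = g x) ->
  smooth_germ a f -> smooth_germ a g.
Proof.
move=> /near_open [U [oU Ua fg]] [W [oW Wa sf]].
exists (U `&` W); split=> //; first exact: openI.
move=> k; apply: (@Ck_eq _ _ _ _ f); first exact: openI.
  by move=> x [/fg].
by apply: Ck_sub (sf k) => x [].
Qed.

Lemma smooth_germ_cst a (c : R) : smooth_germ a (fun _ => c).
Proof.
by exists setT; split=> //; [exact: openT | move=> k; apply: Ck_cst; exact: openT].
Qed.

Lemma smooth_germ_add a f g : smooth_germ a f -> smooth_germ a g ->
  smooth_germ a (fun x => f x + g x).
Proof.
move=> [U [oU Ua sf]] [W [oW Wa sg]].
exists (U `&` W); split=> //; first exact: openI.
move=> k; apply: (@Ck_add _ _ k (U `&` W) f g); first exact: openI.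
  by apply: Ck_sub (sf k) => x [].
by apply: Ck_sub (sg k) => x [].
Qed.

Lemma smooth_germ_mul a f g : smooth_germ a f -> smooth_germ a g ->
  smooth_germ a (fun x => f x * g x : R).
Proof.
move=> [U [oU Ua sf]] [W [oW Wa sg]].
exists (U `&` W); split=> //; first exact: openI.
move=> k; apply: (@Ck_mul _ _ k (U `&` W) f g); first exact: openI.
  by apply: Ck_sub (sf k) => x [].
by apply: Ck_sub (sg k) => x [].
Qed.

Lemma smooth_germ_scale a (c : R) f : smooth_germ a f ->
  smooth_germ a (fun x => c * f x : R).
Proof. by move=> sf; apply: smooth_germ_mul sf; exact: smooth_germ_cst. Qed.

Lemma smooth_germ_opp a f : smooth_germ a f -> smooth_germ a (fun x => - f x).
Proof.
move=> sf; apply: smooth_germ_eq (smooth_germ_scale (-1) sf).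
by near=> x; rewrite mulN1r.
Unshelve. all: by end_near. Qed.

Lemma smooth_germ_sub a f g : smooth_germ a f -> smooth_germ a g ->
  smooth_germ a (fun x => f x - g x).
Proof. by move=> sf sg; apply: smooth_germ_add (smooth_germ_opp sg). Qed.

Lemma smooth_germ_sum a (I : Type) (s : seq I) (P : pred I) (F : I -> V -> R^o) :
  (forall i, smooth_germ a (F i)) ->
  smooth_germ a (fun x => \sum_(i <- s | P i) F i x).
Proof.
move=> sF; elim: s => [|i s IH].
  by apply: smooth_germ_eq (smooth_germ_cst a 0); near=> x; rewrite big_nil.
case Pi : (P i).
  apply: smooth_germ_eq (smooth_germ_add (sF i) IH).
  by near=> x; rewrite big_cons Pi.
by apply: smooth_germ_eq IH; near=> x; rewrite big_cons Pi.
Unshelve. all: by end_near. Qed.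

Lemma smooth_germ_derive a v f : smooth_germ a f ->
  smooth_germ a (fun x => 'D_v f x).
Proof.
by move=> [U [oU Ua sf]]; exists U; split=> // k; have [_] := sf k.+1; exact.
Qed.

Lemma smooth_germ_diff a f : smooth_germ a f -> differentiable f a.
Proof. by move=> [U [oU Ua sf]]; have [+ _] := sf 1%N; exact. Qed.

End Germs.

(** * Symmetry of second derivatives *)

Section Young.
Context {R : realType} {m : nat}.
Local Notation V := 'rV[R]_m.
Implicit Types (f : V -> R^o) (a v w : V).

(** The difference quotients along the line are literally those of the
    directional derivative, so no chain rule is involved. *)
Lemma is_derive_line f p v (s : R) : derivable f (p + s *: v) v ->
  is_derive s 1 (fun s : R => f (p + s *: v)) ('D_v f (p + s *: v)).
Proof.
have E : (fun h : R => h^-1 *: (f (p + (h *: 1 + s) *: v) - f (p + s *: v))) =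
         (fun h : R => h^-1 *: (f (h *: v + (p + s *: v)) - f (p + s *: v))).
  apply/funext => h; congr (_ *: (f _ - _)).
  by rewrite /= -[h *: 1]/(h * 1) mulr1 scalerDl addrCA.
move=> dv; split; first by rewrite /derivable /= E.
by rewrite /derive /= E.
Qed.

Let second_difference f a v w : R :=
  f (a + v + w) - f (a + v) - f (a + w) + f a.

(** Young's estimate. The mean value theorem in the direction [v] turns the second
    difference into a difference of two values of [G = 'D_v f], which the first
    order expansion of [G] at [a] evaluates up to [o(t ^+ 2)]. *)
Lemma second_difference_le f a v w : 
  (\forall x \near a, differentiable f x) ->
  differentiable ('D_v f) a -> forall e : R, 0 < e -> \forall t \near (0 : R),
  `|second_difference f a (t *: v) (t *: w) - t ^+ 2 * 'D_w ('D_v f) a|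
     <= e * t ^+ 2 * (`|v| + `|w|) *+ 2.
Proof.
move=> df dG e e0; set G := 'D_v f in dG *.
have /eqaddoP/(_ e e0) E := diff_locally dG.
have {}E : \forall h \near (0 : V), `|G (a + h) - G a - 'd G a h| <= e * `|h|.
  by apply: filterS E => h; rewrite !fctE /= opprD addrA (addrC h a).
have {}df : \forall h \near (0 : V), differentiable f (a + h).
  by move: df; rewrite (near_shift 0 a) /=; apply: filterS => h /=; rewrite subr0 addrC.
have /nbhs_ballP [d /= d0 Bd] : nbhs (0:V) ((fun h => differentiable f (a + h)) `&`
    (fun h => `|G (a + h) - G a - 'd G a h| <= e * `|h|)) by apply: filterI.
near=> t.
have tvw : `|t| * (`|v| + `|w|) < d.
  near: t; have : (fun t : R => `|t| * (`|v| + `|w|)) x @[x --> 0] --> `|0 : R| * (`|v| + `|w|).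
    apply: cvgM; last exact: cvg_cst.
    by apply: cvg_norm; exact: cvg_id.
  rewrite normr0 mul0r => /cvgrPdist_lt/(_ d d0); apply: filterS => t.
  by rewrite sub0r normrN ger0_norm // mulr_ge0 ?addr_ge0.
have inB (s r : R) : 0 <= s <= 1 -> 0 <= r <= 1 -> ball (0:V) d (s *: (t *: v) + r *: (t *: w)).
  move=> /andP[s0 s1] /andP[r0 r1]; rewrite -ball_normE /= sub0r normrN.
  apply: le_lt_trans tvw; apply: le_trans (ler_normD _ _) _.
  rewrite !normrZ mulrDr; apply: lerD; rewrite ler_piMl ?mulr_ge0 //.
    by rewrite ger0_norm.
  by rewrite ger0_norm.
pose phi (r : R) (s : R) := f ((a + r *: (t *: w)) + s *: (t *: v)) : R^o.
have dphi (r s : R) : 0 <= s <= 1 -> 0 <= r <= 1 ->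
    is_derive s 1 (phi r) (t * G (a + (s *: (t *: v) + r *: (t *: w)))).
  move=> hs hr; have [dfs _] := Bd _ (inB _ _ hs hr).
  have Eq : a + r *: (t *: w) + s *: (t *: v) = a + (s *: (t *: v) + r *: (t *: w)).
    by rewrite -addrA (addrC (r *: _)).
  rewrite /phi; apply: is_derive_eq (is_derive_line _) _ => /=.
    by apply: diff_derivable; rewrite Eq.
  by rewrite Eq /G !deriveE // linearZ.
pose psi (s : R) := phi 1 s - phi 0 s.
pose dpsi (s : R) := t * G (a + (s *: (t *: v) + 1 *: (t *: w)))
                   - t * G (a + (s *: (t *: v) + 0 *: (t *: w))).
have dpsiP (s : R) : 0 <= s <= 1 -> is_derive s 1 psi (dpsi s).
  by move=> hs; apply: is_deriveB; apply: dphi => //; rewrite ?lexx ?ler01.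
have [|x||c] := @MVT R psi dpsi 0 1; first exact: ltr01.
- by rewrite in_itv /= => /andP[x0 x1]; apply: dpsiP; rewrite !ltW.
- apply: derivable_within_continuous => x; rewrite in_itv /= => hx.
  by have [] := dpsiP x hx.
(* the value [c] of the mean value theorem depends on [t]; only its range matters *)
rewrite in_itv /= => /andP[c0 c1]; rewrite subr0 mulr1 => Hc.
have hc : 0 <= c <= 1 by rewrite !ltW.
have h01 : 0 <= (1:R) <= 1 by rewrite ler01 lexx.
have h00 : 0 <= (0:R) <= 1 by rewrite ler01 lexx.
have [_ E1] := Bd _ (inB _ _ hc h01); have [_ E0] := Bd _ (inB _ _ hc h00).
have -> : second_difference f a (t *: v) (t *: w) = dpsi c.
  rewrite -Hc /psi /phi /second_difference !scale1r !scale0r !addr0.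
  by rewrite (addrAC a (t *: w)); ring.
have L : dpsi c - t ^+ 2 * 'D_w G a =
   t * ((G (a + (c *: (t *: v) + 1 *: (t *: w))) - G a - 'd G a (c *: (t *: v) + 1 *: (t *: w)))
    - (G (a + (c *: (t *: v) + 0 *: (t *: w))) - G a - 'd G a (c *: (t *: v) + 0 *: (t *: w)))).
  have lZ (s : R) x : 'd G a (s *: x) = s * 'd G a x by rewrite linearZ.
  have lD x y : 'd G a (x + y) = 'd G a x + 'd G a y by rewrite linearD.
  by rewrite /dpsi deriveE // !lD !lZ; ring.
rewrite L normrM.
have Hn (r : R) : 0 <= r <= 1 -> `|c *: (t *: v) + r *: (t *: w)| <= `|t| * (`|v| + `|w|).
  move=> /andP[r0 r1]; apply: le_trans (ler_normD _ _) _; rewrite !normrZ mulrDr.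
  by apply: lerD; rewrite ler_piMl ?mulr_ge0 // ger0_norm // ltW.
have -> : e * t ^+ 2 * (`|v| + `|w|) *+ 2 =
    `|t| * (e * (`|t| * (`|v| + `|w|)) + e * (`|t| * (`|v| + `|w|))).
  by rewrite -(real_normK (num_real t)); ring.
apply: ler_wpM2l => //; apply: le_trans (ler_normB _ _) _.
by apply: lerD; [apply: le_trans E1 _|apply: le_trans E0 _];
  apply: ler_wpM2l (Hn _ _) => //; exact: ltW.
Unshelve. all: by end_near. Qed.

(** The second difference is symmetric in [v] and [w], and its leading term is
    either iterated derivative. *)
Lemma derive_comm f a v w :
  (\forall x \near a, differentiable f x) ->
  differentiable ('D_v f) a -> differentiable ('D_w f) a ->
  'D_w ('D_v f) a = 'D_v ('D_w f) a.
Proof.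
move=> df dv dw; apply/eqP; rewrite -subr_eq0 -normr_le0.
apply/ler_addgt0Pl => e e0; rewrite addr0.
(* the two estimates add up to four times the sum of the norms; the extra 1 keeps
   the denominator positive when [v] and [w] vanish *)
pose K := (`|v| + `|w|) *+ 4 + 1.
have K0 : 0 < K by rewrite ltr_wpDl ?mulrn_wge0 ?addr_ge0.
have eK : 0 < e / K by rewrite divr_gt0.
have Hv := second_difference_le w df dv eK.
have Hw := second_difference_le v df dw eK.
have [t [t0 h1 h2]] : exists t : R, [/\ 0 < t,
  `|second_difference f a (t *: w) (t *: v) - t ^+ 2 * 'D_v ('D_w f) a|
     <= e / K * t ^+ 2 * (`|w| + `|v|) *+ 2 &
  `|second_difference f a (t *: v) (t *: w) - t ^+ 2 * 'D_w ('D_v f) a|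
     <= e / K * t ^+ 2 * (`|v| + `|w|) *+ 2].
  near (0 : R)^'+ => t; exists t; split; near: t; first exact: nbhs_right_gt.
    exact: cvg_within Hw.
  exact: cvg_within Hv.
have S : second_difference f a (t *: w) (t *: v) = second_difference f a (t *: v) (t *: w).
  by rewrite /second_difference (addrAC a (t *: w)); ring.
rewrite S (addrC `|w|) in h1.
have t2 : 0 < t ^+ 2 by rewrite exprn_gt0.
rewrite -(ler_pM2l t2) -[X in X * `|_|](gtr0_norm t2) -normrM.
move: h1 h2; set A := second_difference _ _ _ _.
move: A; move: ('D_w ('D_v f) a : R) => p; move: ('D_v ('D_w f) a : R) => q A h1 h2.
have -> : t ^+ 2 * (p - q) = (A - t ^+ 2 * q) - (A - t ^+ 2 * p).
  by ring.
apply: le_trans (ler_normB _ _) _; apply: le_trans (lerD h1 h2) _.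
have -> : t ^+ 2 * e = e / K * t ^+ 2 * K by rewrite [RHS]mulrAC divfK ?gt_eqF // mulrC.
have -> : e / K * t ^+ 2 * (`|v| + `|w|) *+ 2 + e / K * t ^+ 2 * (`|v| + `|w|) *+ 2 =
  e / K * t ^+ 2 * ((`|v| + `|w|) *+ 4) by ring.
by rewrite ler_pM2l ?(mulr_gt0 eK t2) // /K lerDl.
Unshelve. all: by end_near. Qed.

End Young.

(** * Smooth maps to spaces of rows, and the duality pairing *)

Lemma lin_sum (R : realType) (U W : lmodType R) (f : U -> W) (n : nat)
    (c : 'I_n -> R) (b : 'I_n -> U) : linear f ->
  f (\sum_i c i *: b i) = \sum_i c i *: f (b i).
Proof.
move=> lf.
pose L : {linear U -> W} := HB.pack f (GRing.isLinear.Build R U W *:%R f lf).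
rewrite -[f]/(L : U -> W) linear_sum; apply: eq_bigr => i _; exact: linearZ.
Qed.

Lemma near_forall (T : topologicalType) (I : finType) (a : T)
    (P : I -> T -> Prop) :
  (forall i, \forall x \near a, P i x) -> \forall x \near a, forall i, P i x.
Proof. exact: filter_forall. Qed.

Lemma lin_opp (R : realType) (U W : lmodType R) (f : U -> W) x : linear f ->
  f (- x) = - f x.
Proof.
move=> lf.
pose L : {linear U -> W} := HB.pack f (GRing.isLinear.Build R U W *:%R f lf).
exact: (linearN L).
Qed.

Lemma row_addE (R : nmodType) p (A B : 'rV[R]_p) j : (A + B) 0 j = A 0 j + B 0 j.
Proof. by rewrite mxE. Qed.

Lemma row_oppE (R : zmodType) p (A : 'rV[R]_p) j : (- A) 0 j = - A 0 j.
Proof. by rewrite mxE. Qed.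

Section RowValued.
Context {R : realType} {m : nat}.
Local Notation V := 'rV[R]_m.
Implicit Types (a v w : V).

Lemma pairingE (xi X : V) : pairing xi X = \sum_j xi 0 j * X 0 j.
Proof. by rewrite /pairing mxE; apply: eq_bigr => j _; rewrite mxE mulrC. Qed.

Lemma pairing_linl (c : R) (xi eta X : V) :
  pairing (c *: xi + eta) X = c * pairing xi X + pairing eta X.
Proof. by rewrite /pairing linearP mulmxDr -scalemxAr !mxE. Qed.

Lemma pairing_linr (c : R) (xi X Y : V) :
  pairing xi (c *: X + Y) = c * pairing xi X + pairing xi Y.
Proof. by rewrite /pairing mulmxDl -scalemxAl !mxE. Qed.

Lemma pairing_basis (xi : V) j : pairing xi (basis_vec j) = xi 0 j.
Proof.
rewrite pairingE (bigD1 j) //= mxE !eqxx mulr1 big1 ?addr0 // => k kj.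
by rewrite mxE (negPf kj) andbF mulr0.
Qed.

Lemma pairing_ext (xi eta : V) : (forall X, pairing xi X = pairing eta X) ->
  xi = eta.
Proof. by move=> E; apply/rowP => j; rewrite -!pairing_basis. Qed.

Lemma pairingC (xi X : V) : pairing xi X = pairing X xi.
Proof. by rewrite !pairingE; apply: eq_bigr => j _; rewrite mulrC. Qed.

Lemma row_expand (v : V) : v = \sum_k v 0 k *: basis_vec k.
Proof. exact: row_sum_delta. Qed.

Lemma dual_mapE (f : {linear V -> V}) xi X :
  pairing (dual_map f xi) X = pairing xi (f X).
Proof.
rewrite [in RHS](row_expand X) linear_sum pairingE /pairing mulmx_suml summxE.
by apply: eq_bigr => j _; rewrite mxE linearZ -scalemxAl mxE mulrC.
Qed.

Lemma pairingDr (xi X Y : V) : pairing xi (X + Y) = pairing xi X + pairing xi Y.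
Proof. by rewrite -[X]scale1r pairing_linr mul1r scale1r. Qed.

Lemma pairingNr (xi X : V) : pairing xi (- X) = - pairing xi X.
Proof. by rewrite /pairing mulNmx mxE. Qed.

Lemma pairingDl (xi eta X : V) : pairing (xi + eta) X = pairing xi X + pairing eta X.
Proof. by rewrite !(pairingC _ X) pairingDr. Qed.

Lemma pairingNl (xi X : V) : pairing (- xi) X = - pairing xi X.
Proof. by rewrite !(pairingC _ X) pairingNr. Qed.

Lemma pairing_row (f : V -> R) : (forall c x y, f (c *: x + y) = c * f x + f y) ->
  forall e, pairing (\row_j f (basis_vec j)) e = f e.
Proof.
move=> lf e; have f_lin : linear (f : V -> R^o) by [].
rewrite [in RHS](row_expand e) (lin_sum _ _ f_lin) pairingE.
by apply: eq_bigr => j _; rewrite mxE mulrC.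
Qed.

Lemma derive_linv (W : normedModType R) (f : V -> W) a (c : R) v w :
  differentiable f a -> 'D_(c *: v + w) f a = c *: 'D_v f a + 'D_w f a.
Proof. by move=> df; rewrite !deriveE // linearP. Qed.

Lemma derive_expand (W : normedModType R) (f : V -> W) a v :
  differentiable f a -> 'D_v f a = \sum_k v 0 k *: 'D_(basis_vec k) f a.
Proof.
move=> df; rewrite deriveE // [in LHS](row_expand v) linear_sum.
by apply: eq_bigr => k _; rewrite linearZ deriveE.
Qed.

Definition smooth_row p (a : V) (X : V -> 'rV[R]_p) : Prop :=
  forall j, smooth_germ a (fun x => X x 0 j : R^o).

Section Rows.
Variable p : nat.
Implicit Types (X Y : V -> 'rV[R]_p).

Lemma differentiable_row X a :
  (forall j, differentiable (fun x => X x 0 j : R^o) a) -> differentiable X a.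
Proof.
move=> dX.
have -> : X = \sum_j (fun x => (X x 0 j : R^o) *: (delta_mx 0 j : 'rV[R]_p)).
  by apply/funext => x; rewrite fct_sumE -row_sum_delta.
by apply: differentiable_sum => j; apply: differentiableZl; exact: dX.
Qed.

Lemma smooth_row_diff a X : smooth_row a X -> differentiable X a.
Proof. by move=> sX; apply: differentiable_row => j; apply: smooth_germ_diff. Qed.

Lemma derive_coord a v X j : differentiable X a ->
  ('D_v X a) 0 j = 'D_v (fun x => X x 0 j : R^o) a.
Proof.
move=> dX; rewrite derive_mx; last exact: diff_derivable.
by rewrite mxE.
Qed.

Lemma derivable_coord a v X j : differentiable X a ->
  derivable (fun x => X x 0 j : R^o) a v.
Proof. by move=> dX; have /derivable_mxP := @diff_derivable _ _ _ X a v dX; exact. Qed.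

Lemma smooth_row_derive a v X : smooth_row a X ->
  smooth_row a (fun x => 'D_v X x).
Proof.
move=> sX j; apply: smooth_germ_eq (smooth_germ_derive v (sX j)).
have : \forall x \near a, forall j, smooth_germ x (fun x => X x 0 j : R^o).
  by apply: near_forall => k; exact: smooth_germ_near (sX k).
by apply: filterS => x /smooth_row_diff dX; rewrite derive_coord.
Qed.

Lemma smooth_row_near a X : smooth_row a X -> \forall x \near a, smooth_row x X.
Proof. by move=> sX; apply: near_forall => k; exact: smooth_germ_near (sX k). Qed.

End Rows.

Lemma smooth_row_lin p q a (L : {linear 'rV[R]_p -> 'rV[R]_q}) X :
  smooth_row a X -> smooth_row a (fun x => L (X x)).
Proof.
move=> sX j; apply: smooth_germ_eq (smooth_germ_sum _ _
  (fun k => smooth_germ_mul (sX k) (smooth_germ_cst a (L (delta_mx 0 k) 0 j)))).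
near=> x; rewrite [in RHS](row_sum_delta (X x)) linear_sum summxE.
by apply: eq_bigr => k _; rewrite linearZ mxE.
Unshelve. all: by end_near. Qed.

Lemma derive_row_lin p q a v (L : {linear 'rV[R]_p -> 'rV[R]_q}) X :
  differentiable X a -> 'D_v (fun x => L (X x)) a = L ('D_v X a).
Proof.
move=> dX.
have -> : (fun x => L (X x)) = \sum_j (fun x => (X x 0 j : R^o) *: L (delta_mx 0 j)).
  apply/funext => x; rewrite fct_sumE [in LHS](row_sum_delta (X x)) linear_sum.
  by apply: eq_bigr => k _; rewrite linearZ.
have dZ j : is_derive a v (fun x => (X x 0 j : R^o) *: L (delta_mx 0 j))
    ('D_v X a 0 j *: L (delta_mx 0 j)).
  have dj : differentiable (fun x => X x 0 j : R^o) a.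
    have := @differentiable_comp R _ _ _ X (fun N : 'rV[R]_p => N 0 j : R^o) a dX.
    by apply; exact: differentiable_coord.
  split; first by apply: diff_derivable; exact: differentiableZl.
  rewrite deriveE; last exact: differentiableZl.
  by rewrite diffZl // derive_coord // deriveE.
rewrite derive_sum; last by move=> j; have [] := dZ j.
rewrite [in RHS](row_sum_delta ('D_v X a)) linear_sum.
by apply: eq_bigr => j _; rewrite linearZ; have [_ ->] := dZ j.
Qed.

Lemma derive_pairing a v (xi X : V -> V) : differentiable xi a ->
  differentiable X a ->
  'D_v (fun x => pairing (xi x) (X x)) a =
  pairing ('D_v xi a) (X a) + pairing (xi a) ('D_v X a).
Proof.
move=> dxi dX.
have -> : (fun x => pairing (xi x) (X x)) =
  \sum_j ((fun x => xi x 0 j : R^o) * (fun x => X x 0 j : R^o)).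
  by apply/funext => x; rewrite fct_sumE pairingE.
rewrite derive_sum; last first.
  by move=> j; apply: derivableM; exact: derivable_coord.
rewrite !pairingE -big_split /=; apply: eq_bigr => j _.
rewrite deriveM; [|exact: derivable_coord|exact: derivable_coord].
by rewrite (derive_coord v j dxi) (derive_coord v j dX) [RHS]addrC; congr (_ + _); exact: mulrC.
Qed.

Lemma smooth_pairing a (xi X : V -> V) : smooth_row a xi -> smooth_row a X ->
  smooth_germ a (fun x => pairing (xi x) (X x)).
Proof.
move=> sxi sX; apply: smooth_germ_eq (smooth_germ_sum _ _
  (fun k => smooth_germ_mul (sxi k) (sX k))).
by near=> x; rewrite pairingE.
Unshelve. all: by end_near. Qed.

Lemma smooth_row_derive_along p a (X : V -> V) (Y : V -> 'rV[R]_p) :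
  smooth_row a X -> smooth_row a Y -> smooth_row a (fun x => 'D_(X x) Y x).
Proof.
move=> sX sY j; apply: smooth_germ_eq (smooth_germ_sum _ _
  (fun k => smooth_germ_mul (sX k) (smooth_row_derive (basis_vec k) sY j))).
have := smooth_row_near sY; apply: filterS => x /smooth_row_diff dY.
by rewrite (derive_expand _ dY) summxE; apply: eq_bigr => k _; rewrite mxE.
Qed.

(** The second derivative [D^2 tau (v, X)] is what separates the derivative of
    a pushed-forward vector field from the push-forward of its derivative. For the
    proof, both sides are expanded over the partial derivatives of [tau]. *)
Lemma derive_along p a v (X : V -> V) (tau : V -> 'rV[R]_p) :
  smooth_row a X -> smooth_row a tau ->
  'D_v (fun x => 'D_(X x) tau x) a =
  'D_('D_v X a) tau a + 'D_v (fun x => 'D_(X a) tau x) a.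
Proof.
move=> sX st; have dX := smooth_row_diff sX; have dt := smooth_row_diff st.
apply/rowP => j.
have dE : differentiable (fun x => 'D_(X x) tau x) a.
  exact: smooth_row_diff (smooth_row_derive_along sX st).
have dE' : differentiable (fun x => 'D_(X a) tau x) a.
  exact: smooth_row_diff (smooth_row_derive (X a) st).
have dk k : differentiable ('D_(basis_vec k) (fun x => tau x 0 j : R^o)) a.
  exact: smooth_germ_diff (smooth_germ_derive _ (st j)).
rewrite row_addE.
have H1 := derive_coord v j dE.
have H2 := derive_coord v j dE'.
transitivity ('D_v (fun x => ('D_(X x) tau x) 0 j : R^o) a); first exact: H1.
transitivity (('D_('D_v X a) tau a) 0 j + 'D_v (fun x => ('D_(X a) tau x) 0 j : R^o) a); last first.
  by congr (_ + _); exact: esym H2.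
have Ex : \forall x \near a, forall v, ('D_v tau x) 0 j =
    \sum_k v 0 k * 'D_(basis_vec k) (fun x => tau x 0 j : R^o) x.
  have := smooth_row_near st.
  apply: filterS => x /[dup] /(_ j) /smooth_germ_diff dj /smooth_row_diff dY w.
  by rewrite derive_coord // (derive_expand _ dj).
transitivity
  ('D_v (\sum_k ((fun x => X x 0 k : R^o) * ('D_(basis_vec k) (fun x => tau x 0 j : R^o)))) a).
  by apply: near_eq_derive; apply: filterS Ex => x ->; rewrite fct_sumE.
transitivity (\sum_k ('D_v X a) 0 k * 'D_(basis_vec k) (fun x => tau x 0 j : R^o) a +
  'D_v (\sum_k (X a 0 k \*o ('D_(basis_vec k) (fun x => tau x 0 j : R^o)))) a); last first.
  congr (_ + _); first exact: esym (nbhs_singleton Ex _).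
  by apply: near_eq_derive; apply: filterS Ex => x ->; rewrite fct_sumE.
rewrite !derive_sum; first last.
- by move=> k; apply: derivableM; [exact: derivable_coord|exact: diff_derivable].
- by move=> k; apply: derivableM; [exact: derivable_cst|exact: diff_derivable].
rewrite -big_split; apply: eq_bigr => k _ /=.
rewrite deriveM; [|exact: derivable_coord|exact: diff_derivable].
rewrite deriveMl; last exact: diff_derivable.
by rewrite (derive_coord v k dX) addrC; congr (_ + _); exact: mulrC.
Qed.

Lemma derive_row_comm p a v w (tau : V -> 'rV[R]_p) : smooth_row a tau ->
  'D_w (fun x => 'D_v tau x) a = 'D_v (fun x => 'D_w tau x) a.
Proof.
move=> st; apply/rowP => j.
have dE u : differentiable (fun x => 'D_u tau x) a.
  exact: smooth_row_diff (smooth_row_derive u st).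
have E u u' : 'D_u' (fun x => ('D_u tau x) 0 j : R^o) a =
    'D_u' ('D_u (fun x => tau x 0 j : R^o)) a.
  apply: near_eq_derive; have := smooth_row_near st.
  by apply: filterS => x /smooth_row_diff dY; rewrite derive_coord.
have d2 u := smooth_germ_diff (smooth_germ_derive u (st j)).
have d1 : \forall x \near a, differentiable (fun x => tau x 0 j : R^o) x.
  by have := smooth_germ_near (st j); apply: filterS => x /smooth_germ_diff.
have C := derive_comm d1 (d2 v) (d2 w).
exact: etrans (etrans (derive_coord w j (dE v)) (E v w))
  (etrans C (esym (etrans (derive_coord v j (dE w)) (E w v)))).
Qed.

End RowValued.

(** * Smooth maps to abstract vector spaces *)

Section VectValued.
Context {R : realType} {m : nat}.
Local Notation V := 'rV[R]_m.
Implicit Types (a v w : V).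

Lemma vcoord_linear (W : vectType R) k : linear (vcoord k : W -> R^o).
Proof. by move=> c x y; rewrite /vcoord linearP. Qed.

Lemma vcoordD (W : vectType R) k (x y : W) : vcoord k (x + y) = vcoord k x + vcoord k y.
Proof. exact: linearD. Qed.

Lemma vcoordN (W : vectType R) k (x : W) : vcoord k (- x) = - vcoord k x.
Proof. exact: linearN. Qed.

Lemma vcoordZ (W : vectType R) k (c : R) (x : W) : vcoord k (c *: x) = c * vcoord k x.
Proof. exact: linearZ. Qed.

Lemma vcoord_sum (W : vectType R) k (I : Type) (s : seq I) (P : pred I) (F : I -> W) :
  vcoord k (\sum_(i <- s | P i) F i) = \sum_(i <- s | P i) vcoord k (F i).
Proof. exact: linear_sum. Qed.

Lemma vect_expand (W : vectType R) (w : W) :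
  w = \sum_k vcoord k w *: (vbasis {: W})`_k.
Proof. by apply: coord_vbasis; rewrite memvf. Qed.

Lemma vcoord_basis_sum (W : vectType R) (c : 'I_(\dim {: W}) -> R) k :
  vcoord k (\sum_i c i *: (vbasis {: W})`_i) = c k.
Proof. by rewrite /vcoord coord_sum_free //; apply: basis_free (vbasisP _). Qed.

Lemma vect_ext (W : vectType R) (w z : W) :
  (forall k, vcoord k w = vcoord k z) -> w = z.
Proof.
move=> E; rewrite (vect_expand w) (vect_expand z).
by apply: eq_bigr => k _; rewrite E.
Qed.

Definition smooth_vect (W : vectType R) a (r : V -> W) : Prop :=
  forall k, smooth_germ a (fun x => vcoord k (r x)).

(** The intersection of the domains of the finitely many coordinates gives the
    common open set. *)
Lemma smooth_atP (W : vectType R) a (r : V -> W) :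
  smooth_at a r <-> smooth_vect a r.
Proof.
split=> [[U [oU Ua sr]] k|sr]; first by exists U.
have /near_open [U [oU Ua sU]] : \forall x \near a, forall k,
    smooth_germ x (fun x => vcoord k (r x)).
  by apply: near_forall => k; exact: smooth_germ_near (sr k).
by exists U; split=> // k; apply: smooth_on_germ => // x /sU.
Qed.

Section Linear.
Variables (W : vectType R).
Implicit Types (r s : V -> W).

Lemma smooth_vect_near a r : smooth_vect a r -> \forall x \near a, smooth_vect x r.
Proof. by move=> sr; apply: near_forall => k; exact: smooth_germ_near (sr k). Qed.

Lemma smooth_vect_eq a r s : (\forall x \near a, r x = s x) ->
  smooth_vect a r -> smooth_vect a s.
Proof.
by move=> rs sr k; apply: smooth_germ_eq (sr k); apply: filterS rs => x ->.
Qed.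

(** A linear form is a combination of coordinates: smoothness is independent of
    the basis. *)
Lemma smooth_form a r (f : W -> R^o) : linear f -> smooth_vect a r ->
  smooth_germ a (fun x => f (r x)).
Proof.
move=> lf sr; apply: smooth_germ_eq (smooth_germ_sum _ _
  (fun k => smooth_germ_mul (sr k) (smooth_germ_cst a (f (vbasis {: W})`_k)))).
near=> x; rewrite [in RHS](vect_expand (r x)) lin_sum //.
Unshelve. all: by end_near. Qed.

Lemma derive_form a v r (f : W -> R^o) : linear f -> smooth_vect a r ->
  'D_v (fun x => f (r x)) a = f (vD v r a).
Proof.
move=> lf sr.
have -> : (fun x => f (r x)) =
    \sum_(k < \dim {: W}) (f (vbasis {: W})`_k \*o (fun x => vcoord k (r x) : R)).
  apply/funext => x; rewrite [in LHS](vect_expand (r x)) lin_sum // fct_sumE.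
  by apply: eq_bigr => k _ /=; rewrite mulrC.
have dk k : derivable (fun x => vcoord k (r x) : R^o) a v.
  by apply: diff_derivable; exact: smooth_germ_diff.
rewrite derive_sum; last first.
  by move=> k; apply: derivableM => //; exact: derivable_cst.
rewrite /vD lin_sum //; apply: eq_bigr => k _.
by rewrite deriveMl //; exact: mulrC.
Qed.

Lemma vcoord_vD a v r k : vcoord k (vD v r a) = 'D_v (fun x => vcoord k (r x)) a.
Proof. exact: vcoord_basis_sum. Qed.

Lemma vD_eq a v r s : (\forall x \near a, r x = s x) -> vD v r a = vD v s a.
Proof.
move=> rs; apply: eq_bigr => k _; congr (_ *: _).
by apply: near_eq_derive; apply: filterS rs => x ->.
Qed.

Lemma vD_linv a (c : R) v w r : smooth_vect a r ->
  vD (c *: v + w) r a = c *: vD v r a + vD w r a.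
Proof.
move=> sr; apply: vect_ext => k; rewrite [RHS]vcoord_linear !vcoord_vD.
by rewrite derive_linv //; exact: smooth_germ_diff.
Qed.

Lemma vD_expand a v r : smooth_vect a r ->
  vD v r a = \sum_k v 0 k *: vD (basis_vec k) r a.
Proof.
move=> sr; apply: vect_ext => k; rewrite [RHS](lin_sum _ _ (@vcoord_linear W k)).
rewrite vcoord_vD derive_expand; last exact: smooth_germ_diff.
by apply: eq_bigr => i _; rewrite vcoord_vD.
Qed.

Lemma smooth_vect_derive a v r : smooth_vect a r -> smooth_vect a (fun x => vD v r x).
Proof.
move=> sr k; apply: smooth_germ_eq (smooth_germ_derive v (sr k)).
by near=> x; rewrite vcoord_vD.
Unshelve. all: by end_near. Qed.

Lemma smooth_vect_derive_along a (X : V -> V) r : smooth_row a X ->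
  smooth_vect a r -> smooth_vect a (fun x => vD (X x) r x).
Proof.
move=> sX sr k; apply: smooth_germ_eq (smooth_germ_sum _ _
  (fun j => smooth_germ_mul (sX j) (smooth_vect_derive (basis_vec j) sr k))).
have := smooth_vect_near sr; apply: filterS => x srx.
by rewrite (vD_expand _ srx) (lin_sum _ _ (@vcoord_linear W k)).
Qed.

Lemma smooth_vect_add a r s : smooth_vect a r -> smooth_vect a s ->
  smooth_vect a (fun x => r x + s x).
Proof.
move=> sr ss k; apply: smooth_germ_eq (smooth_germ_add (sr k) (ss k)).
by near=> x; rewrite /vcoord linearD.
Unshelve. all: by end_near. Qed.

Lemma smooth_vect_sub a r s : smooth_vect a r -> smooth_vect a s ->
  smooth_vect a (fun x => r x - s x).
Proof.
move=> sr ss k; apply: smooth_germ_eq (smooth_germ_sub (sr k) (ss k)).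
by near=> x; rewrite /vcoord linearB.
Unshelve. all: by end_near. Qed.

Lemma smooth_bilinear_form a r s (b : W -> W -> R^o) :
  (forall y, linear (b ^~ y)) -> (forall x, linear (b x)) ->
  smooth_vect a r -> smooth_vect a s -> smooth_germ a (fun x => b (r x) (s x)).
Proof.
move=> bl br sr ss.
pose F k := fun x => vcoord k (r x) * b (vbasis {: W})`_k (s x).
have sF k : smooth_germ a (F k).
  by apply: smooth_germ_mul (sr k) _; exact: smooth_form.
apply: smooth_germ_eq (smooth_germ_sum _ _ sF).
by near=> x; rewrite [in RHS](vect_expand (r x)) (lin_sum _ _ (bl (s x))).
Unshelve. all: by end_near. Qed.

End Linear.

Lemma smooth_vect_lin (W W' : vectType R) a (L : W -> W') (r : V -> W) :
  linear L -> smooth_vect a r -> smooth_vect a (fun x => L (r x)).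
Proof.
move=> lL sr k; apply: (smooth_form (f := fun z => vcoord k (L z)) _ sr).
by move=> c x y; rewrite lL vcoord_linear.
Qed.

Lemma vD_lin (W W' : vectType R) a v (L : W -> W') (r : V -> W) :
  linear L -> smooth_vect a r -> vD v (fun x => L (r x)) a = L (vD v r a).
Proof.
move=> lL sr; apply: vect_ext => k; rewrite vcoord_vD.
apply: (@derive_form _ a v r (fun z => vcoord k (L z))) => //.
by move=> c x y; rewrite lL vcoord_linear.
Qed.

Lemma smooth_vect_bilinear (W W' : vectType R) a (b : W -> W -> W') (r s : V -> W) :
  (forall y, linear (b ^~ y)) -> (forall x, linear (b x)) ->
  smooth_vect a r -> smooth_vect a s -> smooth_vect a (fun x => b (r x) (s x)).
Proof.
move=> bl br sr ss k.
apply: (smooth_bilinear_form (b := fun x y => vcoord k (b x y))) => //.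
  by move=> y c u w; rewrite bl vcoord_linear.
by move=> x c u w; rewrite br vcoord_linear.
Qed.

(** The elementary endomorphisms write [F x] as a combination of constant ones, with
    coefficients the coordinates of the values of [F x] on a basis. *)
Lemma smooth_vect_End (W : vectType R) a (F : V -> 'End(W)) :
  (forall w : W, smooth_vect a (fun x => F x w)) -> smooth_vect a F.
Proof.
move=> sF l; pose b := vbasis {: W}.
pose e (j k : 'I_(\dim {: W})) (w : W) : W := vcoord j w *: b`_k.
have le j k : linear (e j k).
  by move=> c x y; rewrite /e vcoord_linear scalerDl scalerA.
pose L j k : 'End(W) :=
  linfun (HB.pack (e j k) (GRing.isLinear.Build R W W *:%R _ (le j k)) : {linear W -> W}).
have s (j k : 'I_(\dim {: W})) :
    smooth_germ a (fun x => vcoord k (F x b`_j) * vcoord l (L j k) : R^o).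
  by apply: smooth_germ_mul (smooth_germ_cst a _); exact: sF.
apply: smooth_germ_eq (smooth_germ_sum (index_enum _) predT
  (fun j => smooth_germ_sum (index_enum _) predT (s j))).
near=> x.
have FE : F x = \sum_(j < \dim {: W}) \sum_(k < \dim {: W}) vcoord k (F x b`_j) *: L j k.
  apply/lfunP => w; rewrite sum_lfunE [in LHS](vect_expand w) linear_sum.
  apply: eq_bigr => j _; rewrite linearZ /= [in LHS](vect_expand (F x b`_j)).
  rewrite scaler_sumr sum_lfunE; apply: eq_bigr => k _.
  by rewrite scale_lfunE lfunE /= /e !scalerA mulrC.
rewrite [in RHS]FE vcoord_sum; apply: eq_bigr => j _; rewrite vcoord_sum.
by apply: eq_bigr => k _; rewrite [RHS]vcoordZ.
Unshelve. all: by end_near. Qed.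

(** The basis [vbasis] of the product is unrelated to those of the factors; linear
    forms on the product and on the factors mediate between them. *)
Lemma smooth_vect_triple (W : vectType R) a (u : V -> V * V * W) :
  smooth_vect a u <->
  [/\ smooth_row a (fun x => (u x).1.1), smooth_row a (fun x => (u x).1.2) &
      smooth_vect a (fun x => (u x).2)].
Proof.
split=> [su|[s1 s2 s3]].
  split=> k.
  - by apply: (smooth_form (f := fun z : (V * V * W)%type => z.1.1 0 k : R^o) _ su) => c x y;
      rewrite !mxE.
  - by apply: (smooth_form (f := fun z : (V * V * W)%type => z.1.2 0 k : R^o) _ su) => c x y;
      rewrite !mxE.
  - apply: (smooth_form (f := fun z : (V * V * W)%type => vcoord k z.2) _ su) => c x y.
    by rewrite vcoord_linear.
move=> k.
pose f1 (X : V) : R^o := vcoord k ((X, 0, 0) : V * V * W).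
pose f2 (X : V) : R^o := vcoord k ((0, X, 0) : V * V * W).
pose f3 (r : W) : R^o := vcoord k ((0, 0, r) : V * V * W).
have lf1 : linear f1.
  move=> c x y; rewrite /f1 -vcoord_linear; congr vcoord.
  by rewrite -[RHS]/(_, _, _) /= !scaler0 !addr0.
have lf2 : linear f2.
  move=> c x y; rewrite /f2 -vcoord_linear; congr vcoord.
  by rewrite -[RHS]/(_, _, _) /= !scaler0 !addr0.
have lf3 : linear f3.
  move=> c x y; rewrite /f3 -vcoord_linear; congr vcoord.
  by rewrite -[RHS]/(_, _, _) /= !scaler0 !addr0.
have row_form (f : V -> R^o) (X : V -> V) : linear f -> smooth_row a X ->
    smooth_germ a (fun x => f (X x)).
  move=> lf sX; apply: smooth_germ_eq (smooth_germ_sum _ _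
    (fun k => smooth_germ_mul (sX k) (smooth_germ_cst a (f (basis_vec k))))).
  by near=> x; rewrite [in RHS](row_expand (X x)) lin_sum.
apply: smooth_germ_eq (smooth_germ_add (smooth_germ_add (row_form _ _ lf1 s1)
  (row_form _ _ lf2 s2)) (smooth_form lf3 s3)).
near=> x; rewrite /f1 /f2 /f3 /vcoord -!linearD; congr (coord _ _ _).
case: (u x) => [[X xi] r]; rewrite -[LHS]/(_, _, _) /=.
by rewrite !addr0 !add0r.
Unshelve. all: by end_near. Qed.

End VectValued.

(** * Complex coordinates on real vectors and covectors *)

Section ComplexParts.
Context {R : realType}.
Implicit Types z w : R[i].

Lemma complex_ext z w : complex.Re z = complex.Re w ->
  complex.Im z = complex.Im w -> z = w.
Proof. by case: z w => [a b] [c d] /= -> ->. Qed.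

Lemma Re_add z w : complex.Re (z + w) = complex.Re z + complex.Re w.
Proof. by case: z w => [a b] [c d]. Qed.

Lemma Im_add z w : complex.Im (z + w) = complex.Im z + complex.Im w.
Proof. by case: z w => [a b] [c d]. Qed.

Lemma Re_opp z : complex.Re (- z) = - complex.Re z.
Proof. by case: z. Qed.

Lemma Re_mul z w :
  complex.Re (z * w) = complex.Re z * complex.Re w - complex.Im z * complex.Im w.
Proof. by case: z w => [a b] [c d]. Qed.

Lemma Im_mul z w :
  complex.Im (z * w) = complex.Re z * complex.Im w + complex.Im z * complex.Re w.
Proof. by case: z w => [a b] [c d]. Qed.

Lemma Re_scale (c : R) z : complex.Re (Complex c 0 * z) = c * complex.Re z.
Proof. by case: z => x y /=; rewrite mul0r subr0. Qed.

Lemma Im_scale (c : R) z : complex.Im (Complex c 0 * z) = c * complex.Im z.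
Proof. by case: z => x y /=; rewrite mul0r addr0. Qed.

Lemma Re_sum (I : Type) (s : seq I) (P : pred I) (F : I -> R[i]) :
  complex.Re (\sum_(i <- s | P i) F i) = \sum_(i <- s | P i) complex.Re (F i).
Proof. by apply: (big_morph _ Re_add). Qed.

Lemma Im_sum (I : Type) (s : seq I) (P : pred I) (F : I -> R[i]) :
  complex.Im (\sum_(i <- s | P i) F i) = \sum_(i <- s | P i) complex.Im (F i).
Proof. by apply: (big_morph _ Im_add). Qed.

Lemma inv2_complex : (2%:R : R[i])^-1 = Complex (2%:R^-1) 0.
Proof.
have -> : (2%:R : R[i]) = real_complex R 2%:R by rewrite rmorph_nat.
by rewrite -fmorphV.
Qed.

Lemma Re_half z : complex.Re (z / 2%:R) = complex.Re z / 2%:R.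
Proof. by rewrite inv2_complex Re_mul /= mulr0 subr0. Qed.

Lemma Im_half z : complex.Im (z / 2%:R) = complex.Im z / 2%:R.
Proof. by rewrite inv2_complex Im_mul /= mulr0 add0r. Qed.

End ComplexParts.

Section ComplexRows.
Context {R : realType} {n : nat}.
Local Notation V := 'rV[R]_(n + n).
Local Notation C := R[i].
Local Notation ii := (Complex 0 1 : R[i]).
Implicit Types (v w X Y xi eta : V).

Lemma zcoordP v w : (forall k, zcoord k v = zcoord k w) -> v = w.
Proof.
move=> E; apply/rowP => j; case: (split_ordP j) => k ->; by have [] := E k.
Qed.

Lemma zcoord_linear k (c : R) v w :
  zcoord k (c *: v + w) = Complex c 0 * zcoord k v + zcoord k w.
Proof. by apply: complex_ext; rewrite /= !mxE; ring. Qed.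

Lemma zcoordD k v w : zcoord k (v + w) = zcoord k v + zcoord k w.
Proof. by apply: complex_ext; rewrite /= !mxE. Qed.

Lemma zcoordN k v : zcoord k (- v) = - zcoord k v.
Proof. by apply: complex_ext; rewrite /= !mxE. Qed.

Lemma zcoord_mul_i k v : zcoord k (mul_i v) = ii * zcoord k v.
Proof.
apply: complex_ext; rewrite /zcoord /mul_i /=.
  by rewrite row_mxEl mxE [rsubmx _ _ _]mxE; ring.
by rewrite row_mxEr [lsubmx _ _ _]mxE; ring.
Qed.

Lemma mul_i_linear : linear (@mul_i R n).
Proof.
move=> c x y; apply: zcoordP => k.
by rewrite zcoord_mul_i !zcoord_linear !zcoord_mul_i mulrDr mulrCA.
Qed.
HB.instance Definition _ := GRing.isLinear.Build R V V *:%R (@mul_i R n) mul_i_linear.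

Lemma mul_iK v : mul_i (mul_i v) = - v.
Proof.
apply: zcoordP => k; rewrite !zcoord_mul_i zcoordN mulrA.
by apply: complex_ext; rewrite /=; ring.
Qed.

Lemma dual_map_linear (f : V -> V) : linear (dual_map f).
Proof. by move=> c x y; apply/rowP => j; rewrite !mxE pairing_linl. Qed.
HB.instance Definition _ (f : V -> V) :=
  GRing.isLinear.Build R V V *:%R (dual_map f) (@dual_map_linear f).

(** This turns statements on real vectors and covectors into statements on complex
    rows of half the length, where [mul_i] is multiplication by [i]. *)
Lemma pairing_complex xi X :
  pairing xi X = 2%:R * complex.Re (\sum_k cov_dz xi k * zcoord k X).
Proof.
rewrite pairingE big_split_ord /= -big_split /= Re_sum mulr_sumr.
apply: eq_bigr => k _; rewrite Re_mul /cov_dz Re_half Im_half /=; by field.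
Qed.

Definition of_zrow (z : 'I_n -> C) : V :=
  row_mx (\row_k complex.Re (z k)) (\row_k complex.Im (z k)).

Lemma zcoord_of_zrow z k : zcoord k (of_zrow z) = z k.
Proof. by apply: complex_ext; rewrite /= ?row_mxEl ?row_mxEr mxE. Qed.

(** The factors 2 and -2 undo the normalisation of [cov_dz]. *)
Definition of_crow (z : 'I_n -> C) : V :=
  row_mx (\row_k (2%:R * complex.Re (z k))) (\row_k (- 2%:R * complex.Im (z k))).

Lemma cov_dz_of_crow z k : cov_dz (of_crow z) k = z k.
Proof.
by apply: complex_ext; rewrite /cov_dz ?Re_half ?Im_half /= ?row_mxEl ?row_mxEr mxE; field.
Qed.

Lemma Re_cov_dz xi k : complex.Re (cov_dz xi k) = xi 0 (lshift n k) / 2%:R.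
Proof. exact: Re_half. Qed.

Lemma Im_cov_dz xi k : complex.Im (cov_dz xi k) = - xi 0 (rshift n k) / 2%:R.
Proof. exact: Im_half. Qed.

Lemma cov_dz_linear k (c : R) xi eta :
  cov_dz (c *: xi + eta) k = Complex c 0 * cov_dz xi k + cov_dz eta k.
Proof.
by apply: complex_ext;
  rewrite ?Re_add ?Im_add ?Re_mul ?Im_mul /cov_dz ?Re_half ?Im_half /= !mxE; field.
Qed.

(** A complex linear functional is determined by its real part. *)
Lemma cov_dz_unique xi (z : 'I_n -> C) :
  (forall X, pairing xi X = 2%:R * complex.Re (\sum_k z k * zcoord k X)) ->
  forall k, cov_dz xi k = z k.
Proof.
move=> E k.
have two0 : (2%:R : R) != 0 by rewrite pnatr_eq0.
have {}E (c : C) : complex.Re (cov_dz xi k * c) = complex.Re (z k * c).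
  have := E (of_zrow (fun l => if l == k then c else 0)).
  rewrite pairing_complex => /(mulfI two0).
  rewrite (bigD1 k) //= [in RHS](bigD1 k) //= !zcoord_of_zrow eqxx.
  by rewrite !big1 ?addr0 // => l lk; rewrite zcoord_of_zrow (negPf lk) mulr0.
apply: complex_ext; first by have := E 1; rewrite !mulr1.
by have := E ii; rewrite !Re_mul /= !mulr0 !mulr1 !sub0r => /oppr_inj.
Qed.

Lemma zcoord_unique X (z : 'I_n -> C) :
  (forall xi, pairing xi X = 2%:R * complex.Re (\sum_k cov_dz xi k * z k)) ->
  forall k, zcoord k X = z k.
Proof.
move=> E k.
have two0 : (2%:R : R) != 0 by rewrite pnatr_eq0.
have {}E (c : C) : complex.Re (c * zcoord k X) = complex.Re (c * z k).
  have := E (of_crow (fun l => if l == k then c else 0)).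
  rewrite pairing_complex => /(mulfI two0).
  rewrite (bigD1 k) //= [in RHS](bigD1 k) //= !cov_dz_of_crow eqxx.
  by rewrite !big1 ?addr0 // => l lk; rewrite cov_dz_of_crow (negPf lk) mul0r.
apply: complex_ext; first by have := E 1; rewrite !mul1r.
by have := E ii; rewrite !Re_mul /= !mul0r !mul1r !sub0r => /oppr_inj.
Qed.

Lemma cov_dz_dual_mul_i xi k : cov_dz (dual_map (@mul_i R n) xi) k = ii * cov_dz xi k.
Proof.
move: k; apply: cov_dz_unique => X; rewrite dual_mapE pairing_complex.
by congr (_ * complex.Re _); apply: eq_bigr => k _; rewrite zcoord_mul_i mulrCA mulrA.
Qed.

Lemma cov_dzP xi eta : (forall k, cov_dz xi k = cov_dz eta k) -> xi = eta.
Proof.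
move=> E; apply: pairing_ext => X; rewrite !pairing_complex.
by under eq_bigr do rewrite E.
Qed.

Lemma beta_form_linr b xi (c : R) eta eta' :
  beta_form b xi (c *: eta + eta') = Complex c 0 * beta_form b xi eta + beta_form b xi eta' :> C.
Proof.
rewrite /beta_form mulr_sumr -big_split; apply: eq_bigr => k _ /=.
rewrite mulr_sumr -big_split; apply: eq_bigr => l _ /=.
by rewrite cov_dz_linear; ring.
Qed.

Lemma B_formE (b : 'M[C]_n) xi eta : B_form b xi eta = 2%:R * complex.Re (beta_form b xi eta).
Proof. by rewrite /B_form Re_add; case: (beta_form _ _ _) => x y /=; ring. Qed.

Lemma pairing_B_map (b : 'M[C]_n) xi eta : pairing eta (B_map b xi) = B_form b xi eta.
Proof.
rewrite pairingC /B_map; apply: pairing_row => c x y.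
by rewrite !B_formE beta_form_linr Re_add Re_mul /=; ring.
Qed.

(** The main property of the real bivector [beta + conj beta]: in complex coordinates
    its map is multiplication by the matrix of [beta]. Commutation with the complex
    structure, behaviour under charts and non-degeneracy all follow from it. *)
Lemma zcoord_B_map (b : 'M[C]_n) xi l :
  zcoord l (B_map b xi) = \sum_k b k l * cov_dz xi k.
Proof.
move: l; apply: zcoord_unique => eta; rewrite pairing_B_map B_formE.
congr (_ * complex.Re _); rewrite /beta_form exchange_big; apply: eq_bigr => l _ /=.
by rewrite mulr_sumr; apply: eq_bigr => k _; rewrite mulrC.
Qed.

Lemma B_map_linear (b : 'M[C]_n) : linear (B_map b).
Proof.
move=> c x y; apply: zcoordP => l; rewrite zcoord_linear !zcoord_B_map mulr_sumr.
rewrite -big_split; apply: eq_bigr => k _ /=; rewrite cov_dz_linear; ring.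
Qed.
HB.instance Definition _ (b : 'M[C]_n) :=
  GRing.isLinear.Build R V V *:%R (B_map b) (@B_map_linear b).

Lemma B_map_skew (b : 'M[C]_n) xi eta : b^T = - b ->
  pairing eta (B_map b xi) = - pairing xi (B_map b eta).
Proof.
move=> bT; rewrite !pairing_B_map !B_formE -mulrN -Re_opp; congr (_ * complex.Re _).
rewrite /beta_form exchange_big -sumrN; apply: eq_bigr => l _ /=.
rewrite -sumrN; apply: eq_bigr => k _.
have -> : b k l = - b l k.
  by have := congr1 (fun A : 'M[C]_n => A l k) bT; rewrite !mxE.
by ring.
Qed.

(** [beta + conj beta] has no component of type (1,1). *)
Lemma mul_i_B_map (b : 'M[C]_n) xi :
  mul_i (B_map b xi) = B_map b (dual_map (@mul_i R n) xi).
Proof.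
apply: zcoordP => l; rewrite zcoord_mul_i !zcoord_B_map mulr_sumr.
by apply: eq_bigr => k _; rewrite cov_dz_dual_mul_i mulrCA.
Qed.

Lemma dual_mul_iK xi : dual_map (@mul_i R n) (dual_map (@mul_i R n) xi) = - xi.
Proof.
apply: cov_dzP => k; rewrite !cov_dz_dual_mul_i mulrA.
by apply: complex_ext; rewrite !(Re_mul, Im_mul) /cov_dz ?Re_half ?Im_half /= !mxE; ring.
Qed.

(** Real covectors correspond bijectively to complex rows, on which the map is
    right multiplication by [b]. *)
Lemma B_map_bijective (b : 'M[C]_n) : bijective (B_map b) <-> \det b != 0.
Proof.
split=> [/bij_inj Binj|db].
  apply/negP => /det0P [u u0 ub0]; case/negP: u0; apply/eqP/rowP => k.
  rewrite mxE -(cov_dz_of_crow (fun k => u 0 k)).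
  have -> : of_crow (fun k => u 0 k) = 0.
    apply: Binj; rewrite linear0; apply: zcoordP => l; rewrite zcoord_B_map.
    have -> : zcoord l (0 : V) = 0 by apply: complex_ext; rewrite /= mxE.
    transitivity ((u *m b) 0 l); last by rewrite ub0 mxE.
    by rewrite mxE; apply: eq_bigr => j _; rewrite cov_dz_of_crow mulrC.
  by apply: complex_ext; rewrite /cov_dz ?Re_half ?Im_half /= !mxE; ring.
have ub : b \in unitmx by rewrite unitmxE unitfE.
pose f v := of_crow (fun k => ((\row_l zcoord l v) *m invmx b) 0 k).
exists f => x.
  apply: cov_dzP => k; rewrite cov_dz_of_crow.
  have -> : \row_l zcoord l (B_map b x) = (\row_l cov_dz x l) *m b.
    apply/rowP => l; rewrite !mxE zcoord_B_map.
    by apply: eq_bigr => j _; rewrite mxE mulrC.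
  by rewrite mulmxK // mxE.
apply: zcoordP => l; rewrite zcoord_B_map.
transitivity (((\row_l zcoord l x) *m invmx b *m b) 0 l).
  by rewrite [RHS]mxE; apply: eq_bigr => j _; rewrite cov_dz_of_crow mulrC.
by rewrite mulmxKV // mxE.
Qed.

End ComplexRows.

(** * Complex derivatives and holomorphic functions *)

Lemma derive_ext (R : realType) (V W : normedModType R) (f g : V -> W) (a v : V) :
  f =1 g -> 'D_v f a = 'D_v g a.
Proof. by move=> /funext ->. Qed.

Section ComplexDerivatives.
Context {R : realType} {n : nat}.
Local Notation V := 'rV[R]_(n + n).
Local Notation C := R[i].
Local Notation ii := (Complex 0 1 : R[i]).
Implicit Types (a v w : V) (f g : V -> C).

Definition csmooth a f : Prop :=
  smooth_germ a (fun x => complex.Re (f x)) /\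
  smooth_germ a (fun x => complex.Im (f x)).

Lemma csmooth_cst a (c : C) : csmooth a (fun _ => c).
Proof. by split; exact: smooth_germ_cst. Qed.

Lemma csmooth_eq a f g : (\forall x \near a, f x = g x) -> csmooth a f -> csmooth a g.
Proof.
move=> fg [s1 s2]; split; [apply: smooth_germ_eq s1|apply: smooth_germ_eq s2];
  by apply: filterS fg => x ->.
Qed.

Lemma csmooth_add a f g : csmooth a f -> csmooth a g -> csmooth a (fun x => f x + g x).
Proof.
move=> [s1 s2] [t1 t2]; split.
  by apply: smooth_germ_eq (smooth_germ_add s1 t1); near=> x; rewrite Re_add.
by apply: smooth_germ_eq (smooth_germ_add s2 t2); near=> x; rewrite Im_add.
Unshelve. all: by end_near. Qed.

Lemma csmooth_mul a f g : csmooth a f -> csmooth a g -> csmooth a (fun x => f x * g x).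
Proof.
move=> [s1 s2] [t1 t2]; split.
  apply: smooth_germ_eq (smooth_germ_sub (smooth_germ_mul s1 t1) (smooth_germ_mul s2 t2)).
  by near=> x; rewrite Re_mul.
apply: smooth_germ_eq (smooth_germ_add (smooth_germ_mul s1 t2) (smooth_germ_mul s2 t1)).
by near=> x; rewrite Im_mul.
Unshelve. all: by end_near. Qed.

Lemma csmooth_sum a (I : Type) (s : seq I) (P : pred I) (F : I -> V -> C) :
  (forall i, csmooth a (F i)) -> csmooth a (fun x => \sum_(i <- s | P i) F i x).
Proof.
move=> sF; elim: s => [|i s IH].
  by apply: csmooth_eq (csmooth_cst a 0); near=> x; rewrite big_nil.
case Pi : (P i).
  apply: csmooth_eq (csmooth_add (sF i) IH).
  by near=> x; rewrite big_cons Pi.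
by apply: csmooth_eq IH; near=> x; rewrite big_cons Pi.
Unshelve. all: by end_near. Qed.

Lemma csmooth_derivable a v f : csmooth a f ->
  derivable (fun x => complex.Re (f x) : R^o) a v /\
  derivable (fun x => complex.Im (f x) : R^o) a v.
Proof.
by move=> [s1 s2]; split; apply: diff_derivable; apply: smooth_germ_diff.
Qed.

Lemma cderive_eq a v f g : (\forall x \near a, f x = g x) -> cderive v f a = cderive v g a.
Proof.
move=> fg; apply: complex_ext; apply: near_eq_derive; by apply: filterS fg => x ->.
Qed.

Lemma cderive_cst a v (c : C) : cderive v (fun _ => c) a = 0.
Proof. by apply: complex_ext => /=; exact: derive_cst. Qed.

Lemma cderive_add a v f g : csmooth a f -> csmooth a g ->
  cderive v (fun x => f x + g x) a = cderive v f a + cderive v g a.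
Proof.
move=> /(csmooth_derivable v) [d1 d2] /(csmooth_derivable v) [e1 e2].
apply: complex_ext; rewrite /cderive /=.
  transitivity ('D_v ((fun x => complex.Re (f x) : R^o) + (fun x => complex.Re (g x) : R^o)) a).
    by apply: derive_ext => x; rewrite Re_add.
  exact: (deriveD d1 e1).
transitivity ('D_v ((fun x => complex.Im (f x) : R^o) + (fun x => complex.Im (g x) : R^o)) a).
  by apply: derive_ext => x; rewrite Im_add.
exact: (deriveD d2 e2).
Qed.

Lemma cderive_mul a v f g : csmooth a f -> csmooth a g ->
  cderive v (fun x => f x * g x) a = cderive v f a * g a + f a * cderive v g a.
Proof.
move=> /(csmooth_derivable v) [d1 d2] /(csmooth_derivable v) [e1 e2].
apply: complex_ext; rewrite /cderive /=.
  transitivity ('D_v ((fun x => complex.Re (f x) : R^o) * (fun x => complex.Re (g x) : R^o)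
     - (fun x => complex.Im (f x) : R^o) * (fun x => complex.Im (g x) : R^o)) a).
    by apply: derive_ext => x; rewrite Re_mul.
  apply: etrans (etrans (deriveB (derivableM d1 e1) (derivableM d2 e2))
    (congr2 (fun p q : R => p - q) (deriveM d1 e1) (deriveM d2 e2))) _.
  rewrite Re_add !Re_mul /= -![_ *: _]/(_ * _).
  move: ('D_v _ a : R) ('D_v _ a : R) ('D_v _ a : R) ('D_v _ a : R) => p q r s.
  by ring.
transitivity ('D_v ((fun x => complex.Re (f x) : R^o) * (fun x => complex.Im (g x) : R^o)
     + (fun x => complex.Im (f x) : R^o) * (fun x => complex.Re (g x) : R^o)) a).
  by apply: derive_ext => x; rewrite Im_mul.
apply: etrans (etrans (deriveD (derivableM d1 e2) (derivableM d2 e1))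
  (congr2 (fun p q : R => p + q) (deriveM d1 e2) (deriveM d2 e1))) _.
rewrite Im_add !Im_mul /= -![_ *: _]/(_ * _).
move: ('D_v _ a : R) ('D_v _ a : R) ('D_v _ a : R) ('D_v _ a : R) => p q r s.
by ring.
Qed.

Lemma cderive_sum a v (I : Type) (s : seq I) (P : pred I) (F : I -> V -> C) :
  (forall i, csmooth a (F i)) ->
  cderive v (fun x => \sum_(i <- s | P i) F i x) a = \sum_(i <- s | P i) cderive v (F i) a.
Proof.
move=> sF; elim: s => [|i s IH].
  rewrite big_nil -[RHS](cderive_cst a v 0); apply: cderive_eq.
  by near=> x; rewrite big_nil.
rewrite big_cons; case Pi : (P i).
  rewrite -IH -cderive_add //; last exact: csmooth_sum.
  by apply: cderive_eq; near=> x; rewrite big_cons Pi.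
by rewrite -IH; apply: cderive_eq; near=> x; rewrite big_cons Pi.
Unshelve. all: by end_near. Qed.

Lemma cderive_linv a (c : R) v w f : csmooth a f ->
  cderive (c *: v + w) f a = Complex c 0 * cderive v f a + cderive w f a.
Proof.
move=> [/smooth_germ_diff d1 /smooth_germ_diff d2].
apply: complex_ext; rewrite ?Re_add ?Im_add ?Re_mul ?Im_mul /cderive /=.
  by rewrite mul0r subr0; exact: (derive_linv c v w d1).
by rewrite mul0r addr0; exact: (derive_linv c v w d2).
Qed.

Lemma cderive_expand a v f : csmooth a f ->
  cderive v f a = \sum_k (Complex (v 0 (lshift n k)) 0 * cderive (basis_vec (lshift n k)) f a
                        + Complex (v 0 (rshift n k)) 0 * cderive (basis_vec (rshift n k)) f a).
Proof.
move=> [/smooth_germ_diff d1 /smooth_germ_diff d2].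
apply: complex_ext; rewrite ?Re_sum ?Im_sum.
  apply: etrans (derive_expand v d1) _.
  rewrite big_split_ord [LHS]/= -big_split; apply: eq_bigr => k _.
  by rewrite Re_add; congr (_ + _); rewrite [RHS]Re_scale.
apply: etrans (derive_expand v d2) _.
rewrite big_split_ord [LHS]/= -big_split; apply: eq_bigr => k _.
by rewrite Im_add; congr (_ + _); rewrite [RHS]Im_scale.
Qed.

(** The Cauchy-Riemann equations make the differential complex linear. *)
Lemma cderive_hol a v f : csmooth a f -> (forall j, dzbar j f a = 0) ->
  cderive v f a = \sum_k zcoord k v * dz k f a.
Proof.
move=> sf hf; rewrite cderive_expand //; apply: eq_bigr => k _.
have := hf k; rewrite /dzbar /dz /=.
set p := cderive _ f a; set q := cderive _ f a => /eqP.
rewrite mulf_eq0 invr_eq0 pnatr_eq0 orbF addr_eq0 => /eqP ->.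
rewrite /zcoord; case: q => x y.
by apply: complex_ext; rewrite ?(Re_mul, Im_mul) ?Re_add ?Im_add ?Re_half ?Im_half /=; field.
Qed.

Lemma cderive_mul_i a v f : csmooth a f -> (forall j, dzbar j f a = 0) ->
  cderive (mul_i v) f a = ii * cderive v f a.
Proof.
move=> sf hf; rewrite !cderive_hol // mulr_sumr; apply: eq_bigr => k _.
by rewrite zcoord_mul_i mulrA.
Qed.

Lemma smooth_row_zcoord a (X : V -> V) : (forall k, csmooth a (fun x => zcoord k (X x))) ->
  smooth_row a X.
Proof. by move=> sX j; case: (split_ordP j) => k ->; have [] := sX k. Qed.

Lemma zcoord_derive a v k (X : V -> V) : smooth_row a X ->
  zcoord k ('D_v X a) = cderive v (fun x => zcoord k (X x)) a.
Proof.
move=> /smooth_row_diff dX.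
by apply: complex_ext; rewrite /zcoord /cderive /=; exact: derive_coord.
Qed.

Lemma csmooth_cov_dz a k (xi : V -> V) : smooth_row a xi -> csmooth a (fun x => cov_dz (xi x) k).
Proof.
move=> sX; split.
  apply: smooth_germ_eq (smooth_germ_mul (sX (lshift n k)) (smooth_germ_cst a (2%:R^-1))).
  by near=> x; rewrite /cov_dz Re_half.
apply: smooth_germ_eq (smooth_germ_mul (smooth_germ_opp (sX (rshift n k)))
  (smooth_germ_cst a (2%:R^-1))).
by near=> x; rewrite /cov_dz Im_half.
Unshelve. all: by end_near. Qed.

Lemma cov_dz_derive a v k (xi : V -> V) : smooth_row a xi ->
  cov_dz ('D_v xi a) k = cderive v (fun x => cov_dz (xi x) k) a.
Proof.
move=> /smooth_row_diff dX.
have dj j : derivable (fun x => xi x 0 j : R^o) a v by exact: derivable_coord.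
apply: complex_ext.
  rewrite Re_cov_dz (derive_coord v _ dX) mulrC.
  apply: etrans (esym (deriveMl _ (dj _))) _.
  rewrite -[RHS]/('D_v (fun x => complex.Re (cov_dz (xi x) k) : R^o) a).
  by apply: derive_ext => x; rewrite Re_cov_dz mulrC.
rewrite Im_cov_dz (derive_coord v _ dX) mulNr mulrC -mulNr.
apply: etrans (esym (deriveMl _ (dj _))) _.
rewrite -[RHS]/('D_v (fun x => complex.Im (cov_dz (xi x) k) : R^o) a).
by apply: derive_ext => x; rewrite Im_cov_dz mulNr mulrC -mulNr.
Qed.

Lemma smooth_B_map a (b : V -> 'M[C]_n) (xi : V -> V) :
  (forall k l, csmooth a (fun x => b x k l)) -> smooth_row a xi ->
  smooth_row a (fun x => B_map (b x) (xi x)).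
Proof.
move=> sb sx; apply: smooth_row_zcoord => l.
apply: csmooth_eq (csmooth_sum _ _ (fun k => csmooth_mul (sb k l) (csmooth_cov_dz k sx))).
by near=> x; rewrite zcoord_B_map.
Unshelve. all: by end_near. Qed.

Definition mx_cderive (v : V) (b : V -> 'M[C]_n) (a : V) : 'M[C]_n :=
  \matrix_(k, l) cderive v (fun x => b x k l) a.

Lemma derive_B_map a v (b : V -> 'M[C]_n) (xi : V -> V) :
  (forall k l, csmooth a (fun x => b x k l)) -> smooth_row a xi ->
  'D_v (fun x => B_map (b x) (xi x)) a =
  B_map (mx_cderive v b a) (xi a) + B_map (b a) ('D_v xi a).
Proof.
move=> sb sx; apply: zcoordP => l.
etransitivity; first exact: zcoord_derive (smooth_B_map sb sx).
transitivity (cderive v (fun x => \sum_k b x k l * cov_dz (xi x) k) a).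
  by apply: cderive_eq; near=> x; rewrite zcoord_B_map.
rewrite cderive_sum; last by move=> k; exact: csmooth_mul (sb k l) (csmooth_cov_dz k sx).
rewrite zcoordD !zcoord_B_map -big_split; apply: eq_bigr => k _ /=.
rewrite (cderive_mul _ (sb k l) (csmooth_cov_dz k sx)) mxE.
by congr (_ + _ * _); exact: esym (cov_dz_derive v k sx).
Unshelve. all: by end_near. Qed.

Lemma smooth_germ_hol U f a : open U -> holomorphic_on U f -> U a -> csmooth a f.
Proof. by move=> oU [s1 s2 _] Ua; split; exact: smooth_germ_on Ua. Qed.

Lemma dzbarE a f j : dzbar j f a =
  (cderive (basis_vec (lshift n j)) f a + ii * cderive (basis_vec (rshift n j)) f a) / 2%:R.
Proof. by []. Qed.

Definition hol_at a f := csmooth a f /\ forall j, dzbar j f a = 0.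

Lemma holomorphic_onP U f : open U ->
  (holomorphic_on U f <-> forall a, U a -> hol_at a f).
Proof.
move=> oU; split=> [hf a Ua|hf].
  split; first exact: smooth_germ_hol Ua.
  by have [_ _ h] := hf => j; exact: h.
split; last by move=> x j /hf [].
  by apply: smooth_on_germ => // a /hf [[]].
by apply: smooth_on_germ => // a /hf [[]].
Qed.

Lemma hol_cst a (c : C) : hol_at a (fun _ => c).
Proof.
split=> [|j]; first exact: csmooth_cst.
by rewrite dzbarE !cderive_cst mulr0 addr0 mul0r.
Qed.

Lemma hol_eq a f g : (\forall x \near a, f x = g x) -> hol_at a f -> hol_at a g.
Proof.
move=> fg [sf hf]; split=> [|j]; first exact: csmooth_eq sf.
by rewrite -(hf j) !dzbarE -!(cderive_eq _ fg).
Qed.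

Lemma hol_add a f g : hol_at a f -> hol_at a g -> hol_at a (fun x => f x + g x).
Proof.
move=> [sf hf] [sg hg]; split=> [|j]; first exact: csmooth_add.
rewrite dzbarE !cderive_add //.
transitivity (dzbar j f a + dzbar j g a); first last.
  by rewrite hf hg addr0.
rewrite !dzbarE.
move: (cderive _ f a) (cderive _ f a) (cderive _ g a) (cderive _ g a) => p q r s.
by field.
Qed.

Lemma hol_mul a f g : hol_at a f -> hol_at a g -> hol_at a (fun x => f x * g x).
Proof.
move=> [sf hf] [sg hg]; split=> [|j]; first exact: csmooth_mul.
rewrite dzbarE !cderive_mul //.
transitivity (dzbar j f a * g a + f a * dzbar j g a); first last.
  by rewrite hf hg mulr0 mul0r addr0.
rewrite !dzbarE.
move: (cderive _ f a) (cderive _ f a) (cderive _ g a) (cderive _ g a) => p q r s.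
by field.
Qed.

Lemma hol_sum a (I : Type) (s : seq I) (P : pred I) (F : I -> V -> C) :
  (forall i, hol_at a (F i)) -> hol_at a (fun x => \sum_(i <- s | P i) F i x).
Proof.
move=> sF; elim: s => [|i s IH].
  by apply: hol_eq (hol_cst a 0); near=> x; rewrite big_nil.
case Pi : (P i).
  apply: hol_eq (hol_add (sF i) IH).
  by near=> x; rewrite big_cons Pi.
by apply: hol_eq IH; near=> x; rewrite big_cons Pi.
Unshelve. all: by end_near. Qed.

Lemma hol_prod a (I : Type) (s : seq I) (P : pred I) (F : I -> V -> C) :
  (forall i, hol_at a (F i)) -> hol_at a (fun x => \prod_(i <- s | P i) F i x).
Proof.
move=> sF; elim: s => [|i s IH].
  by apply: hol_eq (hol_cst a 1); near=> x; rewrite big_nil.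
case Pi : (P i).
  apply: hol_eq (hol_mul (sF i) IH).
  by near=> x; rewrite big_cons Pi.
by apply: hol_eq IH; near=> x; rewrite big_cons Pi.
Unshelve. all: by end_near. Qed.

Lemma hol_det a (b : V -> 'M[C]_n) : (forall k l, hol_at a (fun x => b x k l)) ->
  hol_at a (fun x => \det (b x)).
Proof.
move=> hb; apply: hol_sum => s; apply: hol_mul; first exact: hol_cst.
exact: hol_prod.
Qed.

End ComplexDerivatives.

(** * The Nijenhuis identity at a point *)

Section NijenhuisAlgebra.
Context {R : realType} {m : nat}.
Local Notation V := 'rV[R]_m.
Variables (J Jt B : {linear V -> V}) (dB : V -> {linear V -> V}).
Hypothesis JJ : forall x, J (J x) = - x.
Hypothesis JtE : forall xi X, pairing (Jt xi) X = pairing xi (J X).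
Hypothesis B_skew : forall xi eta, pairing eta (B xi) = - pairing xi (B eta).
Hypothesis dB_skew : forall v xi eta,
  pairing eta (dB v xi) = - pairing xi (dB v eta).
Hypothesis JB : forall xi, J (B xi) = B (Jt xi).
Hypothesis dBD : forall v w xi, dB (v + w) xi = dB v xi + dB w xi.
Hypothesis dBJ : forall v xi, dB (J v) xi = J (dB v xi).
Hypothesis B_poisson : forall xi eta zeta,
  pairing zeta (dB (B xi) eta) + pairing xi (dB (B eta) zeta)
    + pairing eta (dB (B zeta) xi) = 0.

(** The covector part of the Dorfman bracket at a point, evaluated on [e]: the arguments
    [DX], [Dxi] and [Deta] are the derivatives of the fields, and [Q e] stands for
    the contribution of the bundle of Lie algebras. *)
Definition bracket_form (X : V) (DX : V -> V) (xi : V) (Dxi : V -> V) (Y : V)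
    (eta : V) (Deta : V -> V) (Q : V -> R) (e : V) : R :=
  pairing (Deta X) e + pairing eta (DX e) - pairing (Dxi Y) e
    + pairing (Dxi e) Y + Q e.

Let JD x y : J (x + y) = J x + J y. Proof. exact: linearD. Qed.
Let JN x : J (- x) = - J x. Proof. exact: linearN. Qed.

Variables (X xi Y eta : V) (DX Dxi DY Deta : V -> V).

Let X' := J X + B xi.
Let Y' := J Y + B eta.
Let DX' v := J (DX v) + (dB v xi + B (Dxi v)).
Let DY' v := J (DY v) + (dB v eta + B (Deta v)).
Let xi' := - Jt xi.
Let eta' := - Jt eta.
Let Dxi' v := - Jt (Dxi v).
Let Deta' v := - Jt (Deta v).

(** All terms in the derivatives of [X], [xi], [Y], [eta] cancel because [J] is
    constant, [J B = B Jt] and [B] is skew; those in the derivatives of [B] cancel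
    because [dB] is complex linear, except for the three that make up the Schouten
    bracket of [B] with itself. *)
Lemma nijenhuis_vector (F1 F2 : V) (Q1 Q2 : V -> R) :
  (forall e, pairing F1 e = bracket_form X' DX' xi' Dxi' Y eta Deta Q1 e) ->
  (forall e, pairing F2 e = bracket_form X DX xi Dxi Y' eta' Deta' Q2 e) ->
  (forall e, Q1 e + Q2 e = 0) ->
  J ((DY X' - DX' Y) + (DY' X - DX Y')) + B (F1 + F2) =
  (DY' X' - DX' Y') - (DY X - DX Y).
Proof.
move=> h1 h2 hQ.
suff E zeta : pairing zeta (J ((DY X' - DX' Y) + (DY' X - DX Y')) + B (F1 + F2)) =
    pairing zeta ((DY' X' - DX' Y') - (DY X - DX Y)).
  by apply: pairing_ext => zeta; rewrite !(pairingC _ zeta) E.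
rewrite pairingDr (B_skew (F1 + F2)) pairingDl h1 h2 /bracket_form.
have := hQ (B zeta); set q1 := Q1 _; set q2 := Q2 _ => {}hQ.
(* testing against [zeta] moves [B] from the unknown covector to [zeta]: the
   bracket forms are then evaluated on [B zeta] *)
have JBs x : pairing zeta (J (B x)) = - pairing x (J (B zeta)).
  by rewrite JB B_skew JtE.
have P := B_poisson xi eta zeta; rewrite (dB_skew _ zeta xi) in P.
have dX : dB X' eta = J (dB X eta) + dB (B xi) eta by rewrite dBD dBJ.
have dY : dB Y' xi = J (dB Y xi) + dB (B eta) xi by rewrite dBD dBJ.
rewrite /DX' /DY' /Dxi' /Deta' /xi' /eta' dX dY.
rewrite !(JD, JN, JJ, pairingDr, pairingNr, pairingDl, pairingNl, JtE, JBs).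
rewrite (B_skew (Deta X') zeta) (B_skew (Dxi Y') zeta) (B_skew (Dxi (B zeta)) eta).
lra.
Qed.

(** The cancellations are those of the vector component, without the Schouten
    bracket, which has no covector part. *)
Lemma nijenhuis_form (F1 F2 F3 F0 : V) (Q1 Q2 Q3 Q0 : V -> R) :
  (forall e, pairing F1 e = bracket_form X' DX' xi' Dxi' Y eta Deta Q1 e) ->
  (forall e, pairing F2 e = bracket_form X DX xi Dxi Y' eta' Deta' Q2 e) ->
  (forall e, pairing F3 e = bracket_form X' DX' xi' Dxi' Y' eta' Deta' Q3 e) ->
  (forall e, pairing F0 e = bracket_form X DX xi Dxi Y eta Deta Q0 e) ->
  (forall e, Q1 e + Q2 e = 0) -> (forall e, Q3 e = Q0 e) ->
  - Jt (F1 + F2) = F3 - F0.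
Proof.
move=> h1 h2 h3 h0 hQ hQ'; apply: pairing_ext => e.
rewrite pairingNl pairingDl pairingNl JtE pairingDl h1 h2 h3 h0 /bracket_form.
have := hQ (J e); have := hQ' e.
set q1 := Q1 _; set q2 := Q2 _; set q3 := Q3 _; set q0 := Q0 _ => {}hQ' {}hQ.
rewrite /DX' /DY' /Dxi' /Deta' /xi' /eta'.
have JBs (a b : V) : pairing a (J (B b)) = - pairing b (J (B a)).
  by rewrite JB B_skew JtE.
rewrite !(JD, JN, JJ, pairingDr, pairingNr, pairingDl, pairingNl, JtE, dBJ).
rewrite (B_skew (Dxi (J e)) eta) (JBs eta).
lra.
Qed.

End NijenhuisAlgebra.

(** * The Dorfman bracket in a flat trivialisation *)

Section QuadraticLieAlgebra.
Context {R : realType} (g : quadratic_lie_algebra R).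

Lemma qla_br_lin_l (z : g) : linear ((@qla_br R g)^~ z).
Proof. by move=> c x y; rewrite qla_br_linl. Qed.

Lemma qla_br_lin_r (z : g) : linear (@qla_br R g z).
Proof. by move=> c x y; rewrite qla_br_linr. Qed.

Lemma qla_sp_lin_l (z : g) : linear ((@qla_sp R g)^~ z : g -> R^o).
Proof. by move=> c x y; rewrite qla_sp_linl. Qed.

Lemma qla_sp_lin_r (z : g) : linear (@qla_sp R g z : g -> R^o).
Proof. by move=> c x y; rewrite !(qla_sp_sym z) qla_sp_linl. Qed.

Lemma qla_spZDl (c : R) (x y z : g) : qla_sp (c *: x + y) z = c * qla_sp x z + qla_sp y z.
Proof. exact: qla_sp_linl. Qed.

End QuadraticLieAlgebra.

Section LocalDorfman.
Context {R : realType} {m : nat} (g : quadratic_lie_algebra R).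
Local Notation V := 'rV[R]_m.
Local Notation E := (V * V * g)%type.
Implicit Types (a : V) (u v : V -> E).

(** The formula of [dorfman], for sections given by their local expressions. *)
Definition local_dorfman (a : V) (u v : V -> E) : E :=
  let X := fun x => (u x).1.1 in
  let xi := fun x => (u x).1.2 in
  let r := fun x => (u x).2 in
  let Y := fun x => (v x).1.1 in
  let eta := fun x => (v x).1.2 in
  let s := fun x => (v x).2 in
  (lie_bracket X Y a,
   lie_derivative X eta a - lie_derivative Y xi a
     + differential (fun x => pairing (xi x) (Y x)) a
     + \row_j (2%:R * qla_sp (vD (basis_vec j) r a) (s a)),
   vD (X a) s a - vD (Y a) r a + qla_br (r a) (s a)).

Lemma local_dorfman_eq a u u' v v' : (\forall x \near a, u x = u' x) ->
  (\forall x \near a, v x = v' x) -> local_dorfman a u v = local_dorfman a u' v'.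
Proof.
move=> eu ev.
have ua := nbhs_singleton eu; have va := nbhs_singleton ev.
have dE (W : normedModType R) (h : E -> W) (w : V) (f f' : V -> E) :
    (\forall x \near a, f x = f' x) ->
    'D_w (fun x => h (f x)) a = 'D_w (fun x => h (f' x)) a.
  by move=> ff; apply: near_eq_derive; apply: filterS ff => x ->.
have vE (w : V) (f f' : V -> E) : (\forall x \near a, f x = f' x) ->
    vD w (fun x => (f x).2) a = vD w (fun x => (f' x).2) a.
  by move=> ff; apply: vD_eq; apply: filterS ff => x ->.
have rowE (F F' : 'I_m -> R) : F =1 F' -> \row_j F j = \row_j F' j.
  by move=> FF'; apply/rowP => j; rewrite !mxE.
have L (f f' h h' : V -> E) : (\forall x \near a, f x = f' x) ->
    (\forall x \near a, h x = h' x) ->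
    lie_derivative (fun x => (f x).1.1) (fun x => (h x).1.2) a =
    lie_derivative (fun x => (f' x).1.1) (fun x => (h' x).1.2) a.
  move=> ff hh; rewrite /lie_derivative (nbhs_singleton ff) (nbhs_singleton hh).
  apply: (congr2 +%R (dE _ (fun z : E => z.1.2) _ _ _ hh)).
  apply: rowE => j; exact: (congr1 (pairing _) (dE _ (fun z : E => z.1.1) _ _ _ ff)).
have E1 : lie_bracket (fun x => (u x).1.1) (fun x => (v x).1.1) a =
    lie_bracket (fun x => (u' x).1.1) (fun x => (v' x).1.1) a.
  rewrite /lie_bracket ua va.
  exact: (congr2 (fun p q : V => p - q) (dE _ (fun z : E => z.1.1) _ _ _ ev)
    (dE _ (fun z : E => z.1.1) _ _ _ eu)).
have E2 : differential (fun x => pairing (u x).1.2 (v x).1.1) a =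
    differential (fun x => pairing (u' x).1.2 (v' x).1.1) a.
  apply: rowE => j; apply: near_eq_derive.
  by apply: filterS2 eu ev => x -> ->.
have E3 : \row_j (2%:R * qla_sp (vD (basis_vec j) (fun x => (u x).2) a) (v a).2) =
    \row_j (2%:R * qla_sp (vD (basis_vec j) (fun x => (u' x).2) a) (v' a).2).
  by apply: rowE => j; rewrite va (vE _ _ _ eu).
have E4 : vD (u a).1.1 (fun x => (v x).2) a - vD (v a).1.1 (fun x => (u x).2) a
      + qla_br (u a).2 (v a).2 =
    vD (u' a).1.1 (fun x => (v' x).2) a - vD (v' a).1.1 (fun x => (u' x).2) a
      + qla_br (u' a).2 (v' a).2.
  by rewrite ua va (vE _ _ _ ev) (vE _ _ _ eu).
exact: (congr2 pair (congr2 pair E1 (congr2 +%R (congr2 +%R (congr2 (fun p q : V => p - q)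
  (L _ _ _ _ eu ev) (L _ _ _ _ ev eu)) E2) E3)) E4).
Qed.

Section Smooth.
Variables (a : V) (u v : V -> E).
Hypotheses (su : smooth_vect a u) (sv : smooth_vect a v).

(** The term [pairing xi ('D_e Y)] of [- L_Y xi] cancels against the one of
    [d (xi Y)]; what is left contains no derivative of [Y]. *)
Lemma pairing_dorfman_form e :
  pairing (local_dorfman a u v).1.2 e =
  bracket_form (u a).1.1 (fun w => 'D_w (fun x => (u x).1.1) a)
               (u a).1.2 (fun w => 'D_w (fun x => (u x).1.2) a)
               (v a).1.1
               (v a).1.2 (fun w => 'D_w (fun x => (v x).1.2) a)
               (fun w => 2%:R * qla_sp (vD w (fun x => (u x).2) a) (v a).2) e.
Proof.
have [sX sxi sr] := (smooth_vect_triple a u).1 su.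
have [sY seta ss] := (smooth_vect_triple a v).1 sv.
have dX := smooth_row_diff sX; have dxi := smooth_row_diff sxi.
have dY := smooth_row_diff sY; have deta := smooth_row_diff seta.
have rowX : pairing (\row_j pairing (v a).1.2 ('D_(basis_vec j) (fun x => (u x).1.1) a)) e
   = pairing (v a).1.2 ('D_e (fun x => (u x).1.1) a).
  apply: (pairing_row (f := fun e => pairing (v a).1.2 ('D_e (fun x => (u x).1.1) a))).
  by move=> c x y; rewrite -pairing_linr; congr pairing; exact: derive_linv.
have rowY : pairing (\row_j pairing (u a).1.2 ('D_(basis_vec j) (fun x => (v x).1.1) a)) e
   = pairing (u a).1.2 ('D_e (fun x => (v x).1.1) a).
  apply: (pairing_row (f := fun e => pairing (u a).1.2 ('D_e (fun x => (v x).1.1) a))).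
  by move=> c x y; rewrite -pairing_linr; congr pairing; exact: derive_linv.
have rowd : pairing (differential (fun x => pairing (u x).1.2 (v x).1.1) a) e =
   pairing ('D_e (fun x => (u x).1.2) a) (v a).1.1 +
   pairing (u a).1.2 ('D_e (fun x => (v x).1.1) a).
  transitivity ('D_e (fun x => pairing (u x).1.2 (v x).1.1) a); last exact: derive_pairing.
  apply: (pairing_row (f := fun e => 'D_e (fun x => pairing (u x).1.2 (v x).1.1) a : R)).
  move=> c x y; apply: derive_linv; apply: smooth_germ_diff; exact: smooth_pairing.
have rowr : pairing (\row_j (2%:R * qla_sp (vD (basis_vec j) (fun x => (u x).2) a) (v a).2)) e =
   2%:R * qla_sp (vD e (fun x => (u x).2) a) (v a).2.
  apply: (pairing_row (f := fun e => 2%:R * qla_sp (vD e (fun x => (u x).2) a) (v a).2)).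
  by move=> c x y; rewrite vD_linv // qla_spZDl mulrDr mulrCA.
rewrite /local_dorfman /bracket_form /= /lie_derivative.
rewrite !(pairingDl, pairingNl) rowX rowY rowd rowr.
have alg (p q r s t z : R) : p + q - (r + s) + (t + s) + z = p + q - r + t + z by ring.
exact: alg.
Qed.

End Smooth.

Lemma smooth_vect_local_dorfman a u v : smooth_vect a u -> smooth_vect a v ->
  smooth_vect a (fun x => local_dorfman x u v).
Proof.
move=> su sv.
have [sX sxi sr] := (smooth_vect_triple a u).1 su.
have [sY seta ss] := (smooth_vect_triple a v).1 sv.
apply/smooth_vect_triple; split=> /=.
- move=> j; apply: smooth_germ_eq (smooth_germ_sub
    (smooth_row_derive_along sX sY j) (smooth_row_derive_along sY sX j)).
  by near=> x; rewrite /lie_bracket row_addE row_oppE.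
- move=> j.
  have cst (w : V) : smooth_row a (fun _ => w) by move=> k; exact: smooth_germ_cst.
  have D (w : V) (f : V -> V) : smooth_row a f -> smooth_row a (fun x => 'D_w f x).
    exact: smooth_row_derive.
  have T1 := smooth_pairing (smooth_row_derive_along sX seta) (cst (basis_vec j)).
  have T2 := smooth_pairing seta (D (basis_vec j) _ sX).
  have T3 := smooth_pairing (smooth_row_derive_along sY sxi) (cst (basis_vec j)).
  have T4 := smooth_pairing (D (basis_vec j) _ sxi) sY.
  have T5 := smooth_germ_scale 2%:R (smooth_bilinear_form (@qla_sp_lin_l R g)
    (@qla_sp_lin_r R g) (smooth_vect_derive (basis_vec j) sr) ss).
  apply: smooth_germ_eq (smooth_germ_add (smooth_germ_add (smooth_germ_sub
    (smooth_germ_add T1 T2) T3) T4) T5).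
  have := smooth_vect_near sv; have := smooth_vect_near su.
  apply: filterS2 => x sux svx; rewrite -pairing_basis.
  exact: esym (pairing_dorfman_form sux svx (basis_vec j)).
- apply: smooth_vect_add; first apply: smooth_vect_sub.
  + exact: smooth_vect_derive_along.
  + exact: smooth_vect_derive_along.
  + exact: (smooth_vect_bilinear (@qla_br_lin_l R g) (@qla_br_lin_r R g)).
Unshelve. all: by end_near. Qed.

End LocalDorfman.

(** * Vanishing of the Nijenhuis torsion *)

Section PoissonNijenhuis.
Context {R : realType} {n : nat} (g : quadratic_lie_algebra R).
Local Notation V := 'rV[R]_(n + n).
Local Notation C := R[i].
Local Notation ii := (Complex 0 1 : R[i]).
Local Notation E := (V * V * g)%type.

(** The vanishing of the Schouten bracket of a bivector with itself. *)
Definition poisson_at (b : V -> 'M[C]_n) (a : V) : Prop := forall j k l,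
  \sum_h (b a j h * dz h (fun x => b x k l) a + b a k h * dz h (fun x => b x l j) a
        + b a l h * dz h (fun x => b x j k) a) = 0.

(** The endomorphism [poisson_gcs] in a frame, as a function of the bivector. *)
Definition gcs_map (b : 'M[C]_n) (Jg : 'End(g)) (u : E) : E :=
  (mul_i u.1.1 + B_map b u.1.2, - dual_map (@mul_i R n) u.1.2, Jg u.2).

Lemma B_mapZi (b : 'M[C]_n) xi : B_map (ii *: b) xi = mul_i (B_map b xi).
Proof.
apply: zcoordP => l; rewrite zcoord_mul_i !zcoord_B_map mulr_sumr.
by apply: eq_bigr => k _; rewrite mxE mulrA.
Qed.

Lemma B_mapD (b b' : 'M[C]_n) xi : B_map (b + b') xi = B_map b xi + B_map b' xi.
Proof.
apply: zcoordP => l; rewrite zcoordD !zcoord_B_map -big_split.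
by apply: eq_bigr => k _; rewrite mxE mulrDl.
Qed.

Section At.
Variables (b : V -> 'M[C]_n) (a : V).
Hypothesis hb : forall k l, hol_at a (fun x => b x k l).
Hypothesis b_skew : \forall x \near a, (b x)^T = - b x.

Local Notation db v := (mx_cderive v b a).

Lemma mx_cderiveD v w : db (v + w) = db v + db w.
Proof.
apply/matrixP => k l; rewrite !mxE.
have := cderive_linv 1 v w (hb k l).1; rewrite scale1r => ->.
by congr (_ + _); exact: mul1r.
Qed.

Lemma mx_cderive_mul_i v : db (mul_i v) = ii *: db v.
Proof.
by apply/matrixP => k l; rewrite !mxE cderive_mul_i //; case: (hb k l).
Qed.

Lemma mx_cderive_skew v : (db v)^T = - db v.
Proof.
apply/matrixP => k l; rewrite !mxE.
have E : \forall x \near a, b x l k = - 1 * b x k l.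
  apply: filterS b_skew => x /(congr1 (fun A : 'M[C]_n => A k l)).
  by rewrite !mxE => ->; rewrite mulN1r.
rewrite (cderive_eq _ E) cderive_mul ?cderive_cst ?mul0r ?add0r ?mulN1r //.
  exact: csmooth_cst.
by case: (hb k l).
Qed.

(** Contracting the Schouten bracket of [beta] with three (1,0)-forms gives the
    cyclic sum of the derivatives of [B] along its own Hamiltonian vectors. *)
Lemma real_poisson : poisson_at b a -> forall xi eta zeta,
  pairing zeta (B_map (db (B_map (b a) xi)) eta)
  + pairing xi (B_map (db (B_map (b a) eta)) zeta)
  + pairing eta (B_map (db (B_map (b a) zeta)) xi) = 0.
Proof.
move=> hP xi eta zeta.
have dbE xi' k l : db (B_map (b a) xi') k l =
    \sum_j cov_dz xi' j * \sum_h b a j h * dz h (fun x => b x k l) a.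
  have [sf hf] := hb k l.
  rewrite mxE (cderive_hol _ sf hf).
  under eq_bigr do rewrite zcoord_B_map mulr_suml.
  rewrite exchange_big; apply: eq_bigr => j _ /=; rewrite mulr_sumr.
  by apply: eq_bigr => h _; ring.
pose D j k l := \sum_h b a j h * dz h (fun x => b x k l) a.
have hD j k l : D j k l + D k l j + D l j k = 0.
  by rewrite -[RHS](hP j k l) /D -!big_split.
have {}dbE xi' k l : db (B_map (b a) xi') k l = \sum_j cov_dz xi' j * D j k l.
  exact: dbE.
move: D hD dbE => D hD dbE.
move: (dbE xi) (dbE eta) (dbE zeta) => {dbE}.
move: (db _) (db _) (db _) => M3 M2 M1 d1 d2 d3.
rewrite !pairing_B_map !B_formE -!mulrDr -!Re_add.
suff -> : beta_form M1 eta zeta + beta_form M2 zeta xi + beta_form M3 xi eta = 0.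
  by rewrite mulr0.
pose p := cov_dz xi; pose q := cov_dz eta; pose r := cov_dz zeta.
have F1 : beta_form M1 eta zeta = \sum_j \sum_k \sum_l p j * q k * r l * D j k l.
  rewrite /beta_form.
  under eq_bigr => k _ do under eq_bigr => l _ do rewrite d1 !mulr_suml.
  under eq_bigr => k _ do rewrite exchange_big.
  rewrite exchange_big; apply: eq_bigr => j _; apply: eq_bigr => k _.
  by apply: eq_bigr => l _; rewrite /p /q /r; ring.
have F2 : beta_form M2 zeta xi = \sum_j \sum_k \sum_l p j * q k * r l * D k l j.
  rewrite /beta_form.
  under eq_bigr => l _ do under eq_bigr => j _ do rewrite d2 !mulr_suml.
  rewrite exchange_big; apply: eq_bigr => j _ /=.
  rewrite exchange_big; apply: eq_bigr => k _ /=.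
  by apply: eq_bigr => l _; rewrite /p /q /r; ring.
have F3 : beta_form M3 xi eta = \sum_j \sum_k \sum_l p j * q k * r l * D l j k.
  rewrite /beta_form; apply: eq_bigr => j _; apply: eq_bigr => k _.
  rewrite d3 !mulr_suml; apply: eq_bigr => l _.
  by rewrite /p /q /r; ring.
have -> : beta_form M1 eta zeta + beta_form M2 zeta xi + beta_form M3 xi eta =
  \sum_j (\sum_k \sum_l p j * q k * r l * D j k l + \sum_k \sum_l p j * q k * r l * D k l j
     + \sum_k \sum_l p j * q k * r l * D l j k).
  by rewrite F1 F2 F3 !big_split.
rewrite big1 // => j _; rewrite -!big_split big1 // => k _ /=.
rewrite -!big_split big1 // => l _ /=.
by rewrite -!mulrDr hD mulr0.
Qed.

Section Sections.
Variables (Jg : 'End(g)) (u v : V -> E).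
Hypothesis hJg : skew_complex_structure Jg.
Hypothesis hP : poisson_at b a.
Hypotheses (su : smooth_vect a u) (sv : smooth_vect a v).

Let T x := gcs_map (b x) Jg.

Lemma smooth_gcs_map w : smooth_vect a w -> smooth_vect a (fun x => T x (w x)).
Proof.
move=> /smooth_vect_triple [sX sxi sr]; apply/smooth_vect_triple; split=> /=.
- have sB := smooth_B_map (fun k l => (hb k l).1) sxi.
  move=> j; apply: smooth_germ_eq (smooth_germ_add (smooth_row_lin (@mul_i R n) sX j) (sB j)).
  by near=> x; rewrite row_addE.
- move=> j; apply: smooth_germ_eq (smooth_germ_opp (smooth_row_lin (dual_map (@mul_i R n)) sxi j)).
  by near=> x; rewrite row_oppE.
- by apply: smooth_vect_lin sr => c x y; rewrite linearP.
Unshelve. all: by end_near. Qed.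

Lemma derive_gcs_map1 w z : smooth_vect a w ->
  'D_z (fun x => (T x (w x)).1.1) a =
  mul_i ('D_z (fun x => (w x).1.1) a) +
    (B_map (db z) (w a).1.2 + B_map (b a) ('D_z (fun x => (w x).1.2) a)).
Proof.
move=> /smooth_vect_triple [sX sxi _].
have sB := smooth_B_map (fun k l => (hb k l).1) sxi.
have sJ := smooth_row_lin (@mul_i R n) sX.
have d1 := diff_derivable (v := z) (smooth_row_diff sJ).
have d2 := diff_derivable (v := z) (smooth_row_diff sB).
apply: etrans (deriveD d1 d2) _; apply: congr2.
  exact: derive_row_lin (smooth_row_diff sX).
exact: (derive_B_map z (fun k l => (hb k l).1) sxi).
Qed.

Lemma derive_gcs_map2 w z : smooth_vect a w ->
  'D_z (fun x => (T x (w x)).1.2) a = - dual_map (@mul_i R n) ('D_z (fun x => (w x).1.2) a).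
Proof.
move=> /smooth_vect_triple [_ sxi _].
have sJ := smooth_row_lin (dual_map (@mul_i R n)) sxi.
apply: etrans (deriveN (diff_derivable (v := z) (smooth_row_diff sJ))) _.
exact: (congr1 -%R (derive_row_lin _ _ (smooth_row_diff sxi))).
Qed.

Lemma derive_gcs_map3 w z : smooth_vect a w ->
  vD z (fun x => (T x (w x)).2) a = Jg (vD z (fun x => (w x).2) a).
Proof.
move=> /smooth_vect_triple [_ _ sr].
by apply: vD_lin sr => c x y; rewrite linearP.
Qed.

(** The three components are independent: the one in [g] is the integrability of
    [Jg], as [Jg] is parallel, and the other two are the pointwise identities
    [nijenhuis_vector] and [nijenhuis_form]. *)
Lemma gcs_nijenhuis :
  let Tu := fun x => T x (u x) in let Tv := fun x => T x (v x) in
  T a (local_dorfman a Tu v + local_dorfman a u Tv) =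
  local_dorfman a Tu Tv - local_dorfman a u v.
Proof.
move=> Tu Tv.
have sTu : smooth_vect a Tu := smooth_gcs_map su.
have sTv : smooth_vect a Tv := smooth_gcs_map sv.
have [JgJ Jg_skew Jg_int] := hJg.
have ba_skew := nbhs_singleton b_skew.
have D1u : (fun z => 'D_z (fun x => (Tu x).1.1) a) = _ :=
  funext (fun z => derive_gcs_map1 z su).
have D1v : (fun z => 'D_z (fun x => (Tv x).1.1) a) = _ :=
  funext (fun z => derive_gcs_map1 z sv).
have D2u : (fun z => 'D_z (fun x => (Tu x).1.2) a) = _ :=
  funext (fun z => derive_gcs_map2 z su).
have D2v : (fun z => 'D_z (fun x => (Tv x).1.2) a) = _ :=
  funext (fun z => derive_gcs_map2 z sv).
have h1 := pairing_dorfman_form sTu sv; rewrite D1u D2u in h1.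
have h2 := pairing_dorfman_form su sTv; rewrite D2v in h2.
have h3 := pairing_dorfman_form sTu sTv; rewrite D1u D2u D2v in h3.
have h0 := pairing_dorfman_form su sv.
have dB_skew z x y : pairing y (B_map (db z) x) = - pairing x (B_map (db z) y).
  exact: B_map_skew (mx_cderive_skew z).
have dBJ z x : B_map (db (mul_i z)) x = mul_i (B_map (db z) x).
  by rewrite mx_cderive_mul_i B_mapZi.
have dBD z w x : B_map (db (z + w)) x = B_map (db z) x + B_map (db w) x.
  by rewrite mx_cderiveD B_mapD.
have JtE x y : pairing (dual_map (@mul_i R n) x) y = pairing x (mul_i y).
  exact: dual_mapE.
have Q12 z : 2%:R * qla_sp (vD z (fun x => (Tu x).2) a) (v a).2
    + 2%:R * qla_sp (vD z (fun x => (u x).2) a) (Tv a).2 = 0.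
  rewrite (derive_gcs_map3 z su) Jg_skew.
  by rewrite mulrN addNr.
have Q30 z : 2%:R * qla_sp (vD z (fun x => (Tu x).2) a) (Tv a).2
    = 2%:R * qla_sp (vD z (fun x => (u x).2) a) (v a).2.
  rewrite (derive_gcs_map3 z su) Jg_skew /= JgJ.
  by rewrite (lin_opp _ (@qla_sp_lin_r R g _)) opprK.
have N1 := nijenhuis_vector (J := @mul_i R n) (Jt := dual_map (@mul_i R n))
  (B := B_map (b a)) (dB := fun z => B_map (db z))
  (X := (u a).1.1) (xi := (u a).1.2) (Y := (v a).1.1) (eta := (v a).1.2)
  (DX := fun z => 'D_z (fun x => (u x).1.1) a) (Dxi := fun z => 'D_z (fun x => (u x).1.2) a)
  (Deta := fun z => 'D_z (fun x => (v x).1.2) a)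
  (@mul_iK R n) JtE
  (fun x y => B_map_skew x y ba_skew) dB_skew (mul_i_B_map (b a)) dBD dBJ
  (real_poisson hP) (fun z => 'D_z (fun x => (v x).1.1) a) h1 h2 Q12.
have N2 := nijenhuis_form (J := @mul_i R n) (Jt := dual_map (@mul_i R n))
  (B := B_map (b a)) (dB := fun z => B_map (db z))
  (X := (u a).1.1) (xi := (u a).1.2) (Y := (v a).1.1) (eta := (v a).1.2)
  (DX := fun z => 'D_z (fun x => (u x).1.1) a) (Dxi := fun z => 'D_z (fun x => (u x).1.2) a)
  (Deta := fun z => 'D_z (fun x => (v x).1.2) a)
  (@mul_iK R n) JtE
  (fun x y => B_map_skew x y ba_skew) (mul_i_B_map (b a)) dBJ
  h1 h2 h3 h0 Q12 Q30.
have N3 : Jg ((local_dorfman a Tu v).2 + (local_dorfman a u Tv).2) =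
  (local_dorfman a Tu Tv).2 - (local_dorfman a u v).2.
  set r := (u a).2; set s := (v a).2.
  set X' := (Tu a).1.1; set Y' := (Tv a).1.1; set X := (u a).1.1; set Y := (v a).1.1.
  set r' := fun x => (u x).2; set s' := fun x => (v x).2.
  have -> : (local_dorfman a Tu v).2 =
    vD X' s' a - Jg (vD Y r' a) + qla_br (Jg r) s.
    by rewrite /local_dorfman /= (derive_gcs_map3 Y su).
  have -> : (local_dorfman a u Tv).2 =
    Jg (vD X s' a) - vD Y' r' a + qla_br r (Jg s).
    by rewrite /local_dorfman /= (derive_gcs_map3 X sv).
  have -> : (local_dorfman a Tu Tv).2 =
    Jg (vD X' s' a) - Jg (vD Y' r' a) + qla_br (Jg r) (Jg s).
    by rewrite /local_dorfman /= (derive_gcs_map3 X' sv) (derive_gcs_map3 Y' su).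
  have -> : (local_dorfman a u v).2 = vD X s' a - vD Y r' a + qla_br r s by [].
  have [||_] := Jg_int (Jg r, r) (Jg s, s); [by split; rewrite /= ?JgJ..|].
  rewrite /= => Jint.
  have JD x y : Jg (x + y) = Jg x + Jg y by rewrite linearD.
  have JN x : Jg (- x) = - Jg x by rewrite linearN.
  move: (vD X' s' a) (vD Y r' a) (vD X s' a) (vD Y' r' a) => A1 A2 A3 A4.
  move: (qla_br _ _) (qla_br _ _) (qla_br _ _) (qla_br _ _) Jint => p1 p2 p3 p4 Jint.
  have {}Jint k := congr1 (vcoord k) Jint.
  apply: vect_ext => k; have := Jint k.
  rewrite !(JD, JN, JgJ, vcoordD, vcoordN) => E.
  lra.
have pairE (p q q' : E) : p.1.1 = q.1.1 - q'.1.1 -> p.1.2 = q.1.2 - q'.1.2 ->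
    p.2 = q.2 - q'.2 -> p = q - q'.
  by case: p q q' => [[? ?] ?] [[? ?] ?] [[? ?] ?] /= -> -> ->.
have e1 := derive_gcs_map1 (v a).1.1 su; have e2 := derive_gcs_map1 (u a).1.1 sv.
have e3 := derive_gcs_map1 (Tv a).1.1 su; have e4 := derive_gcs_map1 (Tu a).1.1 sv.
apply: pairE; [apply: etrans (etrans _ N1) _|exact: N2|exact: N3].
  exact: (congr2 (fun p q : V => mul_i ('D_((Tu a).1.1) (fun x => (v x).1.1) a - p
    + (q - 'D_((Tv a).1.1) (fun x => (u x).1.1) a))
    + B_map (b a) ((local_dorfman a Tu v).1.2 + (local_dorfman a u Tv).1.2)) e1 e2).
exact: (congr2 (fun p q : V => (p - q) - (local_dorfman a u v).1.1) (esym e4) (esym e3)).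
Qed.

End Sections.
End At.
End PoissonNijenhuis.

(** * The Dorfman bracket under changes of coordinates *)

Section Transport.
Context {R : realType} {m : nat} (g : quadratic_lie_algebra R).
Local Notation V := 'rV[R]_m.
Local Notation E := (V * V * g)%type.
Variables (a : V) (tau : V -> V) (phi : 'End(g)) (u v u' v' : V -> E).

Lemma derive_comp_row (W : normedModType R) (f : V -> W) w :
  differentiable tau a -> differentiable f (tau a) ->
  'D_w (fun x => f (tau x)) a = 'D_('D_w tau a) f (tau a).
Proof.
move=> dt df.
apply: etrans (deriveE w (differentiable_comp dt df)) _.
apply: etrans (congr1 (fun h : V -> W => h w) (diff_comp dt df)) _.
by rewrite /= (deriveE _ df) (deriveE _ dt).
Qed.

Hypothesis st : smooth_row a tau.
Let dt := smooth_row_diff st.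

Lemma vD_comp_row (W : vectType R) (r : V -> W) w : smooth_vect (tau a) r ->
  vD w (fun x => r (tau x)) a = vD ('D_w tau a) r (tau a).
Proof.
move=> sr; apply: vect_ext => k; apply: etrans (vcoord_vD _ _ _ _) _.
apply: etrans (esym (vcoord_vD _ _ _ _)).
exact: (derive_comp_row (f := fun x => vcoord k (r x)) w dt (smooth_germ_diff (sr k))).
Qed.

Hypothesis phi_br : forall x y, phi (qla_br x y) = qla_br (phi x) (phi y).
Hypothesis phi_sp : forall x y, qla_sp (phi x) (phi y) = qla_sp x y.

(** Covectors are pulled back along [tau]; stated through the pairing, this needs
    no inverse of the differential of [tau]. *)
Definition transported (x : V) (z z' : E) : Prop :=
  [/\ z'.1.1 = 'D_z.1.1 tau x,
      forall w, pairing z'.1.2 ('D_w tau x) = pairing z.1.2 w &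
      z'.2 = phi z.2].

Let H w w' := 'D_w (fun x => 'D_w' tau x) a.

Lemma second_derivative_sym w w' : H w w' = H w' w.
Proof. exact: derive_row_comm. Qed.

Section Jets.
Variables (z z' : V -> E).
Hypotheses (sz : smooth_vect a z) (sz' : smooth_vect (tau a) z').
Hypothesis hz : \forall x \near a, transported x (z x) (z' (tau x)).

Lemma transported_jet1 w :
  'D_('D_w tau a) (fun x => (z' x).1.1) (tau a) =
  'D_('D_w (fun x => (z x).1.1) a) tau a + H w (z a).1.1.
Proof.
have [sX _ _] := (smooth_vect_triple _ _).1 sz.
have [sX' _ _] := (smooth_vect_triple _ _).1 sz'.
apply: etrans (esym (derive_comp_row w dt (smooth_row_diff sX'))) _.
apply: etrans (derive_along w sX st).
by apply: near_eq_derive; apply: filterS hz => x [].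
Qed.

(** Obtained by differentiating the invariance of the pairing with the fixed
    direction [e]. *)
Lemma transported_jet2 w e :
  pairing ('D_('D_w tau a) (fun x => (z' x).1.2) (tau a)) ('D_e tau a) =
  pairing ('D_w (fun x => (z x).1.2) a) e - pairing (z' (tau a)).1.2 (H w e).
Proof.
have [_ sxi _] := (smooth_vect_triple _ _).1 sz.
have [_ sxi' _] := (smooth_vect_triple _ _).1 sz'.
have dc : differentiable (fun x => (z' (tau x)).1.2) a.
  exact: (differentiable_comp dt (smooth_row_diff sxi')).
have de : differentiable (fun x => 'D_e tau x) a.
  exact: smooth_row_diff (smooth_row_derive e st).
have P1 := derive_pairing w dc de.
have P2 := derive_pairing w (smooth_row_diff sxi) (differentiable_cst (e : V) a).
have E1 : 'D_w (fun x => pairing (z' (tau x)).1.2 ('D_e tau x)) a =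
    'D_w (fun x => pairing (z x).1.2 e) a.
  by apply: near_eq_derive; apply: filterS hz => x [_ + _]; exact.
have P3 := etrans (esym P1) (etrans E1 P2).
have E2 := derive_comp_row w dt (smooth_row_diff sxi').
apply/eqP; rewrite eq_sym subr_eq eq_sym; apply/eqP.
apply: etrans (congr1 (fun p => pairing p _ + _) (esym E2)) _.
apply: etrans P3 _.
by rewrite derive_cst {2}/pairing mul0mx mxE addr0.
Qed.

Lemma transported_jet3 w :
  vD ('D_w tau a) (fun x => (z' x).2) (tau a) = phi (vD w (fun x => (z x).2) a).
Proof.
have [_ _ sr] := (smooth_vect_triple _ _).1 sz.
have [_ _ sr'] := (smooth_vect_triple _ _).1 sz'.
rewrite -vD_comp_row //.
have lphi : linear phi by move=> c x y; rewrite linearP.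
rewrite -(vD_lin w lphi sr).
by apply: vD_eq; apply: filterS hz => x [].
Qed.

End Jets.

Hypotheses (su : smooth_vect a u) (sv : smooth_vect a v).
Hypotheses (su' : smooth_vect (tau a) u') (sv' : smooth_vect (tau a) v').
Hypothesis hu : \forall x \near a, transported x (u x) (u' (tau x)).
Hypothesis hv : \forall x \near a, transported x (v x) (v' (tau x)).

(** The second derivatives of [tau] enter the transformation of the bracket
    only through their antisymmetrisation, hence disappear. *)
Lemma local_dorfman_transport :
  transported a (local_dorfman a u v) (local_dorfman (tau a) u' v').
Proof.
have [u1 u2 u3] := nbhs_singleton hu; have [v1 v2 v3] := nbhs_singleton hv.
set X := (u a).1.1 in u1; set Y := (v a).1.1 in v1.
split.
- have e1 := transported_jet1 sv sv' hv X; have e2 := transported_jet1 su su' hu Y.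
  rewrite -u1 in e1; rewrite -v1 in e2.
  have e2' := etrans e2 (congr1 (+%R _) (second_derivative_sym Y X)).
  apply: etrans (congr2 (fun p q : V => p - q) e1 e2') _.
  have alg (p q h : V) : p + h - (q + h) = - 1 *: q + p.
    by rewrite opprD addrACA subrr addr0 scaleN1r addrC.
  apply: etrans (alg _ _ _) _.
  have L := derive_linv (-1) ('D_Y (fun x => (u x).1.1) a) ('D_X (fun x => (v x).1.1) a) dt.
  apply: etrans (esym L) _.
  by apply: (congr1 (fun w => 'D_w tau a)); rewrite scaleN1r addrC.
- move=> w.
  have h' := pairing_dorfman_form su' sv' ('D_w tau a).
  have h := pairing_dorfman_form su sv w.
  apply: etrans h' _; apply: etrans _ (esym h).
  rewrite /bracket_form u1 v1.
  have a1 := transported_jet2 sv sv' hv X w.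
  have a2 := congr1 (pairing (v' (tau a)).1.2)
    (etrans (transported_jet1 su su' hu w) (congr1 (+%R _) (second_derivative_sym w X))).
  rewrite pairingDr v2 in a2.
  have a3 := transported_jet2 su su' hu Y w.
  have a4 := etrans (transported_jet2 su su' hu w Y)
    (congr1 (fun p => _ - pairing _ p) (second_derivative_sym w Y)).
  have a5 : 2%:R * qla_sp (vD ('D_w tau a) (fun x => (u' x).2) (tau a)) (v' (tau a)).2 =
      2%:R * qla_sp (vD w (fun x => (u x).2) a) (v a).2.
    by rewrite (transported_jet3 su su' hu w) v3 phi_sp.
  apply: etrans (congr2 +%R (congr2 +%R (congr2 (fun p q => p - q)
    (congr2 +%R a1 a2) a3) a4) a5) _.
  have alg (p p' q r r' s t : R) : p - p' + (q + p') - (r - r') + (s - r') + t = p + q - r + s + t.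
    by ring.
  exact: alg.
- have e1 := transported_jet3 sv sv' hv X; have e2 := transported_jet3 su su' hu Y.
  rewrite -u1 in e1; rewrite -v1 in e2.
  apply: etrans (congr2 (fun p q : g => p - q + _) e1 e2) _.
  by rewrite u3 v3 -phi_br -linearB -linearD.
Qed.

End Transport.

(** * Paths and homotopies *)

Lemma within_comp (T U W : topologicalType) (A : set T) (B : set U)
    (f : T -> U) (h : U -> W) :
  {within A, continuous f} -> (forall x, A x -> B (f x)) ->
  {within B, continuous h} -> {within A, continuous (fun x => h (f x))}.
Proof.
move=> /subspace_continuousP cf AB /subspace_continuousP ch.
apply/subspace_continuousP => x Ax.
have fB : f @ within A (nbhs x) --> within B (nbhs (f x)).
  move=> W' /= HW; have := cf x Ax _ HW; rewrite /nbhs /= /within /=.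
  by apply: filterS => y /= Hy Ay; apply: Hy => //; exact: AB.
exact: cvg_comp fB (ch _ (AB _ Ax)).
Qed.

Lemma within_total (T U : topologicalType) (A : set T) (f : T -> U) :
  continuous f -> {within A, continuous f}.
Proof. exact: continuous_subspaceT. Qed.

Section TotalContinuity.
Context {R : realType} (T U W : topologicalType).
Implicit Types (f h : T -> R).

Lemma cont_fst : continuous (fst : U * W -> U).
Proof. by move=> p; exact: cvg_fst. Qed.

Lemma cont_snd : continuous (snd : U * W -> W).
Proof. by move=> p; exact: cvg_snd. Qed.

Lemma cont_pair (f : T -> U) (h : T -> W) : continuous f -> continuous h ->
  continuous (fun x => (f x, h x)).
Proof. by move=> cf ch x; exact: (cvg_pair (cf x) (ch x)). Qed.

Lemma cont_add f h : continuous f -> continuous h -> continuous (fun x => f x + h x).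
Proof. by move=> cf ch x; exact: (cvgD (cf x) (ch x)). Qed.

Lemma cont_sub f h : continuous f -> continuous h -> continuous (fun x => f x - h x).
Proof. by move=> cf ch x; exact: (cvgB (cf x) (ch x)). Qed.

Lemma cont_mul f h : continuous f -> continuous h -> continuous (fun x => f x * h x).
Proof. by move=> cf ch x; exact: (cvgM (cf x) (ch x)). Qed.

Lemma cont_cst (c : U) : continuous (fun _ : T => c).
Proof. by move=> x; exact: cvg_cst. Qed.

Lemma cont_id : continuous (fun x : T => x).
Proof. by move=> x; exact: cvg_id. Qed.

Lemma cont_comp (f : T -> U) (h : U -> W) : continuous f -> continuous h ->
  continuous (fun x => h (f x)).
Proof. by move=> cf ch x; exact: (cvg_comp _ _ (cf x) (ch (f x))). Qed.

End TotalContinuity.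

Lemma cont_max (R : realType) (T : topologicalType) (f h : T -> R) :
  continuous f -> continuous h -> continuous (fun x => Num.max (f x) (h x)).
Proof.
move=> cf ch.
exact: (cont_comp (cont_pair cf ch) (@max_continuous _ R)).
Qed.

Ltac continuity := repeat first
  [ exact: cont_fst | exact: cont_snd | exact: cont_cst | exact: cont_id
  | apply: cont_pair | apply: cont_sub | apply: cont_add | apply: cont_mul
  | apply: cont_max ].

Section Paths.
Context {R : realType} {M : topologicalType}.
Implicit Types c d : R -> M.
Local Notation unit := (`[0, 1]%classic : set R).

(** The pasting lemma, in the form needed for concatenations, which are defined by
    a test at time 1/2. *)
Lemma paste (T : topologicalType) (A : set T) (theta : T -> R) (f1 f2 : T -> M) :
  closed A -> continuous theta ->
  {within A `&` [set x | theta x <= 2%:R^-1], continuous f1} ->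
  {within A `&` [set x | 2%:R^-1 <= theta x], continuous f2} ->
  (forall x, A x -> theta x = 2%:R^-1 -> f1 x = f2 x) ->
  {within A, continuous (fun x => if theta x <= 2%:R^-1 then f1 x else f2 x)}.
Proof.
move=> cA ct c1 c2 f12.
have -> : A = (A `&` [set x | theta x <= 2%:R^-1]) `|` (A `&` [set x | 2%:R^-1 <= theta x]).
  rewrite -setIUr; apply/seteqP; split=> [x Ax|x []] //; split=> //=.
  by case: (leP (theta x) 2%:R^-1) => h; [left|right => /=; exact: ltW].
apply: withinU_continuous.
- apply: closedI => //; apply: (closed_comp (f := theta) (D := [set y | y <= 2%:R^-1])).
    by move=> x _; exact: ct.
  exact: closed_le.
- apply: closedI => //; apply: (closed_comp (f := theta) (D := [set y | 2%:R^-1 <= y])).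
    by move=> x _; exact: ct.
  exact: closed_ge.
- apply: subspace_eq_continuous c1 => x; rewrite inE => -[Ax /= h].
  by rewrite /from_subspace h.
- apply: subspace_eq_continuous c2 => x; rewrite inE => -[Ax /= h].
  rewrite /from_subspace; case: ifP => // h'.
  by symmetry; apply: f12 => //; apply/eqP; rewrite eq_le h h'.
Qed.

Lemma unitP (t : R) : unit t <-> 0 <= t <= 1.
Proof. by rewrite /= in_itv. Qed.

Lemma path_cat0 c d : path_cat c d 0 = c 0.
Proof. by rewrite /path_cat invr_ge0 ler0n mulr0. Qed.

Lemma path_cat1 c d : path_cat c d 1 = d 1.
Proof.
rewrite /path_cat; have -> : ((1 : R) <= 2%:R^-1) = false.
  by apply/negP/negP; rewrite -ltNge invf_lt1 // ltr1n.
by congr d; lra.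
Qed.

Lemma closed_unit : closed unit.
Proof. exact: interval_closed. Qed.

Lemma is_path_cat c d p q r : is_path c p q -> is_path d q r ->
  is_path (path_cat c d) p r.
Proof.
move=> [cc c0 c1] [cd d0 d1]; split; last 2 first.
- by rewrite path_cat0.
- by rewrite path_cat1.
apply: (paste (theta := fun t : R => t)).
- exact: closed_unit.
- exact: cont_id.
- apply: (within_comp (B := unit) (h := c)) => //.
    by apply: within_total; continuity.
  by move=> t [/unitP /andP[t0 t1] /= th]; apply/unitP; lra.
- apply: (within_comp (B := unit) (h := d)) => //.
    by apply: within_total; continuity.
  by move=> t [/unitP /andP[t0 t1] /= th]; apply/unitP; lra.
- move=> t _ ->; have -> : 2%:R * 2%:R^-1 = 1 :> R by rewrite divff.
  by rewrite subrr c1 d0.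
Qed.

Local Notation square := (`[0, 1]%classic `*` `[0, 1]%classic : set (R * R)).

Lemma closed_square : closed square.
Proof.
have -> : square = (fst @^-1` unit) `&` (snd @^-1` unit) by [].
by apply: closedI; apply: closed_comp => [p _|]; [exact: cont_fst|exact: closed_unit|
  exact: cont_snd|exact: closed_unit].
Qed.

Lemma homotopic_cat c c' d d' : c 1 = d 0 -> homotopic c c' -> homotopic d d' ->
  homotopic (path_cat c d) (path_cat c' d').
Proof.
move=> cd [H [cH hH]] [K [cK hK]].
exists (fun p => if p.2 <= 2%:R^-1 then H (p.1, 2%:R * p.2) else K (p.1, 2%:R * p.2 - 1)).
split.
  apply: (paste (theta := snd) (f1 := fun p => H (p.1, 2%:R * p.2))
    (f2 := fun p => K (p.1, 2%:R * p.2 - 1))).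
  - exact: closed_square.
  - exact: cont_snd.
  - apply: (within_comp (B := square) (h := H) (f := fun p : R * R => (p.1, 2%:R * p.2))) => //.
      by apply: within_total; continuity.
    move=> p [[/unitP h1 /unitP /andP[t0 t1]] /= th]; split; apply/unitP => //=; lra.
  - apply: (within_comp (B := square) (h := K) (f := fun p : R * R => (p.1, 2%:R * p.2 - 1))) => //.
      by apply: within_total; continuity.
    move=> p [[/unitP h1 /unitP /andP[t0 t1]] /= th]; split; apply/unitP => //=; lra.
  - move=> p [/unitP h1 _] ->; have -> : 2%:R * 2%:R^-1 = 1 :> R by rewrite divff.
    rewrite subrr; have [_ _ _ ->] := hH _ h1.
    by have [_ _ -> _] := hK _ h1.
move=> t ht; split.
- rewrite /path_cat /=; case: ifPn => h; have := ht => /andP[t0 t1].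
    by have [|-> //] := hH (2%:R * t); lra.
  by move: h; rewrite -ltNge => h; have [|-> //] := hK (2%:R * t - 1); lra.
- rewrite /path_cat /=; case: ifPn => h; have := ht => /andP[t0 t1].
    by have [|_ -> //] := hH (2%:R * t); lra.
  by move: h; rewrite -ltNge => h; have [|_ -> //] := hK (2%:R * t - 1); lra.
- rewrite path_cat0 /= invr_ge0 ler0n mulr0.
  by have [_ _ -> _] := hH _ ht.
- rewrite path_cat1 /=; have -> : ((1 : R) <= 2%:R^-1) = false.
    by apply/negP/negP; rewrite -ltNge invf_lt1 // ltr1n.
  have -> : 2%:R * 1 - 1 = 1 :> R by lra.
  by have [_ _ _ ->] := hK _ ht.
Qed.

(** The interval is convex, so a reparametrisation can be deformed linearly to the
    identity. *)
Lemma homotopic_reparam c d p q (psi : R -> R) : is_path c p q ->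
  continuous psi -> (forall t, 0 <= t <= 1 -> 0 <= psi t <= 1) ->
  psi 0 = 0 -> psi 1 = 1 -> (forall t, 0 <= t <= 1 -> d t = c (psi t)) ->
  homotopic c d.
Proof.
move=> [cc _ _] cpsi psi01 psi0 psi1 dE.
exists (fun p => c ((1 - p.1) * p.2 + p.1 * psi p.2)); split.
  apply: (within_comp (B := unit) (h := c)
    (f := fun p : R * R => (1 - p.1) * p.2 + p.1 * psi p.2)) => //.
    have c2 : continuous (fun p : R * R => psi p.2).
      exact: (cont_comp (f := snd) (h := psi) (@cont_snd R R) cpsi).
    apply: within_total; apply: cont_add; first by continuity.
    by apply: cont_mul => //; exact: cont_fst.
  move=> [s t] [/unitP /= /andP[s0 s1] /unitP /= ht]; apply/unitP.
  have := psi01 _ ht => /andP[p0 p1]; have := ht => /andP[t0 t1].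
  by apply/andP; split; nra.
move=> t ht /=; split.
- by congr c; ring.
- by rewrite dE //; congr c; ring.
- by rewrite psi0; congr c; ring.
- by rewrite psi1; congr c; ring.
Qed.

Lemma homotopic_refl c p q : is_path c p q -> homotopic c c.
Proof.
move=> cp; apply: (homotopic_reparam (psi := id) cp) => //.
exact: cont_id.
Qed.

Lemma homotopic_cat_assoc c d e p q r s : is_path c p q -> is_path d q r ->
  is_path e r s ->
  homotopic (path_cat (path_cat c d) e) (path_cat c (path_cat d e)).
Proof.
move=> pc pd pe.
(* the reparametrisation has slopes 1/2, 1 and 2 on [0, 1/2], [1/2, 3/4] and [3/4, 1];
   it is convex, hence the maximum of its three affine pieces *)
pose psi (t : R) := Num.max (Num.max (t / 2%:R) (t - 4%:R^-1)) (2%:R * t - 1).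
have cpsi : continuous psi.
  by rewrite /psi; continuity.
have psi_l t : t <= 2%:R^-1 -> psi t = t / 2%:R.
  move=> h; rewrite /psi max_l; first by apply: max_l; lra.
  by rewrite le_max; apply/orP; left; lra.
have psi_m t : 2%:R^-1 <= t <= 3%:R / 4%:R -> psi t = t - 4%:R^-1.
  move=> /andP[h h']; rewrite /psi max_l; first by apply: max_r; lra.
  by rewrite le_max; apply/orP; right; lra.
have psi_r t : 3%:R / 4%:R <= t -> psi t = 2%:R * t - 1.
  by move=> h; rewrite /psi max_r // ge_max; apply/andP; split; lra.
apply: (homotopic_reparam (psi := psi) (is_path_cat (is_path_cat pc pd) pe)) => //.
- move=> t /andP[t0 t1]; rewrite /psi; apply/andP; split.
    by rewrite !le_max; apply/orP; left; apply/orP; left; lra.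
  by rewrite !ge_max; apply/andP; split; [apply/andP; split|]; lra.
- by rewrite psi_l; lra.
- by rewrite psi_r; lra.
move=> t /andP[t0 t1].
have [h1|h1] := leP t 2%:R^-1.
  rewrite (psi_l _ h1) /path_cat h1.
  have -> : t / 2%:R <= 2%:R^-1 by lra.
  have -> : 2%:R * (t / 2%:R) <= 2%:R^-1 by lra.
  by congr c; lra.
have [h2|h2] := leP t (3%:R / 4%:R).
  rewrite psi_m ?h2 ?(ltW h1) // /path_cat (leNgt t) h1 /=.
  have -> : t - 4%:R^-1 <= 2%:R^-1 by lra.
  have -> : (2%:R * (t - 4%:R^-1) <= 2%:R^-1) = false by apply/negP/negP; lra.
  have -> : 2%:R * t - 1 <= 2%:R^-1 by lra.
  by congr d; lra.
rewrite psi_r ?(ltW h2) // /path_cat (leNgt t) h1 /=.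
have -> : (2%:R * t - 1 <= 2%:R^-1) = false by apply/negP/negP; lra.
by congr e; lra.
Qed.

End Paths.

(** * Paths in charts *)

Lemma within_pair (T U W : topologicalType) (A : set T) (f : T -> U) (h : T -> W) :
  {within A, continuous f} -> {within A, continuous h} ->
  {within A, continuous (fun x => (f x, h x))}.
Proof.
move=> /subspace_continuousP cf /subspace_continuousP ch.
apply/subspace_continuousP => x Ax.
exact: (cvg_pair (cf x Ax) (ch x Ax)).
Qed.

Section Charts.
Context {R : realType} {M : topologicalType} {m : nat}.
Local Notation V := 'rV[R]_m.
Local Notation unit := (`[0, 1]%classic : set R).
Local Notation square := (`[0, 1]%classic `*` `[0, 1]%classic : set (R * R)).

Lemma continuous_segment : continuous (fun p : R * (V * V) => (1 - p.1) *: p.2.1 + p.1 *: p.2.2).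
Proof.
move=> p.
have c1 : (fun p : R * (V * V) => p.2.1) x @[x --> p] --> p.2.1.
  exact: (cont_comp (@cont_snd R (V * V)%type) (@cont_fst V V)).
have c2 : (fun p : R * (V * V) => p.2.2) x @[x --> p] --> p.2.2.
  exact: (cont_comp (@cont_snd R (V * V)%type) (@cont_snd V V)).
have c0 : continuous (fun p : R * (V * V) => 1 - p.1) by continuity.
exact: (cvgD (cvgZ (c0 p) c1) (cvgZ (@cont_fst R (V * V)%type p) c2)).
Qed.

Lemma ball_segment (y0 y z : V) (e s : R) : 0 <= s <= 1 -> ball y0 e y -> ball y0 e z ->
  ball y0 e ((1 - s) *: y + s *: z).
Proof.
move=> /andP[s0 s1]; rewrite -!ball_normE /= => hy hz.
have -> : y0 - ((1 - s) *: y + s *: z) = (1 - s) *: (y0 - y) + s *: (y0 - z).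
  rewrite !scalerBr addrACA -scalerDl subrK scale1r opprD.
  by [].
apply: le_lt_trans (ler_normD _ _) _; rewrite !normrZ !ger0_norm ?subr_ge0 //.
move: hy hz; move: `|y0 - y| `|y0 - z| => p q hp hq.
have [->|s_neq0] := eqVneq s 0; first by rewrite subr0 mul1r mul0r addr0.
have s_gt0 : 0 < s by rewrite lt0r s_neq0.
have : s * q < s * e by rewrite ltr_pM2l.
have : (1 - s) * p <= (1 - s) * e by rewrite ler_wpM2l ?subr_ge0 // ltW.
by lra.
Qed.

Variable phi : chart R M m.
Hypothesis hphi : is_chart phi.

Lemma chart_fwdK p : chart_dom phi p -> chart_bwd phi (chart_fwd phi p) = p.
Proof. by case: hphi => _ _ + _ _; exact. Qed.

Lemma chart_bwd_dom x : chart_img phi x -> chart_dom phi (chart_bwd phi x).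
Proof. by move=> [p dp <-]; rewrite chart_fwdK. Qed.

Lemma chart_bwdK x : chart_img phi x -> chart_fwd phi (chart_bwd phi x) = x.
Proof. by move=> [p dp <-]; rewrite chart_fwdK. Qed.

Lemma chart_img_fwd p : chart_dom phi p -> chart_img phi (chart_fwd phi p).
Proof. by exists p. Qed.

Lemma chart_ball p : chart_dom phi p -> exists2 e : R, 0 < e &
  ball (chart_fwd phi p) e `<=` chart_img phi.
Proof.
move=> dp; have [_ oi _ _ _] := hphi.
have /nbhs_ballP [e /= e0 He] := open_nbhs_nbhs (conj oi (chart_img_fwd dp)).
by exists e.
Qed.

Lemma chart_dom_near p : chart_dom phi p -> \forall q \near p, chart_dom phi q.
Proof. by move=> dp; have [od _ _ _ _] := hphi; exact: open_nbhs_nbhs. Qed.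

Lemma chart_fwd_cvg p : chart_dom phi p ->
  chart_fwd phi q @[q --> p] --> chart_fwd phi p.
Proof.
move=> dp; have [od _ _ cf _] := hphi.
by rewrite continuous_open_subspace // in cf; apply: cf; rewrite inE.
Qed.

Lemma chart_bwd_cvg x : chart_img phi x ->
  chart_bwd phi y @[y --> x] --> chart_bwd phi x.
Proof.
move=> dx; have [_ oi _ _ cb] := hphi.
by rewrite continuous_open_subspace // in cb; apply: cb; rewrite inE.
Qed.

Definition chart_segment (q : M) (x : V) : R -> M :=
  fun t => chart_bwd phi ((1 - t) *: chart_fwd phi q + t *: x).

Section Ball.
Variables (y0 : V) (e : R).
Hypothesis sub : ball y0 e `<=` chart_img phi.

Definition chart_cell : set M := [set p | chart_dom phi p /\ ball y0 e (chart_fwd phi p)].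

Lemma chart_cell_bwd x : ball y0 e x -> chart_cell (chart_bwd phi x).
Proof.
by move=> bx; split; [exact: chart_bwd_dom (sub bx)|rewrite chart_bwdK //; exact: sub].
Qed.

Lemma chart_segment_path q x : chart_cell q -> ball y0 e x ->
  is_path (chart_segment q x) q (chart_bwd phi x).
Proof.
move=> [dq bq] bx; rewrite /chart_segment; split.
- have [_ _ _ _ cb] := hphi.
  apply: (within_comp (B := chart_img phi) (h := chart_bwd phi)
    (f := fun t : R => (1 - t) *: chart_fwd phi q + t *: x : V)) => //.
    apply: within_total => t.
    have c : continuous (fun t : R => (t, (chart_fwd phi q, x))) by continuity.
    exact: (cont_comp c continuous_segment).
  by move=> t /unitP ht; apply: sub; exact: ball_segment.
- by rewrite subr0 scale1r scale0r addr0 chart_fwdK.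
- by rewrite subrr scale0r scale1r add0r.
Qed.

Lemma chart_segment_cell q x (t : R) : chart_cell q -> ball y0 e x -> 0 <= t <= 1 ->
  chart_cell (chart_segment q x t).
Proof. by move=> [dq bq] bx ht; apply: chart_cell_bwd; exact: ball_segment. Qed.

Lemma path_cat_cell (c d : R -> M) (t : R) : (forall t, 0 <= t <= 1 -> chart_cell (c t)) ->
  (forall t, 0 <= t <= 1 -> chart_cell (d t)) -> 0 <= t <= 1 -> chart_cell (path_cat c d t).
Proof.
move=> hc hd /andP[t0 t1]; rewrite /path_cat; case: ifPn => h.
  by apply: hc; lra.
by rewrite -ltNge in h; apply: hd; lra.
Qed.

(** Straight-line homotopy in coordinates: balls are convex. *)
Lemma cell_homotopic (c d : R -> M) p q : is_path c p q -> is_path d p q ->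
  (forall t, 0 <= t <= 1 -> chart_cell (c t)) ->
  (forall t, 0 <= t <= 1 -> chart_cell (d t)) -> homotopic c d.
Proof.
move=> [cc c0 c1] [cd d0 d1] hc hd.
have [_ _ _ cf cb] := hphi.
exists (fun p => chart_bwd phi ((1 - p.1) *: chart_fwd phi (c p.2)
                                 + p.1 *: chart_fwd phi (d p.2))).
split.
  apply: (within_comp (B := chart_img phi) (h := chart_bwd phi)) => //; last first.
    move=> [s t] [/unitP /= hs /unitP /= ht]; apply: sub; apply: ball_segment => //.
      by have [] := hc t ht.
    by have [] := hd t ht.
  have c2 (f : R -> M) : {within unit, continuous f} ->
      (forall t, 0 <= t <= 1 -> chart_cell (f t)) ->
      {within square, continuous (fun p : R * R => chart_fwd phi (f p.2))}.
    move=> cont_f hf.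
    apply: (within_comp (B := chart_dom phi) (h := chart_fwd phi)) => //.
      apply: (within_comp (B := unit) (h := f) (f := snd)) => //; last by move=> p' [].
      by apply: within_total; exact: cont_snd.
    by move=> [s t] [_ /unitP /= ht]; have [] := hf t ht.
  have W := within_pair (within_total (A := square) (@cont_fst R R))
    (within_pair (c2 _ cc hc) (c2 _ cd hd)).
  exact: (within_comp W (B := setT) (fun _ _ => I) (within_total continuous_segment)).
move=> t ht; have [dct _] := hc t ht; have [ddt _] := hd t ht.
have u0 : 0 <= (0 : R) <= 1 by rewrite lexx ler01.
have u1 : 0 <= (1 : R) <= 1 by rewrite lexx ler01.
split => /=.
- by rewrite subr0 scale1r scale0r addr0 chart_fwdK.
- by rewrite subrr scale0r scale1r add0r chart_fwdK.
- by rewrite d0 c0 -scalerDl subrK scale1r chart_fwdK // -c0; have [] := hc 0 u0.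
- by rewrite d1 c1 -scalerDl subrK scale1r chart_fwdK // -c1; have [] := hc 1 u1.
Qed.

End Ball.
End Charts.

(** * Frames along paths in the manifold *)

Section ManifoldPaths.
Context {R : realType} {n : nat} (M : complex_manifold R n) (m0 : M).
Local Notation V := 'rV[R]_(n + n).
Local Notation I := (atlas_index M).
Local Notation at_ i := (@atlas R n M i).
Implicit Types (i j : I) (c d gamma : R -> M) (x y : V).

Let hat i : is_chart (at_ i) := atlas_chart i.

Lemma homotopic_end c d : homotopic c d -> c 1 = d 1.
Proof.
move=> [H [_ hH]]; have [|_ h1 _ h2] := hH 1; first by rewrite ler01 lexx.
by rewrite -h1 -h2.
Qed.

(** The set of endpoints of paths from [m0] is open and its complement is open, as
    any two points of a ball in a chart are joined by a segment. *)
Lemma path_connected : forall p, exists c : R -> M, is_path c m0 p.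
Proof.
pose P := [set p : M | exists c : R -> M, is_path c m0 p].
have cell_path i (e : R) p q q' : ball (chart_fwd (at_ i) p) e `<=` chart_img (at_ i) ->
    chart_cell (at_ i) (chart_fwd (at_ i) p) e q ->
    chart_cell (at_ i) (chart_fwd (at_ i) p) e q' -> P q -> P q'.
  move=> sub cq [dq' bq'] [c hc].
  exists (path_cat c (chart_segment (at_ i) q (chart_fwd (at_ i) q'))).
  have := chart_segment_path (hat i) sub cq bq'.
  by rewrite chart_fwdK //; exact: is_path_cat hc.
have near_cell i p (e : R) : chart_dom (at_ i) p -> 0 < e ->
    \forall q \near p, chart_cell (at_ i) (chart_fwd (at_ i) p) e q.
  move=> dp e0; apply: filterI; first exact: chart_dom_near.
  exact: chart_fwd_cvg (nbhsx_ballx _ _ e0).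
have self_cell i p (e : R) : chart_dom (at_ i) p -> 0 < e ->
    chart_cell (at_ i) (chart_fwd (at_ i) p) e p.
  by move=> dp e0; split=> //; exact: ballxx.
suff E : P = setT by move=> p; have : P p by rewrite E.
apply: (carrier_connected (c := M)).
- exists m0; exists (fun _ => m0); split=> //.
  by apply: within_total; exact: cont_cst.
- exists P; last by rewrite setTI.
  rewrite openE => p Pp; rewrite /interior.
  have [i dp] := atlas_cover p; have [e e0 sub] := chart_ball (hat i) dp.
  apply: filterS (near_cell i p e dp e0) => q cq.
  exact: cell_path sub (self_cell _ _ _ dp e0) cq Pp.
- exists P; last by rewrite setTI.
  rewrite closedE => p clp; apply: contrapT => nPp; apply: clp.
  have [i dp] := atlas_cover p; have [e e0 sub] := chart_ball (hat i) dp.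
  apply: filterS (near_cell i p e dp e0) => q cq Pq; apply: nPp.
  exact: cell_path sub cq (self_cell _ _ _ dp e0) Pq.
Qed.

Section Frames.
Variables (i : I) (c : R -> M).
Hypothesis fc : is_frame m0 i c.

Lemma frame_ball : exists2 e : R, 0 < e & ball (coords i c) e `<=` chart_img (at_ i).
Proof. by case: fc => _; exact: chart_ball. Qed.

Section InBall.
Variables (e : R).
Hypotheses (e0 : 0 < e) (sub : ball (coords i c) e `<=` chart_img (at_ i)).

Let cell_c : chart_cell (at_ i) (coords i c) e (c 1).
Proof. by case: fc => _ dc; split=> //; exact: ballxx. Qed.

Lemma segment_path x : ball (coords i c) e x ->
  is_path (segment i c x) (c 1) (chart_bwd (at_ i) x).
Proof. exact: (chart_segment_path (hat i) sub cell_c). Qed.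

Lemma local_frame_path x : ball (coords i c) e x ->
  is_path (path_cat c (segment i c x)) m0 (chart_bwd (at_ i) x).
Proof. by case: fc => pc _ bx; exact: is_path_cat pc (segment_path bx). Qed.

Lemma local_frame_end x : ball (coords i c) e x ->
  path_cat c (segment i c x) 1 = chart_bwd (at_ i) x.
Proof. by move=> bx; have [] := local_frame_path bx. Qed.

Lemma local_frame x : ball (coords i c) e x -> is_frame m0 i (path_cat c (segment i c x)).
Proof.
move=> bx; split; first by rewrite local_frame_end //; exact: local_frame_path.
by rewrite local_frame_end //; exact: chart_bwd_dom (sub bx).
Qed.

Lemma local_frame_coords x : ball (coords i c) e x ->
  coords i (path_cat c (segment i c x)) = x.
Proof. by move=> bx; rewrite /coords local_frame_end // chart_bwdK //; exact: sub. Qed.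

(** The two paths to the point of coordinates [y] only differ inside a ball, hence
    are homotopic. Therefore a bracket of sections, defined frame by frame, can be
    computed near [c 1] from the local expressions at [c] alone. *)
Lemma local_local (W : Type) (F : field M W) x y : homotopy_invariant m0 F ->
  ball (coords i c) e x -> ball (coords i c) e y ->
  local F i (path_cat c (segment i c x)) y = local F i c y.
Proof.
move=> hF bx by_; have [pc _] := fc.
have px := segment_path bx; have py := segment_path by_.
have cx := chart_cell_bwd (hat i) sub bx.
rewrite /local.
have -> : segment i (path_cat c (segment i c x)) y = chart_segment (at_ i) (chart_bwd (at_ i) x) y.
  by apply/funext => t; rewrite /segment local_frame_end.
have pxy := chart_segment_path (hat i) sub cx by_.
have H1 := homotopic_cat_assoc pc px pxy.
have P1 := is_path_cat (is_path_cat pc px) pxy.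
have P2 := is_path_cat pc (is_path_cat px pxy).
have fr d q : is_path d m0 q -> chart_dom (at_ i) q -> is_frame m0 i d.
  by move=> pd dq; have [_ _ d1] := pd; split; rewrite d1.
have dy := chart_bwd_dom (hat i) (sub by_).
apply: etrans (hF _ _ _ (fr _ _ P1 dy) _ H1) _; first by have [_ _ ->] := P2.
apply: hF (fr _ _ P2 dy) _ _.
  by have [_ _ ->] := local_frame_path by_; exact: local_frame_path.
apply: homotopic_cat (homotopic_refl pc) _; first by rewrite path_cat0; have [_ ->] := px.
apply: (cell_homotopic (hat i) sub (is_path_cat px pxy) py).
  move=> t ht; apply: path_cat_cell => // s hs; first exact: chart_segment_cell.
  exact: chart_segment_cell.
by move=> t ht; exact: chart_segment_cell.
Qed.

End InBall.

Lemma local_homotopic (W : Type) (F : field M W) d : homotopy_invariant m0 F ->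
  is_path d m0 (d 1) -> homotopic c d ->
  \forall x \near coords i c, local F i c x = local F i d x.
Proof.
move=> hF pd hcd; have [e e0 sub] := frame_ball; have [pc dc] := fc.
apply: filterS (nbhsx_ballx _ _ e0) => x bx; rewrite /local.
have <- : segment i c x = segment i d x.
  by apply/funext => t; rewrite /segment (homotopic_end hcd).
have px := segment_path e0 sub bx.
apply: hF; first exact: local_frame bx.
  have := is_path_cat pd (q := d 1) (r := chart_bwd (at_ i) x) (d := segment i c x).
  rewrite -(homotopic_end hcd) => /(_ px) [? ? E]; split=> //.
by apply: homotopic_cat (homotopic_refl px) => //; have [_ -> _] := px.
Qed.

(** The point of coordinates [transition x] is reached from [c 1] along a segment
    of the chart [j] or of the chart [i]: both stay in a common simply connected
    neighbourhood, hence define the same frame up to homotopy. *)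
Lemma local_transport (W : Type) (F : field M W) j gamma :
  homotopy_invariant m0 F -> is_loop m0 gamma -> chart_dom (at_ j) (c 1) ->
  \forall x \near coords i c,
    [/\ is_frame m0 i (path_cat c (segment i c x)),
        path_cat c (segment i c x) 1 = chart_bwd (at_ i) x,
        chart_dom (at_ j) (chart_bwd (at_ i) x) &
        local F j (path_cat gamma c) (transition (at_ i) (at_ j) x) =
        F j (path_cat gamma (path_cat c (segment i c x)))].
Proof.
move=> hF lg djc; have [e e0 sub] := frame_ball; have [pc dc] := fc.
have ic : chart_img (at_ i) (coords i c) by exact: chart_img_fwd.
have jc : chart_img (at_ j) (coords j c) by exact: chart_img_fwd.
have bi : chart_bwd (at_ i) (coords i c) = c 1 by rewrite chart_fwdK.
have bj : chart_bwd (at_ j) (coords j c) = c 1 by rewrite chart_fwdK.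
have [e' e'0 sub'] : exists2 e' : R, 0 < e' & ball (coords j c) e' `<=`
    (chart_img (at_ j) `&` [set y | chart_cell (at_ i) (coords i c) e (chart_bwd (at_ j) y)]).
  suff /nbhs_ballP [e' /= e'0 He'] : nbhs (coords j c) (chart_img (at_ j) `&`
      [set y | chart_cell (at_ i) (coords i c) e (chart_bwd (at_ j) y)]) by exists e'.
  apply: filterI.
    by have [_ oi _ _ _] := hat j; exact: open_nbhs_nbhs.
  have Hc : nbhs (chart_bwd (at_ j) (coords j c)) (chart_cell (at_ i) (coords i c) e).
    rewrite bj; apply: filterI; first exact: chart_dom_near.
    exact: chart_fwd_cvg (nbhsx_ballx _ _ e0).
  exact: (chart_bwd_cvg (hat j) jc Hc).
have subj : ball (coords j c) e' `<=` chart_img (at_ j) by move=> y /sub' [].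
have subc y : ball (coords j c) e' y -> chart_cell (at_ i) (coords i c) e (chart_bwd (at_ j) y).
  by move=> /sub' [].
have N : \forall x \near coords i c, chart_dom (at_ j) (chart_bwd (at_ i) x) /\
    ball (coords j c) e' (chart_fwd (at_ j) (chart_bwd (at_ i) x)).
  have Hc : nbhs (chart_bwd (at_ i) (coords i c)) (chart_cell (at_ j) (coords j c) e').
    rewrite bi; apply: filterI; first exact: chart_dom_near.
    exact: chart_fwd_cvg (nbhsx_ballx _ _ e'0).
  exact: (chart_bwd_cvg (hat i) ic Hc).
apply: filterS2 N (nbhsx_ballx _ _ e0) => x [djx bjx] bx.
split=> //; [exact: local_frame bx|exact: local_frame_end bx|].
have px := segment_path e0 sub bx.
have cjc : chart_cell (at_ j) (coords j c) e' (c 1) by split=> //; exact: ballxx.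
have gc1 : path_cat gamma c 1 = c 1 by rewrite path_cat1.
rewrite /local.
have -> : segment j (path_cat gamma c) (transition (at_ i) (at_ j) x) =
    chart_segment (at_ j) (c 1) (chart_fwd (at_ j) (chart_bwd (at_ i) x)).
  by apply/funext => t; rewrite /segment gc1.
have := chart_segment_path (hat j) subj cjc bjx.
rewrite chart_fwdK //; set s := chart_segment _ _ _ => ps.
have P1 := is_path_cat (is_path_cat lg pc) ps.
have P2 := is_path_cat lg (is_path_cat pc ps).
have P3 := is_path_cat lg (is_path_cat pc px).
have fr d : is_path d m0 (chart_bwd (at_ i) x) -> is_frame m0 j d.
  by move=> pd; have [_ _ d1] := pd; split; rewrite d1.
apply: etrans (hF _ _ _ (fr _ P1) _ (homotopic_cat_assoc lg pc ps)) _.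
  by have [_ _ ->] := P2.
apply: hF (fr _ P2) _ _; first by have [_ _ ->] := P3.
have [_ s0 _] := ps; have [_ x0 _] := px; have [_ c0 _] := pc; have [_ _ g1] := lg.
apply: homotopic_cat (homotopic_refl lg) _; first by rewrite path_cat0 g1 c0.
apply: homotopic_cat (homotopic_refl pc) _; first by rewrite s0.
apply: (cell_homotopic (hat i) sub ps px) => t ht.
  by apply: subc; apply: ball_segment => //; exact: ballxx.
by apply: chart_segment_cell => //; split=> //; exact: ballxx.
Qed.

End Frames.
End ManifoldPaths.

(** * Transition maps *)

Section Transitions.
Context {R : realType} {n : nat} (M : complex_manifold R n).
Local Notation V := 'rV[R]_(n + n).
Local Notation I := (atlas_index M).
Local Notation at_ i := (@atlas R n M i).
Implicit Types (i j : I) (p : M) (x y v w : V).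

Let hat i : is_chart (at_ i) := atlas_chart i.

Lemma open_overlap i j :
  open (chart_fwd (at_ i) @` (chart_dom (at_ i) `&` chart_dom (at_ j))).
Proof.
rewrite openE => _ [p [dip djp] <-]; rewrite /interior.
have ip : chart_img (at_ i) (chart_fwd (at_ i) p) by exact: chart_img_fwd.
have N1 : \forall x \near chart_fwd (at_ i) p, chart_img (at_ i) x.
  by have [_ oi _ _ _] := hat i; exact: open_nbhs_nbhs.
have N2 : nbhs (chart_fwd (at_ i) p) [set x | chart_dom (at_ j) (chart_bwd (at_ i) x)].
  have Hc : nbhs (chart_bwd (at_ i) (chart_fwd (at_ i) p)) (chart_dom (at_ j)).
    by rewrite chart_fwdK //; exact: chart_dom_near.
  exact: (chart_bwd_cvg (hat i) ip Hc).
apply: filterS2 N1 N2 => x ix jx; exists (chart_bwd (at_ i) x); last exact: chart_bwdK.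
by split=> //; exact: chart_bwd_dom.
Qed.

Section AtPoint.
Variables (i j : I) (p : M).
Hypotheses (dip : chart_dom (at_ i) p) (djp : chart_dom (at_ j) p).
Let tau := transition (at_ i) (at_ j).
Let a := chart_fwd (at_ i) p.

Lemma transition_hol k : hol_at a (fun x => zcoord k (tau x)).
Proof.
have [+ _] := holomorphic_onP (fun x => zcoord k (tau x)) (@open_overlap i j).
by apply; [exact: atlas_holomorphic|exists p].
Qed.

Lemma smooth_transition : smooth_row a tau.
Proof. by apply: smooth_row_zcoord => k; case: (transition_hol k). Qed.

Lemma transition_at : tau a = chart_fwd (at_ j) p.
Proof. by rewrite /tau /transition /= /a chart_fwdK. Qed.

Lemma mul_jacobian v : v *m real_jacobian i j p = 'D_v tau a.
Proof.
by rewrite /real_jacobian deriveEjacobian //; exact: smooth_row_diff smooth_transition.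
Qed.

(** Transition maps are holomorphic: in complex coordinates their differential is
    multiplication by the complex Jacobian matrix. *)
Lemma zcoord_mul_jacobian v b :
  zcoord b (v *m real_jacobian i j p) = \sum_k zcoord k v * hol_jacobian i j p k b.
Proof.
have [sf hf] := transition_hol b.
rewrite mul_jacobian; apply: etrans (zcoord_derive v b smooth_transition) _.
rewrite (cderive_hol _ sf hf); apply: eq_bigr => k _; by rewrite mxE.
Qed.

Lemma mul_i_jacobian v :
  mul_i v *m real_jacobian i j p = mul_i (v *m real_jacobian i j p).
Proof.
apply: zcoordP => b; rewrite zcoord_mul_i !zcoord_mul_jacobian mulr_sumr.
by apply: eq_bigr => k _; rewrite zcoord_mul_i mulrA.
Qed.

End AtPoint.

Lemma row_fixed_mx m (A : 'M[R]_m) : (forall v : 'rV[R]_m, v *m A = v) -> A = 1%:M.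
Proof. by move=> h; apply/row_matrixP => k; rewrite rowE h rowE mulmx1. Qed.

Lemma jacobianK i j p : chart_dom (at_ i) p -> chart_dom (at_ j) p ->
  real_jacobian i j p *m real_jacobian j i p = 1%:M.
Proof.
move=> dip djp; apply: row_fixed_mx => v; rewrite mulmxA !mul_jacobian //.
have st := smooth_transition dip djp.
have ss := smooth_transition djp dip; rewrite -(transition_at j dip) in ss *.
have E := derive_comp_row v (smooth_row_diff st) (smooth_row_diff ss).
apply: etrans (esym E) _.
transitivity ('D_v (id : V -> V) (chart_fwd (at_ i) p)); last exact: derive_id.
apply: near_eq_derive.
have N : \forall x \near chart_fwd (at_ i) p,
    (chart_fwd (at_ i) @` (chart_dom (at_ i) `&` chart_dom (at_ j))) x.
  by apply: open_nbhs_nbhs; split; [exact: open_overlap|exists p].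
apply: filterS N => _ [q [diq djq] <-].
by rewrite /transition /= (chart_fwdK (hat i)) // (chart_fwdK (hat j)).
Qed.

(** The real Jacobian matrix determines the holomorphic one. *)
Lemma hol_jacobianK i j p : chart_dom (at_ i) p -> chart_dom (at_ j) p ->
  hol_jacobian i j p *m hol_jacobian j i p = 1%:M.
Proof.
move=> dip djp; apply/matrixP => k b.
pose v : V := of_zrow (fun l => (l == k)%:R).
have E : zcoord b (v *m real_jacobian i j p *m real_jacobian j i p) = zcoord b v.
  by rewrite -mulmxA jacobianK // mulmx1.
rewrite zcoord_mul_jacobian // in E.
transitivity (zcoord b v); last by rewrite zcoord_of_zrow mxE eq_sym.
rewrite -E mxE; apply: eq_bigr => l _; congr (_ * _).
rewrite zcoord_mul_jacobian // (bigD1 k) //= zcoord_of_zrow eqxx mul1r.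
by rewrite big1 ?addr0 // => l' lk; rewrite zcoord_of_zrow (negPf lk) mul0r.
Qed.

Lemma pairing_jacobian i j p xi v : chart_dom (at_ i) p -> chart_dom (at_ j) p ->
  pairing (xi *m (real_jacobian j i p)^T) (v *m real_jacobian i j p) = pairing xi v.
Proof.
move=> dip djp; rewrite /pairing trmx_mul trmxK -mulmxA (mulmxA (real_jacobian i j p)).
by rewrite jacobianK // mul1mx.
Qed.

Lemma pairing_mul_trmx m (xi v : 'rV[R]_m) (A : 'M[R]_m) :
  pairing (xi *m A^T) v = pairing xi (v *m A).
Proof. by rewrite /pairing trmx_mul trmxK mulmxA. Qed.

Lemma dual_mul_i_jacobian i j p xi : chart_dom (at_ i) p -> chart_dom (at_ j) p ->
  dual_map (@mul_i R n) (xi *m (real_jacobian j i p)^T) =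
  dual_map (@mul_i R n) xi *m (real_jacobian j i p)^T.
Proof.
move=> dip djp; apply: pairing_ext => X.
rewrite pairing_mul_trmx; apply: etrans (dual_mapE _ _ _) _.
apply: etrans _ (esym (dual_mapE _ _ _)) => /=.
by rewrite pairing_mul_trmx mul_i_jacobian.
Qed.

Lemma cov_dz_jacobian i j p xi k : chart_dom (at_ i) p -> chart_dom (at_ j) p ->
  cov_dz (xi *m (real_jacobian j i p)^T) k =
  \sum_l hol_jacobian j i p k l * cov_dz xi l.
Proof.
move=> dip djp; move: k; apply: cov_dz_unique => X.
rewrite pairing_mul_trmx pairing_complex; congr (_ * complex.Re _).
under eq_bigr do rewrite zcoord_mul_jacobian // mulr_sumr.
rewrite exchange_big; apply: eq_bigr => k _; rewrite mulr_suml.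
by apply: eq_bigr => l _; ring.
Qed.

Lemma B_map_jacobian i j p (b b' : 'M[R[i]]_n) xi :
  chart_dom (at_ i) p -> chart_dom (at_ j) p ->
  b' = (hol_jacobian i j p)^T *m b *m hol_jacobian i j p ->
  B_map b' (xi *m (real_jacobian j i p)^T) = B_map b xi *m real_jacobian i j p.
Proof.
move=> dip djp bE; apply: zcoordP => l.
rewrite zcoord_B_map zcoord_mul_jacobian //.
pose c := \row_k cov_dz xi k.
transitivity ((c *m (hol_jacobian j i p)^T *m b') 0 l).
  rewrite mxE; apply: eq_bigr => k _; rewrite mulrC; congr (_ * _).
  by rewrite cov_dz_jacobian // mxE; apply: eq_bigr => h _; rewrite !mxE mulrC.
transitivity ((c *m b *m hol_jacobian i j p) 0 l).
  rewrite bE; move: (hol_jacobianK dip djp).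
  move: (hol_jacobian i j p) (hol_jacobian j i p) => K H KH.
  have -> : c *m H^T *m (K^T *m b *m K) = c *m (H^T *m K^T) *m b *m K by rewrite !mulmxA.
  by rewrite -trmx_mul KH trmx1 mulmx1.
rewrite mxE; apply: eq_bigr => k _; congr (_ * _).
by rewrite zcoord_B_map mxE; apply: eq_bigr => h _; rewrite mxE mulrC.
Qed.

End Transitions.

(** * Sections of the Courant algebroid and the endomorphism field *)

Section Courant.
Context {R : realType} {n : nat} (M : complex_manifold R n) (m0 : M).
Context (g : quadratic_lie_algebra R).
Local Notation V := 'rV[R]_(n + n).
Local Notation I := (atlas_index M).
Local Notation at_ i := (@atlas R n M i).
Local Notation E := (V * V * g)%type.
Local Notation ii := (Complex 0 1 : R[i]).
Variables (beta : I -> M -> 'M[R[i]]_n) (Jg : 'End(g)) (rho : (R -> M) -> 'End(g)).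
Hypothesis hbeta : holomorphic_poisson beta.
Hypothesis hJg : skew_complex_structure Jg.
Hypothesis hrho : pi1_representation m0 Jg rho.
Implicit Types (i j : I) (c d gamma : R -> M) (u v : field M E).

Let hat i : is_chart (at_ i) := atlas_chart i.
Local Notation JJ := (poisson_gcs beta Jg).

Lemma gcs_map_linear (b : 'M[R[i]]_n) : linear (gcs_map b Jg).
Proof.
move=> k x y; rewrite /gcs_map.
have h (A B : V) (a1 a2 : V) (r1 r2 : g) :
    k *: ((A, a1, r1) : E) + (B, a2, r2) = (k *: A + B, k *: a1 + a2, k *: r1 + r2) by [].
rewrite h; congr (_, _, _).
- by rewrite !linearP scalerDr addrACA.
- by rewrite linearP opprD scalerN.
- by rewrite linearP.
Qed.

Lemma poisson_gcsE i c (w : E) : JJ i c w = gcs_map (beta i (c 1)) Jg w.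
Proof.
pose L : {linear E -> E} := HB.pack (gcs_map (beta i (c 1)) Jg)
  (GRing.isLinear.Build R E E *:%R _ (gcs_map_linear (beta i (c 1)))).
exact: (lfunE L w).
Qed.

Lemma beta_local_hol i k l x : chart_img (at_ i) x ->
  hol_at x (fun y => beta i (chart_bwd (at_ i) y) k l).
Proof.
have [_ _ hb _] := hbeta; have [_ oi _ _ _] := hat i.
exact: ((holomorphic_onP _ oi).1 (hb i k l) x).
Qed.

Lemma beta_local_skew i x : chart_img (at_ i) x ->
  \forall y \near x, (beta i (chart_bwd (at_ i) y))^T = - beta i (chart_bwd (at_ i) y).
Proof.
have [hb _ _ _] := hbeta; have [_ oi _ _ _] := hat i => ix.
apply: filterS (open_nbhs_nbhs (conj oi ix)) => y iy.
by apply: hb; exact: chart_bwd_dom.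
Qed.

Lemma beta_local_poisson i x : chart_img (at_ i) x ->
  poisson_at (fun y => beta i (chart_bwd (at_ i) y)) x.
Proof. by have [_ _ _ hb] := hbeta => ix j k l; exact: hb. Qed.

Lemma local_end_near i c : is_frame m0 i c -> \forall x \near coords i c,
  [/\ is_frame m0 i (path_cat c (segment i c x)),
      path_cat c (segment i c x) 1 = chart_bwd (at_ i) x &
      coords i (path_cat c (segment i c x)) = x].
Proof.
move=> fc; have [e e0 sub] := frame_ball fc.
apply: filterS (nbhsx_ballx _ _ e0) => x bx.
split; [exact: (local_frame fc e0 sub bx)|exact: (local_frame_end fc e0 sub bx)|].
exact: (local_frame_coords fc e0 sub bx).
Qed.

Lemma frame_img i c : is_frame m0 i c -> chart_img (at_ i) (coords i c).
Proof. by move=> [_ dc]; exact: chart_img_fwd. Qed.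

Lemma frame_bwd i c : is_frame m0 i c -> chart_bwd (at_ i) (coords i c) = c 1.
Proof. by move=> [_ dc]; exact: chart_fwdK. Qed.

Lemma section_smooth u i c : is_section m0 rho u -> is_frame m0 i c ->
  smooth_vect (coords i c) (local u i c).
Proof. by move=> [_ _ su] fc; apply/smooth_atP; exact: su. Qed.

Lemma dorfmanE u v i c :
  dorfman u v i c = local_dorfman (coords i c) (local u i c) (local v i c).
Proof. by []. Qed.

(** The transformation law of sections is given frame by frame; the homotopy between
    segments of the two charts makes it an identity between local expressions, which
    can be differentiated. *)
Lemma section_transported u i j gamma c : is_section m0 rho u ->
  is_loop m0 gamma -> is_frame m0 i c -> chart_dom (at_ j) (c 1) ->
  \forall x \near coords i c,
    transported (transition (at_ i) (at_ j)) (rho gamma) x (local u i c x)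
      (local u j (path_cat gamma c) (transition (at_ i) (at_ j) x)).
Proof.
move=> [hu eu _] lg fc djc.
apply: filterS2 (local_transport fc hu lg djc) (local_end_near fc)
  => x [fx cx djx ->] [_ _ kx].
have dix : chart_dom (at_ i) (chart_bwd (at_ i) x) by rewrite -cx; case: fx.
have xE : chart_fwd (at_ i) (chart_bwd (at_ i) x) = x by rewrite -cx.
rewrite (eu i j gamma _ lg fx) ?cx // /frame_change -/(local u i c x).
have T w : w *m real_jacobian i j (chart_bwd (at_ i) x) = 'D_w (transition (at_ i) (at_ j)) x.
  by rewrite mul_jacobian // xE.
split=> /=; [exact: T| |by []] => w.
by apply: etrans (congr1 (pairing _) (esym (T w))) _; exact: pairing_jacobian.
Qed.

Lemma path_cat_loop i j gamma c : is_loop m0 gamma -> is_frame m0 i c ->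
  chart_dom (at_ j) (c 1) -> is_frame m0 j (path_cat gamma c).
Proof.
move=> lg [pc _] djc; split; rewrite path_cat1 //; exact: is_path_cat lg pc.
Qed.

(** Homotopy invariance holds because the local expressions agree, equivariance is
    [local_dorfman_transport], and smoothness follows as the brackets at nearby frames
    come from a single pair of local expressions. *)
Lemma dorfman_section u v : is_section m0 rho u -> is_section m0 rho v ->
  is_section m0 rho (dorfman u v).
Proof.
move=> su sv; have [hu eu _] := su; have [hv ev _] := sv.
split.
- move=> i c d fc pd hcd.
  have E : coords i c = coords i d by rewrite /coords (homotopic_end hcd).
  rewrite !dorfmanE -E; apply: local_dorfman_eq.
    exact: (local_homotopic fc hu pd hcd).
  exact: (local_homotopic fc hv pd hcd).
- move=> i j gamma c lg fc djc; have [_ dic] := fc.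
  have fj := path_cat_loop lg fc djc.
  have tE : transition (at_ i) (at_ j) (coords i c) = coords j (path_cat gamma c).
    by rewrite /transition /= frame_bwd // /coords path_cat1.
  have st := smooth_transition dic djc.
  have sju := section_smooth su fj; have sjv := section_smooth sv fj.
  have [aut _ _] := hrho; have [_ rbr rsp _] := aut _ lg.
  rewrite -tE in sju sjv.
  have [t1 t2 t3] := local_dorfman_transport st rbr rsp (section_smooth su fc)
    (section_smooth sv fc) sju sjv (section_transported su lg fc djc)
    (section_transported sv lg fc djc).
  rewrite [LHS]dorfmanE -tE [in RHS]dorfmanE.
  rewrite [LHS]surjective_pairing [X in (X, _) = _]surjective_pairing /frame_change.
  apply: (congr2 pair (congr2 pair _ _) t3).
    by apply: etrans t1 _; apply: esym; exact: mul_jacobian.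
  apply: pairing_ext => X; rewrite pairing_mul_trmx.
  apply: etrans _ (t2 (X *m real_jacobian j i (c 1))); apply: (congr1 (pairing _)).
  apply: etrans _ (mul_jacobian dic djc _).
  by rewrite -mulmxA jacobianK // mulmx1.
- move=> i c fc; apply/smooth_atP.
  have [e e0 sub] := frame_ball fc.
  apply: smooth_vect_eq (smooth_vect_local_dorfman (section_smooth su fc) (section_smooth sv fc)).
  have B : \forall x \near coords i c, ball (coords i c) e x := nbhsx_ballx _ _ e0.
  have N : \forall x \near coords i c, \forall y \near x, ball (coords i c) e y.
    by apply: near_join.
  apply: filterS2 B N => x bx Nx.
  rewrite /local -/(local u i c) -/(local v i c) dorfmanE (local_frame_coords fc e0 sub bx).
  apply: local_dorfman_eq; apply: filterS Nx => y by_; apply: esym;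
    exact: (local_local fc e0 sub).
Qed.

Lemma frame_change_sub i j gamma p (w z : E) :
  frame_change rho i j gamma p (w - z) =
  frame_change rho i j gamma p w - frame_change rho i j gamma p z.
Proof.
case: w z => [[X xi] r] [[Y eta] s].
by rewrite /frame_change /= !mulmxBl linearB.
Qed.

Lemma frame_change_add i j gamma p (w z : E) :
  frame_change rho i j gamma p (w + z) =
  frame_change rho i j gamma p w + frame_change rho i j gamma p z.
Proof.
case: w z => [[X xi] r] [[Y eta] s].
by rewrite /frame_change /= !mulmxDl linearD.
Qed.

Lemma section_sub u v : is_section m0 rho u -> is_section m0 rho v ->
  is_section m0 rho (u - v).
Proof.
move=> [hu eu su] [hv ev sv]; split.
- by move=> i c d fc pd hcd; apply: (congr2 (fun p q : E => p - q)); [exact: hu|exact: hv].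
- move=> i j gamma c lg fc djc; apply: esym; apply: etrans (frame_change_sub _ _ _ _ _ _) _.
  by apply: esym; apply: (congr2 (fun p q : E => p - q)); [exact: eu|exact: ev].
- move=> i c fc; apply/smooth_atP.
  by apply: smooth_vect_sub; apply/smooth_atP; [exact: su|exact: sv].
Qed.

Lemma section_add u v : is_section m0 rho u -> is_section m0 rho v ->
  is_section m0 rho (u + v).
Proof.
move=> [hu eu su] [hv ev sv]; split.
- by move=> i c d fc pd hcd; apply: (congr2 (fun p q : E => p + q)); [exact: hu|exact: hv].
- move=> i j gamma c lg fc djc; apply: esym; apply: etrans (frame_change_add _ _ _ _ _ _) _.
  by apply: esym; apply: (congr2 (fun p q : E => p + q)); [exact: eu|exact: ev].
- move=> i c fc; apply/smooth_atP.
  by apply: smooth_vect_add; apply/smooth_atP; [exact: su|exact: sv].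
Qed.

Lemma mul_iD (x y : V) : mul_i (x + y) = mul_i x + mul_i y.
Proof. exact: (linearD (@mul_i R n)). Qed.

Lemma gcs_mapK (b : 'M[R[i]]_n) (w : E) : gcs_map b Jg (gcs_map b Jg w) = - w.
Proof.
have [JJg _ _] := hJg; case: w => [[X xi] r]; rewrite /gcs_map /=.
rewrite JJg mul_iD mul_iK mul_i_B_map.
have -> : B_map b (- dual_map (@mul_i R n) xi) = - B_map b (dual_map (@mul_i R n) xi).
  exact: (linearN (B_map b)).
have -> : dual_map (@mul_i R n) (- dual_map (@mul_i R n) xi) = xi.
  apply: etrans (linearN (dual_map (@mul_i R n)) _) _.
  by rewrite /= dual_mul_iK opprK.
by rewrite addrK.
Qed.

Lemma gcs_map_skew (b : 'M[R[i]]_n) (w z : E) : b^T = - b ->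
  courant_sp (gcs_map b Jg w) z = - courant_sp w (gcs_map b Jg z).
Proof.
move=> bT; have [_ Jskew _] := hJg.
case: w z => [[X xi] r] [[Y eta] s]; rewrite /courant_sp /gcs_map /=.
have D (x y : V) : pairing (dual_map (@mul_i R n) x) y = pairing x (mul_i y) by exact: dual_mapE.
rewrite !(pairingDr, pairingNl) !D (B_map_skew xi eta bT) Jskew.
move: (pairing _ _ : R) (pairing _ _ : R) (pairing _ _ : R) (qla_sp _ _) => p q t z.
by ring.
Qed.

Lemma gcs_map_frame_change i j gamma c (w : E) : is_loop m0 gamma ->
  is_frame m0 i c -> chart_dom (at_ j) (c 1) ->
  gcs_map (beta j (c 1)) Jg (frame_change rho i j gamma (c 1) w) =
  frame_change rho i j gamma (c 1) (gcs_map (beta i (c 1)) Jg w).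
Proof.
move=> lg [_ dic] djc; have [aut _ _] := hrho; have [_ _ _ rJ] := aut _ lg.
have [_ hb _ _] := hbeta.
rewrite /gcs_map /frame_change /= rJ mulmxDl mulNmx mul_i_jacobian // dual_mul_i_jacobian //.
by rewrite (B_map_jacobian _ dic djc (hb i j _ dic djc)).
Qed.

(** Applied to a fixed vector, the structure depends smoothly on the entries of the
    bivector. *)
Lemma smooth_gcs_field : smooth_field m0 JJ.
Proof.
move=> i c fc; apply/smooth_atP; apply: smooth_vect_End => w.
have ic := frame_img fc.
have hb k l := beta_local_hol k l ic.
have sw : smooth_vect (coords i c) (fun _ : V => w) by move=> k; exact: smooth_germ_cst.
apply: smooth_vect_eq (smooth_gcs_map hb Jg sw).
by apply: filterS (local_end_near fc) => x [_ cx _]; rewrite /local poisson_gcsE cx.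
Qed.

End Courant.

(** * The generalised complex structure *)

Section Structure.
Context {R : realType} {n : nat} (M : complex_manifold R n) (m0 : M).
Context (g : quadratic_lie_algebra R).
Local Notation V := 'rV[R]_(n + n).
Local Notation I := (atlas_index M).
Local Notation at_ i := (@atlas R n M i).
Local Notation E := (V * V * g)%type.
Variables (beta : I -> M -> 'M[R[i]]_n) (Jg : 'End(g)) (rho : (R -> M) -> 'End(g)).
Hypothesis hbeta : holomorphic_poisson beta.
Hypothesis hJg : skew_complex_structure Jg.
Hypothesis hrho : pi1_representation m0 Jg rho.
Local Notation JJ := (poisson_gcs beta Jg).
Implicit Types (i j : I) (c d gamma : R -> M) (u v : field M E).

Lemma gcs_end_section : is_end_section m0 rho JJ.
Proof.
split.
- by move=> i c d _ _ hcd; rewrite /poisson_gcs (homotopic_end hcd).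
- move=> i j gamma c lg fc djc w; rewrite !poisson_gcsE path_cat1.
  exact: (gcs_map_frame_change hbeta hrho w lg fc djc).
- exact: smooth_gcs_field hbeta.
Qed.

(** An eigensection [u.1 + i u.2] is determined by its imaginary part, since
    [u.1 = T u.2]: closure under the bracket becomes the vanishing of the
    Nijenhuis torsion of [T] on imaginary parts. *)
Lemma gcs_involutive (u v : field M E * field M E) :
  is_eigensection m0 rho JJ u -> is_eigensection m0 rho JJ v ->
  is_eigensection m0 rho JJ (complexified_bracket (@dorfman R n M g) u v).
Proof.
move=> [su1 su2 eu] [sv1 sv2 ev]; split.
- by apply: section_sub; exact: (dorfman_section hrho).
- by apply: section_add; exact: (dorfman_section hrho).
move=> i c fc; set a := coords i c.
pose b x := beta i (chart_bwd (at_ i) x).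
have ia := frame_img fc.
have near_eq (z : field M E * field M E) :
    (forall i c, is_frame m0 i c -> i_eigen (JJ i c) (z.1 i c, z.2 i c)) ->
    \forall x \near a, local z.1 i c x = gcs_map (b x) Jg (local z.2 i c x).
  move=> ez; apply: filterS (local_end_near fc) => x [fx cx _].
  have [_ /= E1] := ez _ _ fx.
  by rewrite /local -E1 poisson_gcsE cx.
have Eu := near_eq u eu; have Ev := near_eq v ev.
have nearid (f : V -> E) : \forall x \near a, f x = f x by near=> x.
have N := gcs_nijenhuis (fun k l => beta_local_hol hbeta k l ia) (beta_local_skew hbeta ia) hJg
  (beta_local_poisson hbeta ia) (section_smooth su2 fc) (section_smooth sv2 fc).
rewrite /= (frame_bwd fc) in N.
have E2 : JJ i c ((dorfman u.1 v.2 + dorfman u.2 v.1) i c) =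
    (dorfman u.1 v.1 - dorfman u.2 v.2) i c.
  apply: etrans (poisson_gcsE _ _ _ _ _) _.
  apply: etrans (etrans _ N) _; last apply: esym.
    apply: congr1; exact: (congr2 (fun p q : E => p + q)
      (local_dorfman_eq Eu (nearid _)) (local_dorfman_eq (nearid _) Ev)).
  exact: (congr2 (fun p q : E => p - q) (local_dorfman_eq Eu Ev) erefl).
split; last exact: E2.
by rewrite /= -E2 !poisson_gcsE gcs_mapK.
Unshelve. all: by end_near. Qed.

Lemma gcs_generalised_complex : generalised_complex m0 rho JJ.
Proof.
have [hb _ _ _] := hbeta.
split; [exact: gcs_end_section|..|exact: gcs_involutive].
- move=> i c [_ dc] w z; rewrite !poisson_gcsE.
  exact: (gcs_map_skew hJg _ _ (hb i _ dc)).
- by move=> i c _ w; rewrite !poisson_gcsE gcs_mapK.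
Qed.

Lemma gcs_components : has_components m0 JJ (fun _ _ => @mul_i R n)
  (fun i p => B_map (beta i p)) (fun _ => Jg)
  (fun _ _ _ => 0) (fun _ _ _ => 0) (fun _ _ _ => 0).
Proof.
move=> i c fc; split; split=> x.
- rewrite /comp_J poisson_gcsE /gcs_map /= (linear0 (B_map (beta i (c 1)))).
  by rewrite addr0.
- by rewrite /comp_B poisson_gcsE /gcs_map /= (linear0 (@mul_i R n)) add0r.
- by rewrite /comp_A poisson_gcsE.
- by rewrite /comp_C poisson_gcsE /gcs_map /= (linear0 (dual_map (@mul_i R n))) oppr0.
- by rewrite /comp_mu poisson_gcsE /gcs_map /= linear0.
- by rewrite /comp_nu poisson_gcsE /gcs_map /= linear0.
Qed.

Lemma gcs_parallel : parallel_complex_structure m0 rho (fun _ => Jg).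
Proof.
have [aut _ _] := hrho.
split=> //.
- by move=> gamma c lg _ x; have [_ _ _ ->] := aut _ lg.
- by move=> i c _; apply/smooth_atP => k; exact: (smooth_germ_cst _ (vcoord k Jg)).
- move=> i c _ v; apply: big1 => k _.
  have D0 := derive_cst (vcoord k Jg : R^o) (coords i c) v.
  exact: etrans (congr1 (fun z : R => z *: _) D0) (scale0r _).
Qed.

(** The determinant is a polynomial in the entries, and [beta] transforms by a
    congruence with the complex Jacobian matrix. *)
Lemma det_beta_holomorphic : holomorphic_anticanonical_sq (det_beta beta).
Proof.
have [_ hb _ _] := hbeta.
split=> [i|i j p dip djp].
  have [_ oi _ _ _] := atlas_chart i.
  apply/(holomorphic_onP _ oi) => x ix.
  by apply: hol_det => k l; exact: (beta_local_hol hbeta).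
by rewrite /det_beta (hb i j p dip djp) !det_mulmx det_tr mulrAC expr2.
Qed.

(** The condition [nondegenerate_at] at [p] quantifies over paths ending at [p]: it
    would hold vacuously at the zeros of [det beta] if [M] were not path connected. *)
Lemma gcs_nondegenerate_locus :
  [set p | nondegenerate_at m0 JJ p] = ~` zero_locus (det_beta beta).
Proof.
have B_E i c w : comp_B (JJ i c) w = B_map (beta i (c 1)) w.
  by rewrite /comp_B poisson_gcsE /gcs_map /= (linear0 (@mul_i R n)) add0r.
apply/seteqP; split=> p /=.
  move=> nd [i dip det0]; have [c pc] := path_connected m0 p.
  have [_ _ c1] := pc.
  have fc : is_frame m0 i c by split; rewrite c1.
  have := eq_bij (nd i c fc c1) (B_E i c).
  by rewrite c1 => /B_map_bijective; rewrite -/(det_beta beta i p) det0 eqxx.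
move=> nz i c [_ dic] cp.
apply: eq_bij (fun w => esym (B_E i c w)).
apply/B_map_bijective/eqP => det0; apply: nz; exists i; rewrite -cp //.
Qed.

End Structure.

Theorem proposition25 (R : realType) (n : nat) (M : complex_manifold R n) (m0 : M)
    (beta : atlas_index M -> M -> 'M[R[i]]_n)
    (hbeta : holomorphic_poisson beta)
    (g : quadratic_lie_algebra R) (Jg : 'End(g))
    (hJg : skew_complex_structure Jg)
    (rho : (R -> M) -> 'End(g))
    (hrho : pi1_representation m0 Jg rho) :
  let JJ := poisson_gcs beta Jg in
  let A := fun _ : R -> M => Jg in
  [/\ generalised_complex m0 rho JJ,
      has_components m0 JJ (fun _ _ => mul_i) (fun i p => B_map (beta i p)) A
        (fun _ _ _ => 0) (fun _ _ _ => 0) (fun _ _ _ => 0),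
      parallel_complex_structure m0 rho A,
      holomorphic_anticanonical_sq (det_beta beta) &
      [set p | nondegenerate_at m0 JJ p] = ~` zero_locus (det_beta beta)].
Proof.
move=> JJ A; split.
- exact: gcs_generalised_complex.
- exact: gcs_components.
- exact: gcs_parallel.
- exact: det_beta_holomorphic.
- exact: gcs_nondegenerate_locus.
Qed.
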